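(* Let $\lambda\in\{1,-1\}$ and let $q(x,t)=\epsilon q_1(x,t)+\epsilon^2q_2(x,t)+\cdots$ be the perturbative solution (in the small parameter $\epsilon>0$) of the NLS equation $iq_t+q_{xx}-2\lambda|q|^2q=0$ on the half-line $x>0$ satisfying $q(x,0)=0$ for $x>0$ and $q(0,t)=\epsilon g_{01}(t)+\epsilon^2g_{02}(t)+\cdots$, where the $g_{0n}$ are sufficiently smooth with $g_{0n}(0)=\dot g_{0n}(0)=\ddot g_{0n}(0)=\cdots=0$ for all $n\ge1$. Write $q_x(0,t)=\epsilon g_{11}(t)+\epsilon^2g_{12}(t)+\epsilon^3g_{13}(t)+\cdots$. Then, with $c=\frac{\sqrt\pi}{2}e^{-i\pi/4}$, $$g_{11}(t)=-\frac{e^{-i\pi/4}}{\sqrt\pi}\int_0^t\frac{\dot g_{01}(t')}{\sqrt{t-t'}}dt',\qquad g_{12}(t)=-\frac{e^{-i\pi/4}}{\sqrt\pi}\int_0^t\frac{\dot g_{02}(t')}{\sqrt{t-t'}}dt',$$ and $$\begin{aligned}g_{13}(t)=\;&\frac{2\lambda c}{\pi i}\int_0^t\frac{|g_{01}(t')|^2g_{01}(t')}{\sqrt{t-t'}}dt'-\frac{2\lambda c}{\pi i}\int_0^t|g_{01}(t')|^2\int_0^{t'}\frac{\dot g_{01}(t'')}{\sqrt{t-t''}}dt''dt'-\frac{2c}{\pi}\int_0^t\frac{\dot g_{03}(t')}{\sqrt{t-t'}}dt'\\&-\frac{\lambda c}{\pi i}\int_0^tg_{01}(t')\int_0^{t'}\bar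 g_{01}(t'')\int_0^{t''}\frac{\dot g_{01}(t''')}{(t-t'+t''-t''')^{3/2}}dt'''dt''dt'\\&+\frac{\lambda c}{\pi}\int_0^tg_{01}(t')\int_0^{t'}\bar g_{11}(t'')\int_0^{t''}\frac{g_{11}(t''')}{(t-t'+t''-t''')^{3/2}}dt'''dt''dt'\\&-\frac{\lambda c}{\pi}\int_0^tg_{11}(t')\int_0^{t'}\bar g_{01}(t'')\int_0^{t''}\frac{g_{11}(t''')}{(t-t'+t''-t''')^{3/2}}dt'''dt''dt'\\&+\frac{\lambda c}{\pi}\int_0^tg_{11}(t')\int_0^{t'}\bar g_{11}(t'')\int_0^{t''}\frac{g_{01}(t''')}{(t-t'+t''-t''')^{3/2}}dt'''dt''dt'\\&+i\lambda g_{01}(t)\int_0^t\big[\bar g_{01}(t')g_{11}(t')-\bar g_{11}(t')g_{01}(t')\big]dt'.\end{aligned}$$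
   Context: Dots denote derivatives with respect to $t$ and bars denote complex conjugation. The perturbative solution means the formal expansion in powers of $\epsilon$ obtained by substituting the series into the equation and the initial and boundary conditions and equating powers of $\epsilon$. *)

(* Defs.v *)
From HB Require Import structures.
From mathcomp Require Import all_boot all_order all_algebra.
From mathcomp Require Import all_classical all_reals all_analysis.
From mathcomp Require Import complex.
Import Order.TTheory GRing.Theory Num.Theory numFieldNormedType.Exports.

Set Implicit Arguments.
Unset Strict Implicit.
Unset Printing Implicit Defensive.

Local Open Scope ring_scope.

Section Defs.
Variable R : realType.

(* the imaginary unit i = 0 + 1 i of R[i] (stated explicitly to avoid the
   generic Num.imaginary) *)
Definition iC : R[i] := Complex 0 1.

Definition ReF (f : R -> R[i]) : R -> R := fun s => complex.Re (f s).
Definition ImF (f : R -> R[i]) : R -> R := fun s => complex.Im (f s).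

Definition cderivable (f : R -> R[i]) (x : R) : Prop :=
  derivable (ReF f) x 1 /\ derivable (ImF f) x 1.

(* the derivative f'(x) of f : R -> C (meaningful when cderivable f x) *)
Definition cderive (f : R -> R[i]) (x : R) : R[i] :=
  Complex (derive1 (ReF f) x) (derive1 (ImF f) x).

Definition csmooth (f : R -> R[i]) : Prop :=
  forall (n : nat) (x : R),
    derivable (derive1n n (ReF f)) x 1 /\ derivable (derive1n n (ImF f)) x 1.

Definition cflat_at0 (f : R -> R[i]) : Prop :=
  forall n : nat, derive1n n (ReF f) 0 = 0 /\ derive1n n (ImF f) 0 = 0.

Definition cint (a b : R) (f : R -> R[i]) : R[i] :=
  Complex (Rintegral lebesgue_measure `[a, b]%classic (ReF f))
          (Rintegral lebesgue_measure `[a, b]%classic (ImF f)).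

Definition cmod (z : R[i]) : R :=
  Num.sqrt (complex.Re z ^+ 2 + complex.Im z ^+ 2).

Definition dx (q : R -> R -> R[i]) (x t : R) : R[i] := cderive (fun y => q y t) x.
Definition dxx (q : R -> R -> R[i]) (x t : R) : R[i] := cderive (fun y => dx q y t) x.
Definition dt (q : R -> R -> R[i]) (x t : R) : R[i] := cderive (q x) t.

Definition jcont (u : R -> R -> R[i]) : Prop :=
  (forall p : R * R, {for p, continuous (fun p : R * R => complex.Re (u p.1 p.2))}) /\
  (forall p : R * R, {for p, continuous (fun p : R * R => complex.Im (u p.1 p.2))}).

Definition classical_reg (q : R -> R -> R[i]) : Prop :=
  (forall x t, cderivable (fun y => q y t) x) /\
  (forall x t, cderivable (fun y => dx q y t) x) /\
  (forall x t, cderivable (q x) t) /\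
  jcont q /\ jcont (dx q) /\ jcont (dxx q) /\ jcont (dt q).

Definition decaying (q : R -> R -> R[i]) : Prop :=
  forall T : R, 0 < T -> exists C : R, forall x t : R,
    0 <= x -> 0 <= t <= T ->
    cmod (q x t) + cmod (dx q x t) + cmod (dxx q x t) + cmod (dt q x t) <= C / (1 + x) ^+ 2.

Definition forced_lin_schr (F : R -> R -> R[i]) (g : R -> R[i])
  (q : R -> R -> R[i]) : Prop :=
  classical_reg q /\ decaying q /\
  (forall x t, 0 < x -> 0 < t -> iC * dt q x t + dxx q x t = F x t) /\
  (forall x, 0 <= x -> q x 0 = 0) /\
  (forall t, 0 <= t -> q 0 t = g t).

(* The first three terms q1, q2, q3 of the perturbative solution
   q = eps q1 + eps^2 q2 + eps^3 q3 + ... of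
   i q_t + q_xx - 2 lam |q|^2 q = 0 on the half-line, with q(x,0) = 0 and
   q(0,t) = eps g01 + eps^2 g02 + eps^3 g03 + ... :
   equating powers of eps gives
     O(eps)  : i q1_t + q1_xx = 0,                  q1(0,t) = g01(t)
     O(eps^2): i q2_t + q2_xx = 0,                  q2(0,t) = g02(t)
     O(eps^3): i q3_t + q3_xx = 2 lam |q1|^2 q1,    q3(0,t) = g03(t)
   all with zero initial data. *)
Definition perturbative_sol (lam : R) (g01 g02 g03 : R -> R[i])
  (q1 q2 q3 : R -> R -> R[i]) : Prop :=
  forced_lin_schr (fun _ _ => 0) g01 q1 /\
  forced_lin_schr (fun _ _ => 0) g02 q2 /\
  forced_lin_schr
    (fun x t => (2 * lam)%:C%C * (q1 x t * conjc (q1 x t)) * q1 x t) g03 q3.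

Definition e_mipi4 : R[i] := Complex (cos (- (pi / 4))) (sin (- (pi / 4))).

Definition c_nls : R[i] := (Num.sqrt pi / 2)%:C%C * e_mipi4.

Definition ker12 (t s : R) : R[i] := ((Num.sqrt (t - s))^-1)%:C%C.

Definition ker32 (a : R) : R[i] := ((a `^ (3 / 2))^-1)%:C%C.

End Defs.

(* Main.v *)
(** Let [k = (t - i d)^(-1/2)]: the Gaussian [k exp (i x^2 k^2 / 4)] solves the
    free Schrodinger equation and is smooth for [d > 0]. Green's identity on the
    half-line against its [x]-derivative expresses the Neumann trace of a forced
    linear Schrodinger equation through its Dirichlet trace and the integral of
    the forcing against the kernel. For [q3] the forcing [2 l |q1|^2 q1] lives in
    the whole quarter plane; adding [l] times the cubic normal form
    [S(y) = \int_0^y q1(u) P(u, y) du], [P(u, y) = \int_u^oo conj q1(v) q1(v + y - u) dv],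
    trades it for boundary values of [q1] times functions of [y] that solve linear
    Schrodinger equations themselves, so a second application of Green's identity
    makes every integral in [x] explicit. Dominated convergence then gives [d -> 0]. *)
Require Import Defs.
From HB Require Import structures.
From mathcomp Require Import all_boot all_order all_algebra.
From mathcomp Require Import all_classical all_reals all_analysis.
From mathcomp Require Import complex.
From mathcomp Require Import measurable_realfun gauss_integral ring lra.
Import Order.TTheory GRing.Theory Num.Theory numFieldNormedType.Exports.
Set Implicit Arguments.
Unset Strict Implicit.
Unset Printing Implicit Defensive.
Local Open Scope classical_set_scope.
Local Open Scope ring_scope.
Local Open Scope complex_scope.

(** The obstacle is that [|q1|^2 q1] is not a free solution, so Green's identity does not express
    its pairing with the kernel by boundary values. The normal form helps because shifting u and y
    together only moves the lower limit of P: [P_u + P_y = - conj q1(u) q1(y)]. In [i S_t + S_yy]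
    all integrals over u then cancel, leaving [-2 |q1|^2 q1] and terms whose coefficients are values
    at u = 0. P is encoded as the time integral of its flux at v = u, which is the same by the
    equation and the zero initial data, needs no improper integral, and at u = 0 has boundary values
    as coefficients. In the kernel of the triple integrals, t - t' is the time left after the
    forcing acts and t'' - t''' is the lag of the second use of Green's identity; they add because
    the kernel at lag t - t' is continued backwards in time. The last term of g13 is the Neumann
    trace of l S, namely l q1(0) P(0, 0), moved to the other side. A positive d keeps the kernels
    bounded in x at all times, so the decay of the solutions alone justifies every exchange of limit
    and integral; the limit survives because the cubed kernel integrates to order (t -
    t')^(-1/2). *)

Section ComplexBasics.
Context {R : realType}.
Implicit Types z w : R[i].

Lemma cReD z w : complex.Re (z + w) = complex.Re z + complex.Re w.
Proof. by case: z; case: w. Qed.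
Lemma cImD z w : complex.Im (z + w) = complex.Im z + complex.Im w.
Proof. by case: z; case: w. Qed.
Lemma cReN z : complex.Re (- z) = - complex.Re z.
Proof. by case: z. Qed.
Lemma cImN z : complex.Im (- z) = - complex.Im z.
Proof. by case: z. Qed.
Lemma cReM z w : complex.Re (z * w) =
  complex.Re z * complex.Re w - complex.Im z * complex.Im w.
Proof. by case: z; case: w. Qed.
Lemma cImM z w : complex.Im (z * w) =
  complex.Re z * complex.Im w + complex.Im z * complex.Re w.
Proof. by case: z; case: w. Qed.
Lemma cReC z : complex.Re (conjc z) = complex.Re z.
Proof. by case: z. Qed.
Lemma cImC z : complex.Im (conjc z) = - complex.Im z.
Proof. by case: z. Qed.
Lemma complex_ext z w : complex.Re z = complex.Re w -> complex.Im z = complex.Im w -> z = w.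
Proof. by case: z => a b; case: w => c d /= -> ->. Qed.

Lemma iC_sqr : @iC R * @iC R = -1.
Proof. by apply: complex_ext; rewrite /= ?mulr0 ?mul0r ?mulr1 ?mul1r ?addr0 ?sub0r ?oppr0. Qed.

Lemma conjc_iC : conjc (@iC R) = - @iC R.
Proof. by apply: complex_ext => /=; rewrite ?oppr0. Qed.

Lemma conjcM z w : conjc (z * w) = conjc z * conjc w.
Proof. by apply: complex_ext; rewrite ?(cReC, cImC, cReM, cImM); ring. Qed.
Lemma conjcN z : conjc (- z) = - conjc z.
Proof. by apply: complex_ext; rewrite ?(cReC, cImC, cReN, cImN). Qed.

Lemma cmodE z : cmod z = ComplexField.Normc.normc z.
Proof. by case: z. Qed.
Lemma cmod_ge0 z : 0 <= cmod z. Proof. exact: sqrtr_ge0. Qed.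
Lemma cmodM z w : cmod (z * w) = cmod z * cmod w.
Proof. by rewrite !cmodE ComplexField.Normc.normcM. Qed.
Lemma cmod_normE z : (cmod z)%:C = `|z|.
Proof. by rewrite cmodE; case: z. Qed.
Lemma cmodD z w : cmod (z + w) <= cmod z + cmod w.
Proof.
have := ler_normD z w.
by rewrite -!cmod_normE -rmorphD /= lecR.
Qed.
Lemma cmodN z : cmod (- z) = cmod z.
Proof. by rewrite /cmod cReN cImN !sqrrN. Qed.
Lemma cmodB z w : cmod (z - w) <= cmod z + cmod w.
Proof. by rewrite -(cmodN w) cmodD. Qed.
Lemma cmod_conjc z : cmod (conjc z) = cmod z.
Proof. by rewrite /cmod cReC cImC !sqrrN. Qed.
Lemma cmod0 : cmod (0 : R[i]) = 0.
Proof. by rewrite /cmod /= expr0n addr0 sqrtr0. Qed.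
Lemma cmod_real (a : R) : cmod a%:C = `|a|.
Proof. by rewrite /cmod /= expr0n addr0 sqrtr_sqr. Qed.
Lemma cmod_iC : cmod (@iC R) = 1.
Proof. by rewrite /cmod /= expr0n add0r expr1n sqrtr1. Qed.
Lemma cmodX z n : cmod (z ^+ n) = cmod z ^+ n.
Proof.
elim: n => [|n IH]; last by rewrite !exprS cmodM IH.
by rewrite !expr0 (_ : 1 = 1%:C)// cmod_real normr1.
Qed.
Lemma Re_le_cmod z : `|complex.Re z| <= cmod z.
Proof. by rewrite -sqrtr_sqr ler_sqrt ?lerDl ?addr_ge0 ?sqr_ge0. Qed.
Lemma Im_le_cmod z : `|complex.Im z| <= cmod z.
Proof. by rewrite -sqrtr_sqr ler_sqrt ?lerDr ?addr_ge0 ?sqr_ge0. Qed.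
Lemma cmod_le_ReIm z : cmod z <= `|complex.Re z| + `|complex.Im z|.
Proof.
have -> : z = (complex.Re z)%:C + @iC R * (complex.Im z)%:C.
  by apply: complex_ext; rewrite ?(cReD, cImD, cReM, cImM) /=; ring.
apply: (le_trans (cmodD _ _)); rewrite cmodM cmod_iC mul1r !cmod_real.
by rewrite !(cReD, cImD, cReM, cImM) /= !(mul0r, mul1r, mulr0, addr0, subr0, add0r).
Qed.

End ComplexBasics.

(** * Continuity and differentiability of complex-valued functions *)

Definition ccont {R : realType} {T : topologicalType} (f : T -> R[i]) : Prop :=
  continuous (fun x => complex.Re (f x)) /\ continuous (fun x => complex.Im (f x)).

Section ComplexContinuity.
Context {R : realType} {T : topologicalType}.
Implicit Types f g : T -> R[i].

Lemma ccont_cst (z : R[i]) : ccont (fun _ : T => z).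
Proof. by split => x; exact: cvg_cst. Qed.

Lemma ccontD f g : ccont f -> ccont g -> ccont (fun x => f x + g x).
Proof.
move=> [f1 f2] [g1 g2]; split => x.
- under [X in continuous_at _ X]eq_fun do rewrite /= cReD.
  by apply: cvgD; [exact: f1|exact: g1].
- under [X in continuous_at _ X]eq_fun do rewrite /= cImD.
  by apply: cvgD; [exact: f2|exact: g2].
Qed.

Lemma ccontN f : ccont f -> ccont (fun x => - f x).
Proof.
move=> [f1 f2]; split => x.
- under [X in continuous_at _ X]eq_fun do rewrite /= cReN.
  by apply: cvgN; exact: f1.
- under [X in continuous_at _ X]eq_fun do rewrite /= cImN.
  by apply: cvgN; exact: f2.
Qed.

Lemma ccontM f g : ccont f -> ccont g -> ccont (fun x => f x * g x).
Proof.
move=> [f1 f2] [g1 g2]; split => x.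
- under [X in continuous_at _ X]eq_fun do rewrite /= cReM.
  by apply: cvgB; apply: cvgM; [exact: f1|exact: g1|exact: f2|exact: g2].
- under [X in continuous_at _ X]eq_fun do rewrite /= cImM.
  by apply: cvgD; apply: cvgM; [exact: f1|exact: g2|exact: f2|exact: g1].
Qed.

Lemma ccontX f n : ccont f -> ccont (fun x => f x ^+ n).
Proof.
move=> cf; elim: n => [|n IH]; first exact: ccont_cst.
under eq_fun do rewrite exprS.
exact: ccontM.
Qed.

Lemma ccont_conjc f : ccont f -> ccont (fun x => conjc (f x)).
Proof.
move=> [f1 f2]; split => x.
- under [X in continuous_at _ X]eq_fun do rewrite /= cReC.
  exact: f1.
- under [X in continuous_at _ X]eq_fun do rewrite /= cImC.
  by apply: cvgN; exact: f2.
Qed.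

Lemma ccont_real (h : T -> R) : continuous h -> ccont (fun x => (h x)%:C).
Proof. by move=> ch; split => x /=; [exact: ch|exact: cvg_cst]. Qed.

Lemma ccont_comp {U : topologicalType} (f : T -> R[i]) (h : U -> T) :
  continuous h -> ccont f -> ccont (fun x => f (h x)).
Proof.
move=> ch [f1 f2]; split => x.
- exact: (@continuous_comp _ _ _ h (fun y => complex.Re (f y)) _ (ch x) (f1 _)).
- exact: (@continuous_comp _ _ _ h (fun y => complex.Im (f y)) _ (ch x) (f2 _)).
Qed.

End ComplexContinuity.

(** Continuity by recursion on the syntax of the function; [base] settles the leaves. Each rule
    receives its subfunctions explicitly, so that higher-order unification has nothing to guess. *)
Ltac ccts base := cbv beta; lazymatch goal with
  | |- ccont (fun _ => ?c) => exact: ccont_cst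
  | |- ccont (fun x => @?f x + @?g x) => refine (@ccontD _ _ f g _ _); ccts base
  | |- ccont (fun x => - @?f x) => refine (@ccontN _ _ f _); ccts base
  | |- ccont (fun x => @?f x * @?g x) => refine (@ccontM _ _ f g _ _); ccts base
  | |- ccont (fun x => conjc (@?f x)) => refine (@ccont_conjc _ _ f _); ccts base
  | |- ccont (fun x => @?f x ^+ ?n) => refine (@ccontX _ _ f n _); ccts base
  | |- _ => first [assumption | base]
  end.

Lemma ccont_pair {R : realType} {T U V : topologicalType} (f : U -> V -> R[i])
    (g : T -> U) (h : T -> V) :
  ccont (fun p : U * V => f p.1 p.2) -> continuous g -> continuous h ->
  ccont (fun x => f (g x) (h x)).
Proof.
move=> cf cg ch.
apply: (@ccont_comp _ _ _ (fun p : U * V => f p.1 p.2) (fun x => (g x, h x))) => //.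
by move=> x; apply: cvg_pair; [exact: cg|exact: ch].
Qed.

(** A relation carrying the value, so that a derivative is computed along the rules and then
    adjusted by [is_cder_eq]. It is componentwise because [cderive] is. *)
Definition is_cder {R : realType} (f : R -> R[i]) (x : R) (l : R[i]) : Prop :=
  is_derive x 1 (ReF f) (complex.Re l) /\ is_derive x 1 (ImF f) (complex.Im l).

Section ComplexDerivative.
Context {R : realType}.
Implicit Types (f g : R -> R[i]) (x : R) (a b : R[i]).

Lemma is_cder_eq f x a b : is_cder f x a -> a = b -> is_cder f x b.
Proof. by move=> + <-. Qed.

Lemma cderivableP f x : cderivable f x -> is_cder f x (cderive f x).
Proof. by move=> [d1 d2]; split; rewrite /= derive1E; [exact: (derivableP d1)|exact: (derivableP d2)]. Qed.

Lemma is_cder_cst z x : is_cder (fun=> z) x 0.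
Proof. by split; exact: is_derive_cst. Qed.

Lemma is_cderD f g x a b : is_cder f x a -> is_cder g x b ->
  is_cder (fun y => f y + g y) x (a + b).
Proof.
move=> [f1 f2] [g1 g2]; split.
- rewrite cReD (_ : ReF _ = ReF f + ReF g); first exact: is_deriveD.
  by apply/funext => y; rewrite /ReF cReD.
- rewrite cImD (_ : ImF _ = ImF f + ImF g); first exact: is_deriveD.
  by apply/funext => y; rewrite /ImF cImD.
Qed.

Lemma is_cderN f x a : is_cder f x a -> is_cder (fun y => - f y) x (- a).
Proof.
move=> [f1 f2]; split.
- rewrite cReN (_ : ReF _ = - ReF f); first exact: is_deriveN.
  by apply/funext => y; rewrite /ReF cReN.
- rewrite cImN (_ : ImF _ = - ImF f); first exact: is_deriveN.
  by apply/funext => y; rewrite /ImF cImN.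
Qed.

Lemma is_cderB f g x a b : is_cder f x a -> is_cder g x b ->
  is_cder (fun y => f y - g y) x (a - b).
Proof. by move=> df dg; apply: is_cderD => //; exact: is_cderN. Qed.

Lemma is_cderM f g x a b : is_cder f x a -> is_cder g x b ->
  is_cder (fun y => f y * g y) x (a * g x + f x * b).
Proof.
move=> [f1 f2] [g1 g2]; split.
- rewrite (_ : ReF _ = ReF f * ReF g - ImF f * ImF g); last first.
    by apply/funext => y; rewrite /ReF cReM.
  by apply: is_derive_eq; rewrite !(cReD, cReM) /ReF /ImF /GRing.scale /=; ring.
- rewrite (_ : ImF _ = ReF f * ImF g + ImF f * ReF g); last first.
    by apply/funext => y; rewrite /ImF cImM.
  apply: is_derive_eq (is_deriveD (is_deriveM f1 g2) (is_deriveM f2 g1)) _.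
  by rewrite !(cImD, cImM) /ReF /ImF /GRing.scale /=; ring.
Qed.

Lemma is_cderZ f x a (z : R[i]) : is_cder f x a ->
  is_cder (fun y => z * f y) x (z * a).
Proof.
move=> df; apply: is_cder_eq; first by apply: is_cderM; [exact: is_cder_cst|exact: df].
by rewrite mul0r add0r.
Qed.

Lemma is_cder_conjc f x a : is_cder f x a ->
  is_cder (fun y => conjc (f y)) x (conjc a).
Proof.
move=> [f1 f2]; split.
- rewrite cReC (_ : ReF _ = ReF f)//.
  by apply/funext => y; rewrite /ReF cReC.
- rewrite cImC (_ : ImF _ = - ImF f); first exact: is_deriveN.
  by apply/funext => y; rewrite /ImF cImC.
Qed.

Lemma is_cder_comp f (h : R -> R) x a (b : R) : is_cder f (h x) a ->
  is_derive x 1 h b -> is_cder (fun y => f (h y)) x (b%:C * a).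
Proof.
move=> [f1 f2] dh; split.
- rewrite cReM /= mul0r subr0 mulrC.
  exact: (@is_derive1_comp _ (ReF f) h).
- rewrite cImM /= mul0r addr0 mulrC.
  exact: (@is_derive1_comp _ (ImF f) h).
Qed.

Lemma is_cder_real (h : R -> R) x (b : R) : is_derive x 1 h b ->
  is_cder (fun y => (h y)%:C) x b%:C.
Proof. by move=> dh; split => /=; [exact: dh|exact: is_derive_cst]. Qed.

Lemma is_cderX f x a n : is_cder f x a ->
  is_cder (fun y => f y ^+ n.+1) x (n.+1%:R * f x ^+ n * a).
Proof.
move=> df; elim: n => [|n IH].
  by rewrite expr0 !mul1r; under [X in is_cder X]eq_fun do rewrite expr1.
under [X in is_cder X]eq_fun do rewrite exprS.
apply: is_cder_eq; first by apply: is_cderM; [exact: df|exact: IH].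
rewrite -(@natr1 _ n.+1) exprS; ring.
Qed.

Lemma is_cder_cvg f x a : is_cder f x a ->
  (ReF f @ x --> complex.Re (f x)) /\ (ImF f @ x --> complex.Im (f x)).
Proof.
move=> [[d1 _] [d2 _]]; split.
- by have /derivable1_diffP/differentiable_continuous := d1.
- by have /derivable1_diffP/differentiable_continuous := d2.
Qed.

Lemma is_cder_ccont f (f' : R -> R[i]) : (forall x, is_cder f x (f' x)) -> ccont f.
Proof. by move=> df; split => x; have [] := is_cder_cvg (df x). Qed.

End ComplexDerivative.

(** * Lebesgue integrals of real functions *)

Section RealIntegrals.
Context {R : realType}.
Notation mu := (@lebesgue_measure R).
Implicit Types (D : set R) (f g F : R -> R) (a b : R).

Lemma Rint_dct D (f_ : nat -> R -> R) f g : measurable D ->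
  (forall n, measurable_fun D (f_ n)) ->
  (forall x, D x -> f_ n x @[n --> \oo] --> f x) ->
  mu.-integrable D (EFin \o g) ->
  (forall n x, D x -> `|f_ n x| <= g x) ->
  mu.-integrable D (EFin \o f) /\
  Rintegral mu D (f_ n) @[n --> \oo] --> Rintegral mu D f.
Proof.
move=> mD mf ff ig fg.
have mlim : measurable_fun D f by exact: measurable_fun_cvg mf ff.
have [] := @dominated_convergence _ _ _ mu D mD (fun n => EFin \o f_ n) (EFin \o f)
  (EFin \o g) _ _ _ ig _.
- by move=> n /=; apply/measurable_EFinP; exact: mf.
- by apply/measurable_EFinP.
- apply: aeW => x Dx; apply/fine_cvgP; split; first exact: nearW.
  exact: ff.
- by apply: aeW => x n Dx; rewrite /= lee_fin fg.
move=> intf _ cvgf; split => //.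
apply: fine_cvg; rewrite /Rintegral fineK//; exact: integrable_fin_num.
Qed.

Lemma continuous_integrable f a b : continuous f ->
  mu.-integrable `[a, b] (EFin \o f).
Proof.
move=> cf; apply: continuous_compact_integrable; first exact: segment_compact.
exact: continuous_subspaceT.
Qed.

Lemma le_Rintegrable D f g : measurable D -> measurable_fun D f ->
  (forall x, D x -> `|f x| <= g x) -> mu.-integrable D (EFin \o g) ->
  mu.-integrable D (EFin \o f).
Proof.
move=> mD mf fg ig; apply: le_integrable ig => //; first exact/measurable_EFinP.
by move=> x Dx; rewrite /= lee_fin (le_trans (fg _ Dx))// ler_norm.
Qed.

(** The left end is treated apart because the primitives in time are differentiable at positive
    times only; at time 0 just a one-sided limit is available. *)
Lemma Rint_FTC2 f F a b : a < b -> continuous f ->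
  (forall x, a < x -> x <= b -> is_derive x 1 F (f x)) -> F @ a^'+ --> F a ->
  Rintegral mu `[a, b] f = F b - F a.
Proof.
move=> ab cf dF Fa.
rewrite /Rintegral (@continuous_FTC2 _ f F a b)//.
- exact: continuous_subspaceT.
- split => //.
  + by move=> x; rewrite in_itv/= => /andP[ax xb]; case: (dF x ax (ltW xb)).
  + have [/derivable1_diffP/differentiable_continuous cF _] := dF b ab (lexx _).
    exact: cvg_at_left_filter cF.
- move=> x; rewrite in_itv/= => /andP[ax xb].
  have [_ <-] := dF x ax (ltW xb); exact: derive1E.
Qed.

Lemma Rint_FTC1 f a x : continuous f -> a < x ->
  is_derive x 1 (fun y => Rintegral mu `[a, y] f) (f x).
Proof.
move=> cf ax.
have xx1 : x < x + 1 by rewrite ltrDl.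
have [d1 d2] := @continuous_FTC1_closed R f a x (x + 1) xx1
  (continuous_integrable _ _ cf) ax (cf x).
by split; [exact: d1|rewrite -derive1E].
Qed.

(** The weight of [decaying]. It has mass 1 on the half-line, and its multiples dominate the
    pairings of solutions with kernels. *)
Definition wght x : R := ((1 + x) ^+ 2)^-1.

Lemma wght_ge0 x : 0 <= wght x.
Proof. by rewrite invr_ge0 sqr_ge0. Qed.

Lemma wght_cont x : 0 <= x -> {for x, continuous wght}.
Proof.
move=> x0; have c : 1 + y @[y --> x] --> 1 + x.
  by apply: cvgD; [exact: cvg_cst|exact: cvg_id].
apply: cvgV; first by rewrite sqrf_eq0 gt_eqF//; lra.
exact: (cvgM c c).
Qed.

Lemma wght_integral : (\int[mu]_(x in `[0%R, +oo[) (wght x)%:E = 1%:E)%E.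
Proof.
pose F (x : R) : R := - (1 + x)^-1.
have dF (x : R) : 0 <= x -> is_derive x 1 F (wght x).
  move=> x0; have n0 : 1 + x != 0 by rewrite gt_eqF//; lra.
  rewrite /F.
  have h : is_derive x 1 (fun y : R => (1 + y)^-1) (- (1 + x) ^- 2 *: (1 : R)).
    apply: is_deriveV => //; apply: is_derive_eq; by rewrite add0r.
  apply: is_derive_eq.
  by rewrite /GRing.scale /= mulr1 opprK.
rewrite (@ge0_continuous_FTC2y _ wght F 0 0) /F ?addr0 ?invr1 ?sub0e ?opprK//.
- by rewrite -EFinN opprK.
- by move=> x _; exact: wght_ge0.
- apply: continuous_in_subspaceT => x; rewrite inE/= in_itv/= andbT.
  exact: wght_cont.
- rewrite -oppr0; apply: cvgN.
  apply/(@gtr0_cvgV0 R R +oo _ (fun x => 1 + x)); last exact: cvg_addrl.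
  by near=> x; rewrite ltr_pwDl.
- by move=> x x0; case: (dF x (ltW x0)).
- have [/derivable1_diffP/differentiable_continuous cF _] := dF 0 (lexx _).
  by have := cvg_at_right_filter cF; rewrite [F 0]/F addr0 invr1.
- move=> x; rewrite in_itv/= andbT => x0.
  have [_ <-] := dF x (ltW x0); exact: derive1E.
Unshelve. all: end_near. Qed.

Lemma wght_integrable : mu.-integrable `[0, +oo[ (EFin \o wght).
Proof.
apply/integrableP; split.
  apply/measurable_EFinP.
  apply: subspace_continuous_measurable_fun => //.
  apply: continuous_in_subspaceT => x; rewrite inE/= in_itv/= andbT.
  exact: wght_cont.
rewrite (_ : (fun x => _) = (EFin \o wght)).
  by rewrite wght_integral ltry.
by apply/funext => x /=; rewrite ger0_norm ?wght_ge0.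
Qed.

Lemma wght_integrableZ (C : R) :
  mu.-integrable `[0, +oo[ (EFin \o (fun x => C * wght x)).
Proof.
rewrite (_ : EFin \o _ = fun x => (C%:E * (wght x)%:E)%E); last first.
  by apply/funext => x /=; rewrite EFinM.
by apply: integrableZl => //; exact: wght_integrable.
Qed.

Lemma Rint_wght_le b : Rintegral mu `[0, b] wght <= 1.
Proof.
have sub : `[0, b]%classic `<=` (`[0, +oo[%classic : set R).
  by move=> x; rewrite /= !in_itv/= andbT => /andP[].
rewrite -lee_fin /Rintegral fineK; last first.
  by apply: integrable_fin_num => //; apply: integrableS wght_integrable.
rewrite -wght_integral; apply: ge0_subset_integral => //.
- by case/integrableP: wght_integrable.
- by move=> x _; rewrite lee_fin wght_ge0.
Qed.

Lemma decay_integrable f (C : R) : continuous f ->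
  (forall x, 0 <= x -> `|f x| <= C * wght x) -> mu.-integrable `[0, +oo[ (EFin \o f).
Proof.
move=> cf fC; apply: (@le_Rintegrable _ _ (fun x => C * wght x)) => //.
- by apply: measurable_funTS; exact: continuous_measurable_fun.
- by move=> x; rewrite /= in_itv/= andbT; exact: fC.
- exact: wght_integrableZ.
Qed.

Lemma wght_cvg0 : wght n%:R @[n --> \oo] --> 0.
Proof.
have h : (n.+1%:R : R)^-1 @[n --> \oo] --> (0 : R) by exact: cvg_harmonic.
rewrite (_ : (fun n : nat => wght n%:R) = (fun n => n.+1%:R^-1 * n.+1%:R^-1)).
  by rewrite -[X in _ --> X](mulr0 (0 : R)); exact: cvgM.
by apply/funext => n; rewrite /wght -invfM nat1r expr2.
Qed.

(** Dominated convergence for [f] truncated to [[0, n]]; the bound on [F] makes the boundary term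
    [F n] vanish in the limit. *)
Lemma Rint_FTC2y f F (C : R) : continuous f ->
  (forall x : R, 0 < x -> is_derive x 1 F (f x)) -> F @ 0^'+ --> F 0 ->
  (forall x, 0 <= x -> `|f x| <= C * wght x) ->
  (forall x, 0 <= x -> `|F x| <= C * wght x) ->
  Rintegral mu `[0, +oo[ f = - F 0.
Proof.
move=> cf dF F0 fC FC.
pose f_ (n : nat) := f \_ `[0, n%:R].
have icg := wght_integrableZ C.
have sub n : `[0, n%:R]%classic `<=` (`[0, +oo[%classic : set R).
  by move=> x; rewrite /= !in_itv/= andbT => /andP[].
have [] := @Rint_dct `[0, +oo[ f_ f (fun x => C * wght x) _ _ _ icg _.
- by [].
- move=> n; apply/measurable_restrict => //.
  by apply: measurable_funTS; exact: continuous_measurable_fun.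
- move=> x; rewrite /= in_itv/= andbT => x0.
  apply: cvg_near_cst; near=> n; rewrite /f_ patchE mem_set//= in_itv/= x0/=.
  by near: n; exact: nbhs_infty_ger.
- move=> n x; rewrite /= in_itv/= andbT => x0; rewrite /f_ patchE.
  case: ifPn => _; first exact: fC.
  by rewrite normr0; apply: le_trans (fC x x0).
move=> _ c1.
have c2 : Rintegral mu `[0, +oo[ (f_ n) @[n --> \oo] --> - F 0.
  have : F n%:R - F 0 @[n --> \oo] --> - F 0.
    rewrite -[X in _ --> X]sub0r; apply: cvgB; last exact: cvg_cst.
    apply: norm_cvg0; apply: (@squeeze_cvgr _ _ _ _ (fun=> 0) (fun n => C * wght n%:R)).
    - by near=> n; rewrite normr_ge0 /= FC.
    - exact: cvg_cst.
    - by rewrite -(mulr0 C); apply: cvgM; [exact: cvg_cst|exact: wght_cvg0].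
  apply: cvg_trans; apply: near_eq_cvg; near=> n.
  have n0 : 0 < n%:R :> R by near: n; exact: nbhs_infty_gtr.
  have <- := Rint_FTC2 n0 cf (fun x x0 _ => dF x x0) F0.
  by rewrite /f_ -Rintegral_mkcondr setIidr.
exact: (cvg_unique _ c1 c2).
Unshelve. all: end_near. Qed.

End RealIntegrals.

(** * Integrals depending on a parameter *)

Section ParametricIntegrals.
Context {R : realType}.
Notation mu := (@lebesgue_measure R).

Lemma continuous_pair {T U V : topologicalType} (f : T -> U) (g : T -> V) :
  continuous f -> continuous g -> continuous (fun x => (f x, g x)).
Proof. by move=> cf cg x; apply: cvg_pair; [exact: cf|exact: cg]. Qed.

(** Tube lemma: joint continuity gives a neighbourhood at each point of the segment, and compactness
    lets one neighbourhood of [x0] serve all [u]. *)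
Lemma near_uniform_itv {X : topologicalType} (F : X -> R -> R) (a b : R) (x0 : X) (e : R) :
  continuous (fun p : X * R => F p.1 p.2) -> 0 < e ->
  \forall x \near x0, forall u, u \in `[a, b] -> `|F x0 u - F x u| < e.
Proof.
move=> cF e0.
have /compact_near_coveringP nc := @segment_compact R a b.
have := nc X (nbhs x0) (fun x u => `|F x0 u - F x u| < e) _.
apply => u abu.
have e2 : 0 < e / 2 by rewrite divr_gt0.
have /cvgrPdist_lt /(_ _ e2) [[A B] /= [nA nB] AB] := cF (x0, u).
exists (B, A) => //= -[v x] /= [Bv Ax].
have h1 := AB (x, v) (conj Ax Bv).
have h2 := AB (x0, v) (conj (nbhs_singleton nA) Bv).
rewrite /= in h1 h2.
rewrite (_ : _ - _ = (F x0 u - F x v) - (F x0 u - F x0 v)); last ring.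
by rewrite (le_lt_trans (ler_normB _ _))// (splitr e) ltrD.
Qed.

Lemma continuous_section2 {X Y : topologicalType} (F : X -> Y -> R) (x : X) :
  continuous (fun p : X * Y => F p.1 p.2) -> continuous (F x).
Proof.
move=> cF y.
apply: (@continuous_comp _ _ _ (fun y => (x, y)) (fun p : X * Y => F p.1 p.2)).
  by apply: cvg_pair; [exact: cvg_cst|exact: cvg_id].
exact: cF.
Qed.

Lemma continuous_section1 {X Y : topologicalType} (F : X -> Y -> R) (y : Y) :
  continuous (fun p : X * Y => F p.1 p.2) -> continuous (F ^~ y).
Proof.
move=> cF x.
apply: (@continuous_comp _ _ _ (fun x => (x, y)) (fun p : X * Y => F p.1 p.2)).
  by apply: cvg_pair; [exact: cvg_id|exact: cvg_cst].
exact: cF.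
Qed.

Lemma Rint_param_cont {X : topologicalType} (F : X -> R -> R) (a b : R) :
  continuous (fun p : X * R => F p.1 p.2) ->
  continuous (fun x => Rintegral mu `[a, b] (F x)).
Proof.
move=> cF x0.
have intF x : mu.-integrable `[a, b] (EFin \o F x).
  by apply: continuous_integrable; exact: continuous_section2.
apply/cvgrPdist_le => e e0.
(* The [+ 1] keeps the quotient meaningful when [a = b]; the segment has length at most
   [|b - a|]. *)
have d0 : 0 < e / (`|b - a| + 1) by rewrite divr_gt0// ltr_wpDl.
have := near_uniform_itv a b x0 cF d0; apply: filterS => x hx.
rewrite -RintegralB//.
have cB : continuous (fun u => F x0 u - F x u).
  by move=> u; apply: cvgB; exact: continuous_section2.
apply: (le_trans (le_normr_Rintegral _ _)) => //.
  by apply: continuous_integrable.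
apply: (@le_trans _ _ (Rintegral mu `[a, b] (fun=> e / (`|b - a| + 1)))).
  apply: le_Rintegral => //.
  - by apply: continuous_integrable => u; apply: cvg_norm; exact: cB.
  - by apply: continuous_integrable => z; exact: cvg_cst.
  - by move=> u ab; exact/ltW/hx.
rewrite Rintegral_cst//= lebesgue_measure_itv/=; case: ifPn => [ab|_]; last first.
  by rewrite mulr0 ltW.
rewrite -EFinB /= mulrAC -mulrA ler_piMr ?(ltW e0)//.
by rewrite ler_pdivrMr ?ltr_wpDl// mul1r (le_trans (ler_norm _))// lerDl.
Qed.

(** Moves a variable upper limit into the integrand over a fixed segment, so that continuity in the
    limit becomes continuity in a parameter. The maximum with 0 accounts for the empty interval when
    [r] is negative. *)
Lemma Rint_rescale (g : R -> R) (r : R) : continuous g ->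
  Rintegral mu `[0, r] g =
  Num.max r 0 * Rintegral mu `[0, 1] (fun u => g (Num.max r 0 * u)).
Proof.
move=> cg; case: (leP r 0) => r0.
  rewrite mul0r; move: r0; rewrite le_eqVlt => /predU1P[->|r0].
    by rewrite set_itv1 Rintegral_set1.
  by rewrite set_itv_ge ?Rintegral_set0// bnd_simp -ltNge.
have cgr : continuous (fun u => g (r * u)).
  move=> u; apply: (@continuous_comp _ _ _ (fun u => r * u) g); last exact: cg.
  exact: mulrl_continuous.
rewrite -RintegralZl//; last exact: continuous_integrable.
pose F u := Rintegral mu `[0, r * u] g.
have -> : Rintegral mu `[0, r] g = F 1 - F 0.
  by rewrite /F mulr1 mulr0 set_itv1 Rintegral_set1 subr0.
apply/esym/Rint_FTC2 => //.
- by move=> u; apply: cvgM; [exact: cvg_cst|exact: cgr].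
- move=> u u0 _.
  have h : is_derive (r * u) 1 (fun y => Rintegral mu `[0, y] g) (g (r * u)).
    by apply: Rint_FTC1 => //; rewrite mulr_gt0.
  have h2 : is_derive u 1 (fun u : R => r * u) r.
    by apply: is_derive_eq; rewrite ?mulr1 /GRing.scale /= ?mulr1 ?mulr0 ?addr0.
  have := is_derive1_comp h h2; rewrite mulrC; exact.
- rewrite [F 0]/F mulr0 set_itv1 Rintegral_set1 /F.
  have i01 := continuous_integrable 0 1 cg.
  have c0 := parameterized_integral_cvg_left (@ltr01 R) i01.
  have cr : r * u @[u --> 0^'+] --> (0 : R).
    rewrite -[X in _ --> X](mulr0 r); apply: cvg_at_right_filter.
    exact: mulrl_continuous.
  exact: cvg_comp cr c0.
Qed.

Lemma continuous_max0 : continuous (fun r : R => Num.max r 0).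
Proof. by move=> r; apply: continuous_max; [exact: cvg_id|exact: cvg_cst]. Qed.

Lemma Rint_upper_cont {X : topologicalType} (F : X -> R -> R) :
  continuous (fun p : X * R => F p.1 p.2) ->
  continuous (fun p : X * R => Rintegral mu `[0, p.2] (F p.1)).
Proof.
move=> cF.
rewrite (_ : (fun p : X * R => _) = (fun p : X * R => Num.max p.2 0 *
    Rintegral mu `[0, 1] (fun u => F p.1 (Num.max p.2 0 * u)))); last first.
  by apply/funext => p; rewrite Rint_rescale//; exact: continuous_section2.
have cm : continuous (fun p : X * R => Num.max p.2 0).
  move=> p; apply: (@continuous_comp _ _ _ snd (fun r : R => Num.max r 0)).
    exact: cvg_snd.
  exact: continuous_max0.
move=> p; apply: cvgM; first exact: cm.
apply: (@Rint_param_cont _ (fun (p : X * R) u => F p.1 (Num.max p.2 0 * u))) => q.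
apply: (@continuous_comp _ _ _ (fun z : (X * R) * R => (z.1.1, Num.max z.1.2 0 * z.2))
  (fun p : X * R => F p.1 p.2)); last exact: cF.
move: q; apply: continuous_pair => q.
  by apply: (@continuous_comp _ _ _ fst fst); exact: cvg_fst.
apply: cvgM; last exact: cvg_snd.
apply: (@continuous_comp _ _ _ fst (fun p : X * R => Num.max p.2 0)); first exact: cvg_fst.
exact: cm.
Qed.

(** For [z] near [y], [F' z u] differs from [F' y u] by less than 1, uniformly on the segment; hence
    [|F' y u| + 1] dominates the derivatives. *)
Lemma Rint_param_derive (F F' : R -> R -> R) (a b c d y : R) :
  y \in `]c, d[ ->
  (forall z, continuous (F z)) ->
  (forall z u, z \in `]c, d[ -> u \in `[a, b] -> is_derive z 1 (F ^~ u) (F' z u)) ->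
  continuous (fun p : R * R => F' p.1 p.2) ->
  is_derive y 1 (fun z => Rintegral mu `[a, b] (F z)) (Rintegral mu `[a, b] (F' y)).
Proof.
move=> ycd cF dF cF'.
have : \forall z \near y, (z \in `]c, d[) /\
    forall u, u \in `[a, b] -> `|F' y u - F' z u| < 1.
  near=> z; split; first by near: z; exact: near_in_itvoo.
  by near: z; exact: (near_uniform_itv a b y cF' ltr01).
case=> e /= e0 he.
have he' (z : R) : `]y - e, y + e[%classic z -> (z \in `]c, d[) /\
    forall u, u \in `[a, b] -> `|F' y u - F' z u| < 1.
  rewrite /= in_itv/= => /andP[z1 z2]; apply: he => /=.
  by rewrite ltr_distlC; lra.
have Iy : `]y - e, y + e[%classic y by rewrite /= in_itv/=; lra.
have intF z : mu.-integrable `[a, b] (EFin \o F z) by exact: continuous_integrable.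
have cF'y : continuous (F' y) by exact: (continuous_section2 cF').
have p1 z u : `]y - e, y + e[%classic z -> `[a, b]%classic u ->
    partial1of2 F z u = F' z u.
  move=> Iz uab; rewrite partial1of2E.
  by have [_ <-] := dF z u (he' z Iz).1 uab.
have hd z u : `]y - e, y + e[%classic z -> `[a, b]%classic u -> derivable (F ^~ u) z 1.
  by move=> Iz uab; have [] := dF z u (he' z Iz).1 uab.
have cG : continuous (fun u => `|F' y u| + 1).
  move=> u; apply: cvgD; last exact: cvg_cst.
  by apply: cvg_norm; exact: cF'y.
have G0 u : 0 <= `|F' y u| + 1 by rewrite addr_ge0.
have Gub z u : `]y - e, y + e[%classic z -> `[a, b]%classic u ->
    `|partial1of2 F z u| <= `|F' y u| + 1.
  move=> Iz uab; rewrite p1//.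
  rewrite (_ : F' z u = F' y u - (F' y u - F' z u)); last ring.
  apply: (le_trans (ler_normB _ _)); rewrite lerD2l.
  by apply: ltW; apply: (he' z Iz).2.
split.
  exact: (@derivable_under_integral R _ _ mu F _ (measurable_itv _) y _ _ Iy _ hd
    _ G0 (continuous_integrable _ _ cG) Gub).
rewrite -derive1E (@differentiation_under_integral R _ _ mu F _ (measurable_itv _) y _ _ Iy
  _ hd _ G0 (continuous_integrable _ _ cG) Gub)//.
by apply: eq_Rintegral => u; rewrite inE => uab; rewrite p1.
Unshelve. all: end_near. Qed.

Lemma Rint_param_derivey (F F' : R -> R -> R) (c d y C : R) :
  y \in `]c, d[ ->
  (forall z, z \in `]c, d[ -> continuous (F z)) ->
  (forall z u, z \in `]c, d[ -> 0 <= u -> is_derive z 1 (F ^~ u) (F' z u)) ->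
  (forall z u, z \in `]c, d[ -> 0 <= u -> `|F z u| <= C * wght u) ->
  (forall z u, z \in `]c, d[ -> 0 <= u -> `|F' z u| <= C * wght u) ->
  is_derive y 1 (fun z => Rintegral mu `[0, +oo[ (F z)) (Rintegral mu `[0, +oo[ (F' y)).
Proof.
move=> Iy cF dF bF bF'.
have C0 : 0 <= C.
  have := le_trans (normr_ge0 _) (bF y 0 Iy (lexx _)).
  by rewrite /wght addr0 expr1n invr1 mulr1.
have mem (u : R) : `[0, +oo[%classic u -> 0 <= u by rewrite /= in_itv/= andbT.
have intF z : `]c, d[%classic z -> mu.-integrable `[0, +oo[ (EFin \o F z).
  by move=> Iz; apply: (@decay_integrable _ _ C) => [|u u0]; [exact: cF|exact: bF].
have p1 z u : `]c, d[%classic z -> `[0, +oo[%classic u ->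
    partial1of2 F z u = F' z u.
  move=> Iz u0; rewrite partial1of2E.
  by have [_ <-] := dF z u Iz (mem u u0).
have hd z u : `]c, d[%classic z -> `[0, +oo[%classic u -> derivable (F ^~ u) z 1.
  by move=> Iz u0; have [] := dF z u Iz (mem u u0).
have G0 u : 0 <= C * wght u by rewrite mulr_ge0// wght_ge0.
have Gub z u : `]c, d[%classic z -> `[0, +oo[%classic u ->
    `|partial1of2 F z u| <= C * wght u.
  by move=> Iz u0; rewrite p1//; apply: bF' => //; exact: mem.
split.
  exact: (@derivable_under_integral R _ _ mu F _ (measurable_itv _) y _ _ Iy intF hd
    _ G0 (wght_integrableZ C) Gub).
rewrite -derive1E (@differentiation_under_integral R _ _ mu F _ (measurable_itv _) y _ _ Iy
  intF hd _ G0 (wght_integrableZ C) Gub)//.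
by apply: eq_Rintegral => u; rewrite inE => uab; rewrite p1.
Qed.

(** Writing [Phi a z] for the integral of [k u z] over [[0, a]], the increment of [Phi z z] is split
    at [Phi y z]. Caratheodory slopes of the two pieces are added, which avoids joint
    differentiability of [Phi]. *)
Lemma Rint_leibniz (k ky : R -> R -> R) (y : R) : 0 < y ->
  continuous (fun p : R * R => k p.1 p.2) ->
  continuous (fun p : R * R => ky p.1 p.2) ->
  (forall u z : R, is_derive z 1 (k u) (ky u z)) ->
  is_derive y 1 (fun z => Rintegral mu `[0, z] (k ^~ z))
    (k y y + Rintegral mu `[0, y] (ky ^~ y)).
Proof.
move=> y0 ck cky dk.
have cswap (h : R -> R -> R) : continuous (fun p : R * R => h p.1 p.2) ->
    continuous (fun p : R * R => h p.2 p.1).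
  move=> ch p; apply: (@continuous_comp _ _ _ (fun p : R * R => (p.2, p.1))
    (fun p : R * R => h p.1 p.2)); last exact: ch.
  by move: p; apply: continuous_pair => p; [exact: cvg_snd|exact: cvg_fst].
have h2 : is_derive y 1 (fun z => Rintegral mu `[0, y] (k ^~ z))
    (Rintegral mu `[0, y] (ky ^~ y)).
  apply: (@Rint_param_derive (fun z u => k u z) (fun z u => ky u z) 0 y (y - 1) (y + 1)).
  - by rewrite in_itv/=; lra.
  - by move=> z; exact: (continuous_section1 ck).
  - by move=> *; exact: dk.
  - exact: cswap.
have /is_derive1_caratheodory[g2 [g2E cg2 g2y]] := h2.
pose Phi a z := Rintegral mu `[0, a] (k ^~ z).
(* The slope in the upper limit is taken at the parameter [z], not [y], so that it telescopes with
   [g2]. The mean value theorem turns it into a value [k c z] with [c] between [y] and [z], which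
   tends to [k y y]. *)
pose g1 z := if z == y then k y y else (Phi z z - Phi y z) / (z - y).
apply/is_derive1_caratheodory; exists (fun z => g1 z + g2 z); split.
- move=> z; rewrite mulrDl -g2E /g1; case: eqP => [->|/eqP zy].
    by rewrite !subrr mulr0 add0r.
  by rewrite divfK ?subr_eq0// /Phi addrA subrK.
- apply: cvgD; last exact: cg2.
  rewrite {2}/g1 eqxx; apply/cvgrPdist_le => e e0.
  have /cvgrPdist_le /(_ _ e0) [[A B] /= [nA nB] AB] := ck (y, y).
  have := filterI nA nB.
  case=> r /= r0 rAB.
  near=> z.
  rewrite /g1; case: eqP => [_|/eqP zy]; first by rewrite subrr normr0 ltW.
  have z0 : 0 < z by near: z; exact: lt_nbhsr.
  have zr : `|y - z| < r.
    by near: z; have /cvgrPdist_lt/(_ _ r0) := @cvg_id _ (nbhs y).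
  have dPhi (a : R) : 0 < a -> is_derive a 1 (Phi ^~ z) (k a z).
    by move=> a0; apply: Rint_FTC1 => //; exact: (continuous_section1 ck).
  have mv (a b : R) : 0 < a -> a < b -> exists2 c, c \in `]a, b[ & Phi b z - Phi a z = k c z * (b - a).
    move=> a0 ab; apply: (@MVT _ (Phi ^~ z) (k ^~ z)) => //.
      by move=> x; rewrite in_itv/= => /andP[ax _]; apply: dPhi; lra.
    apply: derivable_within_continuous => x; rewrite in_itv/= => /andP[ax _].
    by have [] := dPhi x (lt_le_trans a0 ax).
  have [c cyz ->] : exists2 c, `|y - c| < r & (Phi z z - Phi y z) / (z - y) = k c z.
    have [yz|zy'] := ltP y z.
      have [c cI ->] := mv y z y0 yz.
      exists c; last by rewrite mulfK// subr_eq0.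
      move: cI zr; rewrite in_itv/= => /andP[c1 c2].
      by rewrite ltr0_norm ?subr_lt0// ltr0_norm ?subr_lt0//; lra.
    have zy2 : z < y by rewrite lt_neqAle zy.
    have [c cI E] := mv z y z0 zy2.
    exists c; last first.
      by rewrite -opprB E -mulrN opprB mulfK// subr_eq0.
    move: cI zr; rewrite in_itv/= => /andP[c1 c2].
    by rewrite gtr0_norm ?subr_gt0// gtr0_norm ?subr_gt0//; lra.
  apply: (AB (c, z)); split; first by have [] := rAB c cyz.
  by have [] := rAB z zr.
- by rewrite /g1 eqxx g2y.
Unshelve. all: end_near. Qed.

End ParametricIntegrals.

(** * Integrals of complex-valued functions *)

(** [cint a b] is convertible to [cintS] over the closed interval, so facts proved for general sets
    apply to it directly. *)
Definition cintS {R : realType} (D : set R) (f : R -> R[i]) : R[i] :=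
  Complex (Rintegral (@lebesgue_measure R) D (ReF f))
          (Rintegral (@lebesgue_measure R) D (ImF f)).

Definition cintegrable {R : realType} (D : set R) (f : R -> R[i]) : Prop :=
  (@lebesgue_measure R).-integrable D (EFin \o ReF f) /\
  (@lebesgue_measure R).-integrable D (EFin \o ImF f).

Definition cmeasurable {R : realType} (D : set R) (f : R -> R[i]) : Prop :=
  measurable_fun D (ReF f) /\ measurable_fun D (ImF f).

Definition cdecay {R : realType} (f : R -> R[i]) : Prop :=
  ccont f /\ exists C, forall x, 0 <= x -> cmod (f x) <= C * wght x.

Section ComplexIntegrals.
Context {R : realType}.
Notation mu := (@lebesgue_measure R).
Implicit Types (D : set R) (f g F : R -> R[i]) (a b : R).

Lemma eq_cintS D f g : (forall x, D x -> f x = g x) -> cintS D f = cintS D g.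
Proof.
move=> fg; congr Complex; apply: eq_Rintegral => x; rewrite inE => Dx;
  by rewrite /ReF /ImF fg.
Qed.

Lemma eq_cint a b f g : (forall x, a <= x -> x <= b -> f x = g x) ->
  cint a b f = cint a b g.
Proof.
move=> fg; apply: (@eq_cintS `[a, b]) => x /=.
by rewrite in_itv/= => /andP[]; exact: fg.
Qed.

Lemma cintegrable_lin D (k l : R) (u v : R -> R) : measurable D ->
  mu.-integrable D (EFin \o u) -> mu.-integrable D (EFin \o v) ->
  mu.-integrable D (EFin \o (fun x => k * u x + l * v x)).
Proof.
move=> mD iu iv.
rewrite (_ : _ \o _ = (fun x => k%:E * (EFin \o u) x) \+ (fun x => l%:E * (EFin \o v) x))%E.
  by apply: integrableD => //; exact: integrableZl.
by apply/funext => x; rewrite /= EFinD !EFinM.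
Qed.

Lemma Rintegral_lin D (k l : R) (u v : R -> R) : measurable D ->
  mu.-integrable D (EFin \o u) -> mu.-integrable D (EFin \o v) ->
  Rintegral mu D (fun x => k * u x + l * v x) =
  k * Rintegral mu D u + l * Rintegral mu D v.
Proof.
move=> mD iu iv; rewrite RintegralD//; first by rewrite !RintegralZl.
- have := cintegrable_lin k 0 mD iu iv.
  by under [X in EFin \o X]eq_fun do rewrite mul0r addr0.
- have := cintegrable_lin 0 l mD iu iv.
  by under [X in EFin \o X]eq_fun do rewrite mul0r add0r.
Qed.

Lemma cintegrableZ D f (z : R[i]) : measurable D -> cintegrable D f ->
  cintegrable D (fun x => z * f x).
Proof.
move=> mD [f1 f2]; split.
- rewrite (_ : ReF _ = (fun x => complex.Re z * ReF f x + (- complex.Im z) * ImF f x)).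
    exact: cintegrable_lin.
  by apply/funext => x; rewrite /ReF cReM mulNr.
- rewrite (_ : ImF _ = (fun x => complex.Im z * ReF f x + complex.Re z * ImF f x)).
    exact: cintegrable_lin.
  by apply/funext => x; rewrite /ImF cImM addrC.
Qed.

Lemma cintSD D f g : measurable D -> cintegrable D f -> cintegrable D g ->
  cintS D (fun x => f x + g x) = cintS D f + cintS D g.
Proof.
move=> mD [f1 f2] [g1 g2]; apply: complex_ext; rewrite ?cReD ?cImD /=.
- by rewrite -RintegralD//; apply: eq_Rintegral => x _; rewrite /ReF cReD.
- by rewrite -RintegralD//; apply: eq_Rintegral => x _; rewrite /ImF cImD.
Qed.

Lemma cintSZ D f (z : R[i]) : measurable D -> cintegrable D f ->
  cintS D (fun x => z * f x) = z * cintS D f.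
Proof.
move=> mD [f1 f2]; apply: complex_ext; rewrite ?cReM ?cImM /=.
- rewrite -mulNr -Rintegral_lin//.
  by apply: eq_Rintegral => x _; rewrite /ReF /ImF cReM mulNr.
- rewrite addrC -Rintegral_lin//.
  by apply: eq_Rintegral => x _; rewrite /ReF /ImF cImM addrC.
Qed.

Lemma cintSB D f g : measurable D -> cintegrable D f -> cintegrable D g ->
  cintS D (fun x => f x - g x) = cintS D f - cintS D g.
Proof.
move=> mD cf cg.
rewrite (@eq_cintS D _ (fun x => f x + (-1) * g x)); last by move=> x _; rewrite mulN1r.
rewrite cintSD//; first by rewrite cintSZ// mulN1r.
exact: cintegrableZ.
Qed.

Lemma cintegrable_cont a b f : ccont f -> cintegrable `[a, b] f.
Proof. by move=> [f1 f2]; split; exact: continuous_integrable. Qed.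

Lemma cdecay_integrable f : cdecay f -> cintegrable `[0, +oo[ f.
Proof.
move=> [[f1 f2] [C fC]]; split; apply: (@decay_integrable _ _ C) => // x x0.
- exact: le_trans (Re_le_cmod _) (fC x x0).
- exact: le_trans (Im_le_cmod _) (fC x x0).
Qed.

(** The factor 2 comes from estimating real and imaginary parts separately; only the order of
    magnitude matters in what follows. *)
Lemma cmod_cintS D f (g : R -> R) : measurable D -> cintegrable D f ->
  mu.-integrable D (EFin \o g) ->
  (forall x, D x -> cmod (f x) <= g x) ->
  cmod (cintS D f) <= 2 * Rintegral mu D g.
Proof.
move=> mD [f1 f2] ig fg; apply: (le_trans (cmod_le_ReIm _)).
have h (u : R -> R) : mu.-integrable D (EFin \o u) -> (forall x, D x -> `|u x| <= cmod (f x)) ->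
    `|Rintegral mu D u| <= Rintegral mu D g.
  move=> iu uf; apply: (le_trans (le_normr_Rintegral _ _)) => //.
  apply: le_Rintegral => //.
    rewrite (_ : EFin \o _ = abse \o (EFin \o u)) //.
    exact: integrable_abse.
  by move=> x Dx; exact: le_trans (uf x Dx) (fg x Dx).
rewrite mulrDl !mul1r /=; apply: lerD; apply: h => // x _.
- exact: Re_le_cmod.
- exact: Im_le_cmod.
Qed.

Section Finite.
Variables (a b : R) (f g : R -> R[i]).
Hypotheses (cf : ccont f) (cg : ccont g).

Lemma cintD : cint a b (fun x => f x + g x) = cint a b f + cint a b g.
Proof. by apply: (@cintSD `[a, b]) => //; exact: cintegrable_cont. Qed.

Lemma cintB : cint a b (fun x => f x - g x) = cint a b f - cint a b g.
Proof. by apply: (@cintSB `[a, b]) => //; exact: cintegrable_cont. Qed.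

Lemma cintZ (z : R[i]) : cint a b (fun x => z * f x) = z * cint a b f.
Proof. by apply: (@cintSZ `[a, b]) => //; exact: cintegrable_cont. Qed.

Lemma cintN : cint a b (fun x => - f x) = - cint a b f.
Proof.
rewrite -mulN1r -cintZ; apply: eq_cint => x _ _; by rewrite mulN1r.
Qed.

End Finite.

(** Integrals are over sets and carry no orientation: here the set is empty or a single point. *)
Lemma cint_ge a b f : b <= a -> cint a b f = 0.
Proof.
rewrite le_eqVlt => /predU1P[->|ab].
  by rewrite /cint set_itv1 !Rintegral_set1.
by rewrite /cint set_itv_ge ?Rintegral_set0// bnd_simp -ltNge.
Qed.

Lemma cint_FTC1 f a x : ccont f -> a < x -> is_cder (fun y => cint a y f) x (f x).
Proof. by move=> [f1 f2] ax; split; exact: Rint_FTC1. Qed.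

Lemma cint_FTC2 f F a b : a < b -> ccont f ->
  (forall x, a < x -> x <= b -> is_cder F x (f x)) ->
  ReF F @ a^'+ --> ReF F a -> ImF F @ a^'+ --> ImF F a ->
  cint a b f = F b - F a.
Proof.
move=> ab [f1 f2] dF Fa1 Fa2; apply: complex_ext; rewrite ?cReD ?cImD ?cReN ?cImN /=.
- by apply: (@Rint_FTC2 _ _ (ReF F)) => // x ax xb; have [] := dF x ax xb.
- by apply: (@Rint_FTC2 _ _ (ImF F)) => // x ax xb; have [] := dF x ax xb.
Qed.

Lemma cint_FTC2_cont f F a b : a < b -> ccont f -> ccont F ->
  (forall x, a < x -> x <= b -> is_cder F x (f x)) -> cint a b f = F b - F a.
Proof.
move=> ab cf [F1 F2] dF; apply: cint_FTC2 => //; apply: cvg_at_right_filter.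
- exact: F1.
- exact: F2.
Qed.

Lemma cint_FTC2y f F : cdecay f -> cdecay F ->
  (forall x, 0 < x -> is_cder F x (f x)) ->
  cintS `[0, +oo[ f = - F 0.
Proof.
move=> [[f1 f2] [C fC]] [[F1 F2] [D FD]] dF.
have bnd (h : R -> R) (g : R -> R[i]) E : (forall x, `|h x| <= cmod (g x)) ->
    (forall x, 0 <= x -> cmod (g x) <= E * wght x) ->
    E <= Num.max C D -> forall x, 0 <= x -> `|h x| <= Num.max C D * wght x.
  move=> hg gE EC x x0; apply: (le_trans (hg x)); apply: (le_trans (gE x x0)).
  by rewrite ler_wpM2r// wght_ge0.
have mC : C <= Num.max C D by rewrite le_max lexx.
have mD : D <= Num.max C D by rewrite le_max lexx orbT.
apply: complex_ext; rewrite ?cReN ?cImN /=.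
- apply: (@Rint_FTC2y _ (ReF f) (ReF F) (Num.max C D)) => //.
  + by move=> x x0; have [] := dF x x0.
  + by apply: cvg_at_right_filter; exact: F1.
  + by apply: (bnd _ f C) => // x; exact: Re_le_cmod.
  + by apply: (bnd _ F D) => // x; exact: Re_le_cmod.
- apply: (@Rint_FTC2y _ (ImF f) (ImF F) (Num.max C D)) => //.
  + by move=> x x0; have [] := dF x x0.
  + by apply: cvg_at_right_filter; exact: F2.
  + by apply: (bnd _ f C) => // x; exact: Im_le_cmod.
  + by apply: (bnd _ F D) => // x; exact: Im_le_cmod.
Qed.

Lemma cdecayD f g : cdecay f -> cdecay g -> cdecay (fun x => f x + g x).
Proof.
move=> [cf [C fC]] [cg [D gD]]; split; first exact: ccontD.
exists (C + D) => x x0; rewrite mulrDl; apply: (le_trans (cmodD _ _)).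
by rewrite lerD ?fC ?gD.
Qed.

Lemma cdecayM f g : cdecay f -> ccont g ->
  (exists C, forall x, 0 <= x -> cmod (g x) <= C) -> cdecay (fun x => g x * f x).
Proof.
move=> [cf [C fC]] cg [D gD]; split; first exact: ccontM.
exists (D * C) => x x0; rewrite cmodM -mulrA; apply: ler_pM; rewrite ?cmod_ge0//.
- exact: gD.
- exact: fC.
Qed.

Lemma cdecayZ f (z : R[i]) : cdecay f -> cdecay (fun x => z * f x).
Proof.
move=> df; apply: cdecayM => //; first exact: ccont_cst.
by exists (cmod z).
Qed.

Lemma cdecayB f g : cdecay f -> cdecay g -> cdecay (fun x => f x - g x).
Proof.
move=> df dg; rewrite (_ : (fun x => _) = (fun x => f x + (-1) * g x)).
  by apply: cdecayD => //; exact: cdecayZ.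
by apply/funext => x; rewrite mulN1r.
Qed.

Lemma cint_param_cont {X : topologicalType} (F : X -> R -> R[i]) a b :
  ccont (fun p : X * R => F p.1 p.2) -> ccont (fun x => cint a b (F x)).
Proof.
move=> [F1 F2]; split.
- exact: (@Rint_param_cont _ _ (fun x u => complex.Re (F x u))).
- exact: (@Rint_param_cont _ _ (fun x u => complex.Im (F x u))).
Qed.

Lemma cint_upper_cont {X : topologicalType} (F : X -> R -> R[i]) :
  ccont (fun p : X * R => F p.1 p.2) ->
  ccont (fun p : X * R => cint 0 p.2 (F p.1)).
Proof.
move=> [F1 F2]; split.
- exact: (@Rint_upper_cont _ _ (fun x u => complex.Re (F x u))).
- exact: (@Rint_upper_cont _ _ (fun x u => complex.Im (F x u))).
Qed.

Lemma ccont_cint f : ccont f -> ccont (fun y => cint 0 y f).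
Proof.
move=> cf.
have h : ccont (fun p : R * R => cint 0 p.2 f).
  apply: (@cint_upper_cont _ (fun (_ : R) u => f u)).
  by apply: ccont_comp => //; move=> p; exact: cvg_snd.
apply: (@ccont_comp _ _ _ _ (fun y : R => (y, y)) _ h).
by apply: continuous_pair => x; exact: cvg_id.
Qed.

Lemma cint_param_derive (F F' : R -> R -> R[i]) (a b c d y : R) :
  y \in `]c, d[ ->
  (forall z : R, ccont (F z)) ->
  (forall z u : R, z \in `]c, d[ -> u \in `[a, b] -> is_cder (F ^~ u) z (F' z u)) ->
  ccont (fun p : R * R => F' p.1 p.2) ->
  is_cder (fun z => cint a b (F z)) y (cint a b (F' y)).
Proof.
move=> ycd cF dF [c1 c2]; split.
- apply: (@Rint_param_derive _ (fun z u => complex.Re (F z u))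
    (fun z u => complex.Re (F' z u)) a b c d) => //.
  + by move=> z; have [] := cF z.
  + by move=> z u Iz Iu; have [] := dF z u Iz Iu.
- apply: (@Rint_param_derive _ (fun z u => complex.Im (F z u))
    (fun z u => complex.Im (F' z u)) a b c d) => //.
  + by move=> z; have [] := cF z.
  + by move=> z u Iz Iu; have [] := dF z u Iz Iu.
Qed.

Lemma cint_param_derivey (F F' : R -> R -> R[i]) (c d y C : R) :
  y \in `]c, d[ ->
  (forall z : R, z \in `]c, d[ -> ccont (F z)) ->
  (forall z u : R, z \in `]c, d[ -> 0 <= u -> is_cder (F ^~ u) z (F' z u)) ->
  (forall z u : R, z \in `]c, d[ -> 0 <= u -> cmod (F z u) <= C * wght u) ->
  (forall z u : R, z \in `]c, d[ -> 0 <= u -> cmod (F' z u) <= C * wght u) ->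
  is_cder (fun z => cintS `[0, +oo[ (F z)) y (cintS `[0, +oo[ (F' y)).
Proof.
move=> ycd cF dF bF bF'; split.
- apply: (@Rint_param_derivey _ (fun z u => complex.Re (F z u))
    (fun z u => complex.Re (F' z u)) c d y C) => //.
  + by move=> z Iz; have [] := cF z Iz.
  + by move=> z u Iz Iu; have [] := dF z u Iz Iu.
  + by move=> z u Iz u0; exact: le_trans (Re_le_cmod _) (bF z u Iz u0).
  + by move=> z u Iz u0; exact: le_trans (Re_le_cmod _) (bF' z u Iz u0).
- apply: (@Rint_param_derivey _ (fun z u => complex.Im (F z u))
    (fun z u => complex.Im (F' z u)) c d y C) => //.
  + by move=> z Iz; have [] := cF z Iz.
  + by move=> z u Iz Iu; have [] := dF z u Iz Iu.
  + by move=> z u Iz u0; exact: le_trans (Im_le_cmod _) (bF z u Iz u0).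
  + by move=> z u Iz u0; exact: le_trans (Im_le_cmod _) (bF' z u Iz u0).
Qed.

Lemma cint_leibniz (k ky : R -> R -> R[i]) (y : R) : 0 < y ->
  ccont (fun p : R * R => k p.1 p.2) ->
  ccont (fun p : R * R => ky p.1 p.2) ->
  (forall u z : R, is_cder (k u) z (ky u z)) ->
  is_cder (fun z => cint 0 z (k ^~ z)) y (k y y + cint 0 y (ky ^~ y)).
Proof.
move=> y0 [c1 c2] [d1 d2] dk; split; rewrite ?cReD ?cImD /=.
- apply: (@Rint_leibniz _ (fun u z => complex.Re (k u z)) (fun u z => complex.Re (ky u z))) => //.
  by move=> u z; have [] := dk u z.
- apply: (@Rint_leibniz _ (fun u z => complex.Im (k u z)) (fun u z => complex.Im (ky u z))) => //.
  by move=> u z; have [] := dk u z.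
Qed.

End ComplexIntegrals.

(** * Limits of complex sequences and dominated convergence *)

Definition ccvg {R : realType} (u : nat -> R[i]) (l : R[i]) : Prop :=
  complex.Re (u n) @[n --> \oo] --> complex.Re l /\
  complex.Im (u n) @[n --> \oo] --> complex.Im l.

Section ComplexLimits.
Context {R : realType}.
Notation mu := (@lebesgue_measure R).
Implicit Types (u v : nat -> R[i]) (l m : R[i]).

Lemma ccvg_cst l : ccvg (fun=> l) l.
Proof. by split; exact: cvg_cst. Qed.

Lemma ccvgD u v l m : ccvg u l -> ccvg v m -> ccvg (fun n => u n + v n) (l + m).
Proof.
move=> [u1 u2] [v1 v2]; split.
- by under eq_fun do rewrite cReD; rewrite cReD; exact: cvgD.
- by under eq_fun do rewrite cImD; rewrite cImD; exact: cvgD.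
Qed.

Lemma ccvgN u l : ccvg u l -> ccvg (fun n => - u n) (- l).
Proof.
move=> [u1 u2]; split.
- by under eq_fun do rewrite cReN; rewrite cReN; exact: cvgN.
- by under eq_fun do rewrite cImN; rewrite cImN; exact: cvgN.
Qed.

Lemma ccvgB u v l m : ccvg u l -> ccvg v m -> ccvg (fun n => u n - v n) (l - m).
Proof. by move=> ? ?; apply: ccvgD => //; exact: ccvgN. Qed.

Lemma ccvgM u v l m : ccvg u l -> ccvg v m -> ccvg (fun n => u n * v n) (l * m).
Proof.
move=> [u1 u2] [v1 v2]; split.
- by under eq_fun do rewrite cReM; rewrite cReM; apply: cvgB; exact: cvgM.
- by under eq_fun do rewrite cImM; rewrite cImM; apply: cvgD; exact: cvgM.
Qed.

Lemma ccvgX u l n : ccvg u l -> ccvg (fun k => u k ^+ n) (l ^+ n).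
Proof.
move=> ul; elim: n => [|n IH]; first exact: ccvg_cst.
under eq_fun do rewrite exprS.
by rewrite exprS; exact: ccvgM.
Qed.

Lemma ccvg_unique u l m : ccvg u l -> ccvg u m -> l = m.
Proof.
move=> [u1 u2] [v1 v2]; apply: complex_ext.
- exact: (cvg_unique _ u1 v1).
- exact: (cvg_unique _ u2 v2).
Qed.

Lemma eq_ccvg u v l : (forall n, u n = v n) -> ccvg u l -> ccvg v l.
Proof. by move=> /funext ->. Qed.

Lemma cint_dct (D : set R) (f_ : nat -> R -> R[i]) (f : R -> R[i]) (g : R -> R) :
  measurable D -> (forall n, cmeasurable D (f_ n)) ->
  (forall x, D x -> ccvg (fun n => f_ n x) (f x)) ->
  mu.-integrable D (EFin \o g) ->
  (forall n x, D x -> cmod (f_ n x) <= g x) ->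
  cintegrable D f /\ ccvg (fun n => cintS D (f_ n)) (cintS D f).
Proof.
move=> mD mf ff ig fg.
have [i1 c1] := @Rint_dct _ D (fun n => ReF (f_ n)) (ReF f) g mD (fun n => (mf n).1)
  (fun x Dx => (ff x Dx).1) ig (fun n x Dx => le_trans (Re_le_cmod _) (fg n x Dx)).
have [i2 c2] := @Rint_dct _ D (fun n => ImF (f_ n)) (ImF f) g mD (fun n => (mf n).2)
  (fun x Dx => (ff x Dx).2) ig (fun n x Dx => le_trans (Im_le_cmod _) (fg n x Dx)).
by split; split.
Qed.

Lemma ccont_measurable (D : set R) (f : R -> R[i]) : measurable D -> ccont f ->
  cmeasurable D f.
Proof.
by move=> mD [f1 f2]; split; apply: measurable_funTS; exact: continuous_measurable_fun.
Qed.

End ComplexLimits.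

(** * Complex Gaussian kernels for the free Schrodinger equation *)

Definition cexp {R : realType} (z : R[i]) : R[i] :=
  Complex (expR (complex.Re z) * cos (complex.Im z))
          (expR (complex.Re z) * sin (complex.Im z)).

Section ComplexExponential.
Context {R : realType}.

Lemma cmod_cexp (z : R[i]) : cmod (cexp z) = expR (complex.Re z).
Proof.
rewrite /cmod /= !exprMn -mulrDr cos2Dsin2 mulr1 sqrtr_sqr ger0_norm// expR_ge0.
Qed.

Lemma is_cder_cexp (f : R -> R[i]) (x : R) (l : R[i]) : is_cder f x l ->
  is_cder (fun y => cexp (f y)) x (l * cexp (f x)).
Proof.
move=> [f1 f2].
have e1 : is_derive x 1 (expR \o ReF f) (expR (ReF f x) * complex.Re l).
  exact: is_derive1_comp.
have c1 : is_derive x 1 (cos \o ImF f) (- sin (ImF f x) * complex.Im l).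
  exact: is_derive1_comp.
have s1 : is_derive x 1 (sin \o ImF f) (cos (ImF f x) * complex.Im l).
  exact: is_derive1_comp.
split.
- rewrite (_ : ReF _ = (expR \o ReF f) * (cos \o ImF f)); last by apply/funext.
  by apply: is_derive_eq; rewrite /GRing.scale /= cReM /= /ReF /ImF; ring.
- rewrite (_ : ImF _ = (expR \o ReF f) * (sin \o ImF f)); last by apply/funext.
  by apply: is_derive_eq; rewrite /GRing.scale /= cImM /= /ReF /ImF; ring.
Qed.

End ComplexExponential.

Section Kernel.
Context {R : realType}.
Variable d : R.
Hypothesis d_gt0 : 0 < d.

Definition rho (t : R) : R := Num.sqrt (t ^+ 2 + d ^+ 2).

Lemma rho_sqr t : rho t ^+ 2 = t ^+ 2 + d ^+ 2.
Proof. by rewrite sqr_sqrtr// addr_ge0 ?sqr_ge0. Qed.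

Lemma rho_gt_norm t : `|t| < rho t.
Proof. by rewrite -sqrtr_sqr ltr_sqrt ?ltrDl ?ltr_pwDr ?exprn_gt0 ?sqr_ge0. Qed.

Lemma rho_gt0 t : 0 < rho t.
Proof. exact: le_lt_trans (normr_ge0 _) (rho_gt_norm t). Qed.

Lemma rho_ge t : d <= rho t.
Proof. by rewrite -[leLHS]gtr0_norm// -sqrtr_sqr ler_sqrt ?lerDr ?addr_ge0 ?sqr_ge0. Qed.

Lemma rhoD_gt0 t : 0 < (rho t + t) / 2.
Proof. by have := rho_gt_norm t; rewrite ltr_norml => /andP[]; lra. Qed.

Lemma rhoB_gt0 t : 0 < (rho t - t) / 2.
Proof. by have := rho_gt_norm t; rewrite ltr_norml => /andP[]; lra. Qed.

(* The branch of (t - i d)^(-1/2) with positive real and imaginary parts. *)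
Definition kap (t : R) : R[i] :=
  Complex (Num.sqrt ((rho t + t) / 2) / rho t) (Num.sqrt ((rho t - t) / 2) / rho t).

(** The right-hand side is [1 / (t - i d)]. The product of the two radicals is [d / 2] because
    [(rho^2 - t^2) / 4 = (d / 2)^2] and [d] is positive. *)
Lemma kap_sqr t : kap t ^+ 2 = Complex (t / rho t ^+ 2) (d / rho t ^+ 2).
Proof.
have r0 : rho t != 0 by rewrite gt_eqF ?rho_gt0.
have e1 := sqr_sqrtr (ltW (rhoD_gt0 t)); have e2 := sqr_sqrtr (ltW (rhoB_gt0 t)).
have e3 : Num.sqrt ((rho t + t) / 2) * Num.sqrt ((rho t - t) / 2) = d / 2.
  rewrite -sqrtrM ?ltW ?rhoD_gt0//.
  have -> : (rho t + t) / 2 * ((rho t - t) / 2) = (d / 2) ^+ 2.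
    transitivity ((rho t ^+ 2 - t ^+ 2) / 4); first by field.
    by rewrite rho_sqr; field.
  by rewrite sqrtr_sqr gtr0_norm// divr_gt0.
rewrite expr2 /kap.
move: e1 e2 e3; set u := Num.sqrt _; set v := Num.sqrt _; set r := rho t in r0 *.
move=> e1 e2 e3; apply: complex_ext; rewrite ?cReM ?cImM /=.
- rewrite (_ : _ - _ = (u ^+ 2 - v ^+ 2) / r ^+ 2); last by field.
  by rewrite e1 e2; field.
- rewrite (_ : _ + _ = 2 * (u * v) / r ^+ 2); last by field.
  by rewrite e3; field.
Qed.

Lemma kap_inv t : kap t ^+ 2 * (t%:C - @iC R * d%:C) = 1.
Proof.
have r0 : rho t ^+ 2 != 0 by rewrite sqrf_eq0 gt_eqF ?rho_gt0.
rewrite kap_sqr; apply: complex_ext; rewrite ?(cReM, cImM, cReD, cImD, cReN, cImN) /=.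
- rewrite -[RHS](divff r0) [in X in _ = X / _]rho_sqr; field.
  by move: r0; rewrite sqrf_eq0.
- by field; move: r0; rewrite sqrf_eq0.
Qed.

Lemma kap_neq0 t : kap t != 0.
Proof.
apply/eqP => k0; have := kap_inv t; rewrite k0 expr0n mul0r => /eqP.
by rewrite eq_sym oner_eq0.
Qed.

Lemma cmod_kap_sqr t : cmod (kap t) ^+ 2 = (rho t)^-1.
Proof.
have r0 : rho t != 0 by rewrite gt_eqF ?rho_gt0.
rewrite /cmod sqr_sqrtr ?addr_ge0 ?sqr_ge0//= !exprMn !sqr_sqrtr ?ltW ?rhoD_gt0 ?rhoB_gt0//.
by field.
Qed.

Lemma kap_cderivable t : cderivable kap t.
Proof.
have h1 : derivable (fun t : R => t ^+ 2 + d ^+ 2) t 1.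
  have h : is_derive t 1 (fun t : R => t ^+ 2 + d ^+ 2) (2 * t).
    apply: is_derive_eq. rewrite /GRing.scale /=; ring.
  by have [] := h.
have sq (u : R -> R) : 0 < u t -> derivable u t 1 -> derivable (Num.sqrt \o u) t 1.
  move=> u0 /derivableP du.
  by have [] := @is_derive1_comp _ Num.sqrt u t _ _ (is_derive1_sqrt u0) du.
have dr : derivable rho t 1.
  by apply: (sq _ _ h1); rewrite ltr_wpDl ?sqr_ge0// exprn_gt0.
have div (u : R -> R) : derivable u t 1 -> derivable (fun t => u t / rho t) t 1.
  have r0 : rho t != 0 by rewrite gt_eqF ?rho_gt0.
  move=> du; exact: (derivableM du (derivableV r0 dr)).
have half (u : R -> R) : derivable u t 1 -> derivable (fun t => u t / 2) t 1.
  by move=> du; exact: (derivableM du (derivable_cst _ _ _)).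
have did : derivable (fun t : R => t) t 1 := @derivable_id R R t 1.
have hD : derivable (fun t => rho t + t) t 1 := derivableD dr did.
have hB : derivable (fun t => rho t - t) t 1 := derivableB dr did.
by split; apply: div; [exact: (sq _ (rhoD_gt0 t) (half _ hD))|exact: (sq _ (rhoB_gt0 t) (half _ hB))].
Qed.

Lemma is_cder_id t : is_cder (fun s : R => s%:C) t 1.
Proof. exact: (is_cder_real (is_derive_id t 1)). Qed.

(** Once differentiability is known, the value follows from differentiating [k^2 (t - i d) = 1],
    without computing with radicals. *)
Lemma is_cder_kap t : is_cder kap t (- (2^-1 * kap t ^+ 3)).
Proof.
have dk := cderivableP (kap_cderivable t).
set l := cderive kap t in dk *.
suff <- : l = - (2^-1 * kap t ^+ 3) by [].
have h : is_cder (fun s => kap s ^+ 2 * (s%:C - @iC R * d%:C)) t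
    (2%:R * kap t ^+ 1 * l * (t%:C - @iC R * d%:C) + kap t ^+ 2 * (1 - 0)).
  apply: is_cderM; first exact: is_cderX.
  by apply: is_cderB; [exact: is_cder_id|exact: is_cder_cst].
have h0 : is_cder (fun s => kap s ^+ 2 * (s%:C - @iC R * d%:C)) t 0.
  rewrite (_ : (fun s => _) = fun=> 1); first exact: is_cder_cst.
  by apply/funext => s; rewrite kap_inv.
have e : 2%:R * kap t ^+ 1 * l * (t%:C - @iC R * d%:C) + kap t ^+ 2 * (1 - 0) = 0.
  case: h => h1 h2; case: h0 => h01 h02; apply: complex_ext.
  - by rewrite -(@derive_val _ _ _ _ _ _ _ h1) (@derive_val _ _ _ _ _ _ _ h01).
  - by rewrite -(@derive_val _ _ _ _ _ _ _ h2) (@derive_val _ _ _ _ _ _ _ h02).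
have k0 := kap_neq0 t; have ki := kap_inv t.
have : kap t ^+ 2 * (2%:R * kap t ^+ 1 * l * (t%:C - @iC R * d%:C) + kap t ^+ 2 * (1 - 0)) = 0.
  by rewrite e mulr0.
rewrite (_ : _ * _ = 2 * kap t * l * (kap t ^+ 2 * (t%:C - @iC R * d%:C)) + kap t ^+ 4);
  last by ring.
rewrite ki mulr1 => E.
apply: (mulfI (_ : 2 * kap t != 0)); first by rewrite mulf_neq0 ?pnatr_eq0.
rewrite (_ : 2 * kap t * - _ = - kap t ^+ 4); last by field.
by apply/eqP; rewrite -addr_eq0 E.
Qed.

(** This is [i / (t - i d)], so the Gaussian is [exp (x^2 mu / 4)]. In terms of [k] and [mu] all
    derivatives stay polynomial multiples of the Gaussian, and time derivatives carry a visible
    factor [i], as in [K_t = i K_xx]. *)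
Definition mu_ (t : R) : R[i] := @iC R * kap t ^+ 2.

Lemma is_cder_kap_mu t : is_cder kap t (@iC R * (2^-1 * mu_ t * kap t)).
Proof.
apply: is_cder_eq (is_cder_kap t) _; rewrite /mu_.
rewrite (_ : @iC R * _ = (@iC R * @iC R) * (2^-1 * kap t ^+ 3)); last by ring.
by rewrite iC_sqr mulN1r.
Qed.

Lemma is_cder_mu t : is_cder mu_ t (@iC R * mu_ t ^+ 2).
Proof.
apply: is_cder_eq (is_cderZ (@iC R) (is_cderX 1 (is_cder_kap_mu t))) _.
by rewrite /mu_ expr1; field.
Qed.

Definition gau (x t : R) : R[i] := cexp ((x ^+ 2 / 4)%:C * mu_ t).

Lemma Re_mu t : complex.Re (mu_ t) = - (d / rho t ^+ 2).
Proof. by rewrite /mu_ kap_sqr cReM /= mul0r mul1r sub0r. Qed.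

Lemma cmod_mu t : cmod (mu_ t) = (rho t)^-1.
Proof. by rewrite /mu_ cmodM cmod_iC mul1r cmodX cmod_kap_sqr. Qed.

(** This decay in [x] is what the regularization provides: at [d = 0] the modulus would be 1, and
    the polynomial factors of the kernels would be unbounded. *)
Lemma cmod_gau x t : cmod (gau x t) = expR (- (x ^+ 2 * (d / (4 * rho t ^+ 2)))).
Proof.
rewrite /gau cmod_cexp cReM Re_mu; congr expR => /=.
by field; rewrite gt_eqF ?rho_gt0.
Qed.

Lemma is_cder_gau_x x t : is_cder (gau ^~ t) x ((x / 2)%:C * mu_ t * gau x t).
Proof.
apply: is_cder_cexp.
have h : is_derive x 1 (fun x : R => x ^+ 2 / 4) (x / 2).
  by apply: is_derive_eq; rewrite /GRing.scale /=; field.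
apply: is_cder_eq (is_cderM (is_cder_real h) (is_cder_cst (mu_ t) x)) _.
by rewrite mulr0 addr0.
Qed.

Lemma is_cder_gau_t x t :
  is_cder (gau x) t (@iC R * ((x ^+ 2 / 4)%:C * mu_ t ^+ 2 * gau x t)).
Proof.
apply: is_cder_eq (is_cder_cexp (is_cderZ (x ^+ 2 / 4)%:C (is_cder_mu t))) _.
rewrite /gau; ring.
Qed.

End Kernel.

Ltac cder base := first
  [ exact: is_cder_cst | base
  | apply: is_cderD; cder base | apply: is_cderB; cder base
  | apply: is_cderN; cder base
  | apply: is_cderM; cder base | apply: is_cderX; cder base ].

Section KernelFamily.
Context {R : realType}.
Variable d : R.
Hypothesis d_gt0 : 0 < d.
Local Notation k := (kap d).
Local Notation m := (mu_ d).
Local Notation g := (gau d).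

(* [ker0] solves [i u_t + u_xx = 0], is odd in [x], and [ker1 ... ker4] are its
   successive [x]-derivatives, so that [d/dt kerj = i ker(j+2)]. *)
Definition ker0 (x t : R) : R[i] := x%:C * k t ^+ 3 * g x t.
Definition ker1 (x t : R) : R[i] := k t ^+ 3 * (1 + 2^-1 * x%:C ^+ 2 * m t) * g x t.
Definition ker2 (x t : R) : R[i] :=
  k t ^+ 3 * (3 / 2 * x%:C * m t + 4^-1 * x%:C ^+ 3 * m t ^+ 2) * g x t.
Definition ker3 (x t : R) : R[i] :=
  k t ^+ 3 * (3 / 2 * m t + 3 / 2 * x%:C ^+ 2 * m t ^+ 2
              + 8^-1 * x%:C ^+ 4 * m t ^+ 3) * g x t.
Definition ker4 (x t : R) : R[i] :=
  k t ^+ 3 * (15 / 4 * x%:C * m t ^+ 2 + 5 / 4 * x%:C ^+ 3 * m t ^+ 3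
              + 16^-1 * x%:C ^+ 5 * m t ^+ 4) * g x t.

Lemma real_complex_half (x : R) : (x / 2)%:C = 2^-1 * x%:C :> R[i].
Proof. by rewrite mulrC rmorphM /= fmorphV rmorph_nat. Qed.

Lemma real_complex_sqr4 (x : R) : (x ^+ 2 / 4)%:C = 4^-1 * x%:C ^+ 2 :> R[i].
Proof. by rewrite mulrC rmorphM /= fmorphV rmorph_nat rmorphXn. Qed.

Let dgx x t : is_cder (g ^~ t) x (2^-1 * x%:C * m t * g x t).
Proof. by apply: is_cder_eq (is_cder_gau_x d x t) _; rewrite real_complex_half. Qed.

Let dgt x t : is_cder (g x) t (@iC R * (4^-1 * x%:C ^+ 2 * m t ^+ 2 * g x t)).
Proof. by apply: is_cder_eq (is_cder_gau_t d_gt0 x t) _; rewrite real_complex_sqr4. Qed.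

Ltac kx := apply: is_cder_eq;
  [cder ltac:(first [exact: is_cder_id | exact: dgx]) | by rewrite /=; field].
Ltac kt := apply: is_cder_eq;
  [cder ltac:(first [exact: is_cder_kap_mu | exact: is_cder_mu | exact: dgt]) | by rewrite /=; field].

Lemma ker0_x x t : is_cder (ker0 ^~ t) x (ker1 x t).
Proof. by rewrite /ker0 /ker1; kx. Qed.
Lemma ker1_x x t : is_cder (ker1 ^~ t) x (ker2 x t).
Proof. by rewrite /ker1 /ker2; kx. Qed.
Lemma ker2_x x t : is_cder (ker2 ^~ t) x (ker3 x t).
Proof. by rewrite /ker2 /ker3; kx. Qed.
Lemma ker3_x x t : is_cder (ker3 ^~ t) x (ker4 x t).
Proof. by rewrite /ker3 /ker4; kx. Qed.

Lemma ker0_t x t : is_cder (ker0 x) t (@iC R * ker2 x t).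
Proof. by rewrite /ker0 /ker2; kt. Qed.
Lemma ker1_t x t : is_cder (ker1 x) t (@iC R * ker3 x t).
Proof. by rewrite /ker1 /ker3; kt. Qed.
Lemma ker2_t x t : is_cder (ker2 x) t (@iC R * ker4 x t).
Proof. by rewrite /ker2 /ker4; kt. Qed.

Lemma ker4_cont t : ccont (ker4 ^~ t).
Proof.
have cg : ccont (g ^~ t) by apply: is_cder_ccont => x; exact: dgx.
have cx : ccont (fun x : R => x%:C) by apply: ccont_real => x; exact: cvg_id.
by rewrite /ker4; ccts fail.
Qed.

(** [ker0] and [ker2] are odd in [x]. Each use of Green's identity therefore involves one of the two
    boundary traces only. *)
Lemma ker_at0 t : [/\ ker0 0 t = 0, ker1 0 t = k t ^+ 3, ker2 0 t = 0
  & ker3 0 t = 3 / 2 * k t ^+ 3 * m t].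
Proof.
have g0 : g 0 t = 1.
  rewrite /gau expr0n mul0r mul0r /cexp /= expR0 cos0 sin0 mulr1 mulr0.
  by apply: complex_ext.
rewrite /ker0 /ker1 /ker2 /ker3 g0; split; rewrite ?mul0r//.
- by rewrite expr0n /= mulr0 mul0r addr0 !mulr1.
- by rewrite expr0n /= mulr0 mul0r mulr0 mul0r add0r !mulr0 mul0r.
- by rewrite expr0n /= expr0n/=; ring.
Qed.

(** Boundedness in [x] is enough for a kernel, since integrability over the half-line comes from the
    solution it is paired with. *)
Definition kbounded (K : R -> R -> R[i]) : Prop := forall T : R, exists C,
  forall x t, 0 <= x -> `|t| <= T -> cmod (K x t) <= C.

Lemma kboundedD K L : kbounded K -> kbounded L -> kbounded (fun x t => K x t + L x t).
Proof.
move=> bK bL T; have [C hC] := bK T; have [D hD] := bL T.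
exists (C + D) => x t x0 tT; apply: (le_trans (cmodD _ _)).
by rewrite lerD ?hC ?hD.
Qed.

Lemma kboundedZ K (z : R[i]) : kbounded K -> kbounded (fun x t => z * K x t).
Proof.
move=> bK T; have [C hC] := bK T.
exists (cmod z * C) => x t x0 tT; rewrite cmodM ler_wpM2l ?cmod_ge0//.
exact: hC.
Qed.

(** For a positive exponent, extracting the root of that order reduces the claim to [x <= (1 + 1/b)
    (1 + b x^2) <= (1 + 1/b) exp (b x^2)]. *)
Lemma pow_gauss_bound (n : nat) (al : R) : 0 < al ->
  exists C, forall x, 0 <= x -> x ^+ n * expR (- (x ^+ 2 * al)) <= C.
Proof.
move=> al0.
case: n => [|n].
  exists 1 => x _; rewrite expr0 mul1r -expR0 ler_expR oppr_le0.
  by rewrite mulr_ge0 ?sqr_ge0 ?ltW.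
pose b := al / n.+1%:R.
have b0 : 0 < b by rewrite divr_gt0.
exists ((1 + b^-1) ^+ n.+1) => x x0.
have -> : expR (- (x ^+ 2 * al)) = expR (- (x ^+ 2 * b)) ^+ n.+1.
  rewrite -expRM_natl; congr expR.
  by rewrite /b mulrN mulrCA [_ * (al / _)]mulrC divfK ?pnatr_eq0.
rewrite -exprMn; apply: lerXn2r; rewrite ?nnegrE ?mulr_ge0 ?expR_ge0//.
  by rewrite addr_ge0// invr_ge0 ltW.
rewrite expRN ler_pdivrMr ?expR_gt0//.
apply: (@le_trans _ _ ((1 + b^-1) * (1 + x ^+ 2 * b))).
  have bi0 : 0 < b^-1 by rewrite invr_gt0.
  have -> : (1 + b^-1) * (1 + x ^+ 2 * b) = 1 + x ^+ 2 * b + b^-1 + x ^+ 2.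
    by field; rewrite gt_eqF.
  have xb : 0 <= x ^+ 2 * b by rewrite mulr_ge0 ?sqr_ge0 ?ltW.
  have : 0 <= (x - 2^-1) ^+ 2 by exact: sqr_ge0.
  rewrite sqrrB -mulr_natl; nra.
apply: ler_wpM2l; last exact: expR_ge1Dx.
by rewrite addr_ge0 ?invr_ge0 ?ltW.
Qed.

Lemma kbounded_mono (a b : nat) :
  kbounded (fun x t => x%:C ^+ a * m t ^+ b * k t ^+ 3 * g x t).
Proof.
move=> T.
(* The smallest Gaussian rate [d / (4 rho^2)] over [|t| <= T]. *)
pose al := d / (4 * (T ^+ 2 + d ^+ 2)).
have d2 : 0 < d ^+ 2 by rewrite exprn_gt0.
have al0 : 0 < al.
  by rewrite divr_gt0// mulr_gt0// ltr_wpDl ?sqr_ge0.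
have [C hC] := pow_gauss_bound a al0.
(* A rational bound standing in for [d^(-1/2)]: it follows from [c^2 <= 1/d] and
   [c <= c^2 + 1/4]. *)
have kb t : cmod (k t) <= 1 + d^-1.
  have : cmod (k t) ^+ 2 <= d^-1.
    by rewrite cmod_kap_sqr// lef_pV2 ?posrE ?rho_gt0 ?rho_ge.
  have := cmod_ge0 (k t); move: (cmod _) => c c0 h.
  have : 0 <= (c - 2^-1) ^+ 2 by exact: sqr_ge0.
  by rewrite sqrrB -mulr_natl; nra.
have mb t : cmod (m t) <= d^-1.
  by rewrite cmod_mu// lef_pV2 ?posrE ?rho_gt0 ?rho_ge.
exists ((d^-1) ^+ b * (1 + d^-1) ^+ 3 * C) => x t x0 tT.
rewrite !cmodM !cmodX cmod_real ger0_norm//.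
rewrite [leLHS](_ : _ = (cmod (m t) ^+ b * cmod (k t) ^+ 3) * (x ^+ a * cmod (g x t)));
  last by ring.
apply: ler_pM; rewrite ?mulr_ge0 ?exprn_ge0 ?cmod_ge0//.
- by apply: ler_pM; rewrite ?exprn_ge0 ?cmod_ge0// lerXn2r ?nnegrE ?cmod_ge0//
    ?addr_ge0 ?invr_ge0 ?ltW.
- apply: le_trans (hC x x0); rewrite ler_wpM2l ?exprn_ge0// cmod_gau// ler_expR lerN2.
  rewrite ler_wpM2l ?sqr_ge0// /al ler_pM2l// lef_pV2 ?posrE; last 2 first.
  - by rewrite mulr_gt0// ltr_wpDl ?sqr_ge0.
  - by rewrite mulr_gt0// exprn_gt0// rho_gt0.
  by rewrite ler_pM2l// rho_sqr lerD2r -real_normK ?num_real// lerXn2r ?nnegrE//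
    (le_trans (normr_ge0 _) tT).
Qed.

Lemma eq_kbounded K L : (forall x t, K x t = L x t) -> kbounded K -> kbounded L.
Proof. by move=> KL bK T; have [C hC] := bK T; exists C => x t; rewrite -KL; exact: hC. Qed.

Lemma ker_bounded : [/\ kbounded ker0, kbounded ker1, kbounded ker2, kbounded ker3
  & kbounded ker4].
Proof.
have bm := kbounded_mono.
split.
- by apply: eq_kbounded (bm 1%N 0%N) => x t; rewrite /ker0 expr1 expr0 mulr1.
- apply: eq_kbounded (kboundedD (bm 0%N 0%N) (kboundedZ 2^-1 (bm 2%N 1%N))) => x t.
  by rewrite /ker1; field.
- apply: eq_kbounded (kboundedD (kboundedZ (3 / 2) (bm 1%N 1%N))
    (kboundedZ 4^-1 (bm 3%N 2%N))) => x t.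
  by rewrite /ker2; field.
- apply: eq_kbounded (kboundedD (kboundedD (kboundedZ (3 / 2) (bm 0%N 1%N))
    (kboundedZ (3 / 2) (bm 2%N 2%N))) (kboundedZ 8^-1 (bm 4%N 3%N))) => x t.
  by rewrite /ker3; field.
- apply: eq_kbounded (kboundedD (kboundedD (kboundedZ (15 / 4) (bm 1%N 2%N))
    (kboundedZ (5 / 4) (bm 3%N 3%N))) (kboundedZ 16^-1 (bm 5%N 4%N))) => x t.
  by rewrite /ker4; field.
Qed.

End KernelFamily.

(** * Green's identity on the half-line *)

Section Green.
Context {R : realType}.
Notation mu := (@lebesgue_measure R).

(** Stated for a triple so that Green's identity can be used with three consecutive members of the
    kernel family, starting at [ker0], [ker1] or [ker2]. *)
Definition free_kernel (K K1 K2 : R -> R -> R[i]) : Prop :=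
  [/\ forall x t, is_cder (K ^~ t) x (K1 x t),
      forall x t, is_cder (K1 ^~ t) x (K2 x t),
      forall t, ccont (K2 ^~ t),
      forall x t, is_cder (K x) t (@iC R * K2 x t)
    & [/\ kbounded K, kbounded K1 & kbounded K2]].

Definition decays_with (v : R -> R -> R[i]) : Prop :=
  forall T, 0 < T -> exists C, forall x s, 0 <= x -> 0 <= s -> s <= T ->
    cmod (v x s) <= C * wght x.

(* [v1], [v2] and [vt] stand for [v_x], [v_xx] and [v_t]. *)
Definition half_line_fun (v v1 v2 vt : R -> R -> R[i]) : Prop :=
  [/\ [/\ forall x s, 0 < x -> 0 < s -> is_cder (v ^~ s) x (v1 x s),
          forall x s, 0 < x -> 0 < s -> is_cder (v1 ^~ s) x (v2 x s)
        & forall x s, 0 <= x -> 0 < s -> is_cder (v x) s (vt x s)],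
      [/\ forall s, ccont (v ^~ s), forall s, ccont (v1 ^~ s), forall s, ccont (v2 ^~ s),
          forall s, ccont (vt ^~ s)
        & forall x, ccont (v x)],
      [/\ decays_with v, decays_with v1, decays_with v2 & decays_with vt]
    & forall x, 0 <= x -> v x 0 = 0].

Lemma decays_cdecay v s : decays_with v -> 0 <= s -> ccont (v ^~ s) -> cdecay (v ^~ s).
Proof.
move=> dv s0 cv; split => //.
have s1 : 0 < s + 1 by rewrite ltr_wpDl.
have [C hC] := dv (s + 1) s1.
by exists C => x x0; apply: hC => //; rewrite lerDl.
Qed.

Lemma kbounded_at K t : kbounded K ->
  exists C, forall x : R, 0 <= x -> cmod (K x t) <= C.
Proof. by move=> bK; have [C hC] := bK `|t|; exists C => x x0; exact: hC. Qed.

Lemma derive_bound (f f' : R -> R) (s M : R) : 0 < s -> continuous f ->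
  (forall c, 0 < c -> c < s -> is_derive c 1 f (f' c)) ->
  (forall c, 0 < c -> c < s -> `|f' c| <= M) ->
  `|f s - f 0| <= M * s.
Proof.
move=> s0 cf df bf.
have [||c] := @MVT _ f f' 0 s s0.
- by move=> c; rewrite in_itv/= => /andP[c0 cs]; exact: df.
- exact: continuous_subspaceT.
rewrite in_itv/= => /andP[c0 cs] ->.
by rewrite subr0 normrM (gtr0_norm s0) ler_wpM2r ?(ltW s0)// bf.
Qed.

Lemma cderive_bound (f f' : R -> R[i]) (s M : R) : 0 < s -> ccont f ->
  (forall c, 0 < c -> c < s -> is_cder f c (f' c)) ->
  (forall c, 0 < c -> c < s -> cmod (f' c) <= M) ->
  cmod (f s - f 0) <= 2 * M * s.
Proof.
move=> s0 [f1 f2] df bf; apply: (le_trans (cmod_le_ReIm _)).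
rewrite cReD cReN cImD cImN -mulrA mulrDl !mul1r; apply: lerD.
- apply: (@derive_bound (ReF f) (ReF f') s M) => // c c0 cs.
    by have [] := df c c0 cs.
  exact: le_trans (Re_le_cmod _) (bf c c0 cs).
- apply: (@derive_bound (ImF f) (ImF f') s M) => // c c0 cs.
    by have [] := df c c0 cs.
  exact: le_trans (Im_le_cmod _) (bf c c0 cs).
Qed.

Lemma squeeze_right0 (h : R -> R) (M T : R) : 0 < T ->
  (forall s, 0 < s -> s < T -> `|h s| <= M * s) -> h s @[s --> 0^'+] --> (0 : R).
Proof.
move=> T0 hM.
have c1 : M * s @[s --> 0^'+] --> (0 : R).
  rewrite -[X in _ --> X](mulr0 M); apply: cvg_at_right_filter.
  exact: mulrl_continuous.
apply: norm_cvg0; apply: (squeeze_cvgr _ (cvg_cst (0 : R)) c1).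
near=> s; rewrite normr_ge0 /=; apply: hM.
- by near: s; exact: nbhs_right_gt.
- by near: s; exact: nbhs_right_lt.
Unshelve. all: end_near. Qed.

(** The integral over space is differentiated under the integral sign at positive times and
    recovered from its time derivative. The margin [T + 1] makes [T] an interior point. *)
Lemma time_evolution (f ft : R -> R -> R[i]) (T C : R) (dd : R -> R[i]) :
  0 < T -> ccont dd ->
  (forall s, ccont (f s)) -> (forall x, 0 <= x -> ccont (f ^~ x)) ->
  (forall s x, 0 < s -> s < T + 1 -> 0 <= x -> is_cder (f ^~ x) s (ft s x)) ->
  (forall s x, 0 < s -> s < T + 1 -> 0 <= x -> cmod (f s x) <= C * wght x) ->
  (forall s x, 0 < s -> s < T + 1 -> 0 <= x -> cmod (ft s x) <= C * wght x) ->
  (forall x, 0 <= x -> f 0 x = 0) ->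
  (forall s, 0 < s -> s <= T -> cintS `[0, +oo[ (ft s) = dd s) ->
  cintS `[0, +oo[ (f T) = cint 0 T dd.
Proof.
move=> T0 cdd cfx cfs df bf bft f0 ftE.
have T1 : 0 < T + 1 by rewrite addr_gt0.
pose I (s : R) := cintS `[0, +oo[ (f s).
have dI s : 0 < s -> s <= T -> is_cder I s (dd s).
  move=> s0 sT; rewrite -ftE//.
  apply: (@cint_param_derivey _ f ft 0 (T + 1) s C) => //.
  - by rewrite in_itv/= s0 (le_lt_trans sT)// ltrDl.
  - by move=> z x; rewrite in_itv/= => /andP[z0 z1] x0; exact: df.
  - by move=> z x; rewrite in_itv/= => /andP[z0 z1] x0; exact: bf.
  - by move=> z x; rewrite in_itv/= => /andP[z0 z1] x0; exact: bft.
have I0 : I 0 = 0.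
  rewrite /I (@eq_cintS _ _ _ (fun=> 0 * 0)); last first.
    by move=> x /=; rewrite in_itv/= andbT => x0; rewrite f0// mulr0.
  rewrite cintSZ ?mul0r//; apply: cdecay_integrable; split; first exact: ccont_cst.
  by exists 0 => x _; rewrite cmod0 mul0r.
(* Nothing is known about the derivative at time 0, so continuity of [I] there comes from this
   linear bound. One factor 2 is from [cderive_bound], the other from [cmod_cintS]. *)
have bI s : 0 < s -> s < T -> cmod (I s) <= 4 * C * Rintegral mu `[0, +oo[ (@wght R) * s.
  move=> s0 sT; have s1 : s < T + 1 by rewrite (lt_trans sT)// ltrDl.
  rewrite (_ : _ * s = 2 * Rintegral mu `[0, +oo[ (fun x => (2 * C * s) * wght x)); last first.
    rewrite RintegralZl//; first by ring.
    exact: wght_integrable.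
  apply: cmod_cintS => //.
  - apply: cdecay_integrable; split => //; exists C => x x0; exact: bf.
  - exact: wght_integrableZ.
  - move=> x /=; rewrite in_itv/= andbT => x0.
    rewrite [leRHS](_ : _ = 2 * (C * wght x) * s); last by ring.
    have := @cderive_bound (f ^~ x) (ft ^~ x) s (C * wght x) s0 (cfs x x0).
    rewrite f0// subr0; apply => c c0 cs.
    - by apply: df => //; exact: lt_trans cs s1.
    - by apply: bft => //; exact: lt_trans cs s1.
rewrite -[LHS]subr0 -I0; apply/esym/(@cint_FTC2 _ dd I) => //.
- rewrite /ReF I0 /=.
  apply: (squeeze_right0 T0) => s s0 sT; exact: le_trans (Re_le_cmod _) (bI s s0 sT).
- rewrite /ImF I0 /=.
  apply: (squeeze_right0 T0) => s s0 sT; exact: le_trans (Im_le_cmod _) (bI s s0 sT).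
Qed.

Section GreenIdentity.
Variables (K K1 K2 v v1 v2 vt : R -> R -> R[i]).
Hypothesis hK : free_kernel K K1 K2.
Hypothesis hv : half_line_fun v v1 v2 vt.

Let cK t : ccont (K ^~ t).
Proof. by case: hK => k1 _ _ _ _; apply: is_cder_ccont => x; exact: k1. Qed.
Let cK1 t : ccont (K1 ^~ t).
Proof. by case: hK => _ k1 _ _ _; apply: is_cder_ccont => x; exact: k1. Qed.
Let cK2 t : ccont (K2 ^~ t).
Proof. by case: hK. Qed.

Lemma cdecay_mul (L w : R -> R -> R[i]) (t s : R) : kbounded L -> (forall t, ccont (L ^~ t)) ->
  decays_with w -> (forall s, ccont (w ^~ s)) -> 0 <= s ->
  cdecay (fun x => L x t * w x s).
Proof.
move=> bL cL dw cw s0; apply: cdecayM => //.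
- by apply: decays_cdecay.
- exact: kbounded_at.
Qed.

(** The integrand is the [x]-derivative of [K v1 - K1 v], which decays at infinity. *)
Lemma green_space (t s : R) : 0 < s ->
  cintS `[0, +oo[ (fun x => K x t * v2 x s - K2 x t * v x s) =
  K1 0 t * v 0 s - K 0 t * v1 0 s.
Proof.
move=> s0; have s0' := ltW s0.
case: hK => k1 k2 k3 k4 [b0 b1 b2].
case: hv => [[d1 d2 d3] [c0 c1 c2 ct cs] [e0 e1 e2 et] v0].
rewrite (@cint_FTC2y _ _ (fun x => K x t * v1 x s - K1 x t * v x s)).
- by rewrite opprB.
- by apply: cdecayB; exact: cdecay_mul.
- by apply: cdecayB; exact: cdecay_mul.
- move=> x x0; apply: is_cder_eq.
    apply: is_cderB; apply: is_cderM; [exact: k1|exact: d2|exact: k2|exact: d1].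
  by rewrite /=; ring.
Qed.

(** The kernel runs backwards in time along [v], from [sg + T] down to [sg], so that the two second
    [x]-derivatives combine into a boundary term. With [sg = 0] this yields the Neumann trace, with
    [sg = T - s] the shifted convolutions. The abstract [dd] lets each caller supply a simplified,
    continuous time derivative. *)
Lemma green_identity (T sg : R) (dd : R -> R[i]) : 0 < T -> 0 <= sg -> ccont dd ->
  (forall s, 0 < s -> s <= T -> dd s =
    @iC R * (K1 0 (sg + T - s) * v 0 s - K 0 (sg + T - s) * v1 0 s)
    - @iC R * cintS `[0, +oo[ (fun x => K x (sg + T - s) * (@iC R * vt x s + v2 x s))) ->
  cintS `[0, +oo[ (fun x => K x sg * v x T) = cint 0 T dd.
Proof.
move=> T0 sg0 cdd ddE.
case: hK => k1 k2 k3 k4 [b0 b1 b2].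
case: hv => [[d1 d2 d3] [c0 c1 c2 ct cs] [e0 e1 e2 et] v0].
have T1 : 0 < T + 1 by rewrite addr_gt0.
have [C0 hC0] := b0 (sg + T + 1); have [C2 hC2] := b2 (sg + T + 1).
have [D0 hD0] := e0 _ T1; have [Dt hDt] := et _ T1.
(* Beyond [T] the kernel is evaluated at times below [sg], possibly negative; this is harmless for
   positive [d], and it is why [kbounded] speaks of [|t|]. *)
have tau s : 0 < s -> s < T + 1 -> `|sg + T - s| <= sg + T + 1.
  by move=> s0 s1; rewrite ler_norml; lra.
have C00 : 0 <= C0.
  apply: le_trans (cmod_ge0 _) (hC0 0 0 (lexx _) _); rewrite normr0; lra.
have C20 : 0 <= C2.
  apply: le_trans (cmod_ge0 _) (hC2 0 0 (lexx _) _); rewrite normr0; lra.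
have -> : cintS `[0, +oo[ (fun x => K x sg * v x T) =
    cintS `[0, +oo[ (fun x => K x (sg + T - T) * v x T).
  by rewrite addrK.
apply: (@time_evolution (fun z x => K x (sg + T - z) * v x z)
    (fun z x => K x (sg + T - z) * vt x z - @iC R * K2 x (sg + T - z) * v x z)
    T (C0 * D0 + C0 * Dt + C2 * D0) dd) => //.
- by move=> z; exact: ccontM.
- move=> x x0; apply: ccontM => //.
  apply: (@ccont_comp _ _ _ (K x) (fun z => sg + T - z)).
    by move=> z; apply: cvgB; [exact: cvg_cst|exact: cvg_id].
  by apply: is_cder_ccont => z; exact: k4.
- move=> z x z0 z1 x0.
  have dz : is_derive z 1 (fun z : R => sg + T - z) (-1).
    by apply: is_derive_eq; ring.
  have hk := @is_cder_comp R (K x) (fun z => sg + T - z) z _ (-1) (k4 x (sg + T - z)) dz.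
  apply: is_cder_eq (is_cderM hk (d3 x z x0 z0)) _.
  rewrite (_ : (-1)%:C = -1 :> R[i]); last by apply: complex_ext; rewrite /= ?oppr0.
  by rewrite /=; ring.
- move=> z x z0 z1 x0.
  have hz := tau z z0 z1.
  rewrite cmodM; apply: (@le_trans _ _ (C0 * (D0 * wght x))).
    by apply: ler_pM; [exact: cmod_ge0|exact: cmod_ge0|exact: hC0|apply: hD0 => //; exact: ltW].
  rewrite mulrA ler_wpM2r ?wght_ge0// -addrA lerDl.
  have D00 : 0 <= D0 * wght x by apply: le_trans (cmod_ge0 _) (hD0 x z x0 (ltW z0) (ltW z1)).
  have Dt0 : 0 <= Dt * wght x by apply: le_trans (cmod_ge0 _) (hDt x z x0 (ltW z0) (ltW z1)).
  have w0 : 0 < wght x by rewrite invr_gt0 exprn_gt0// ltr_pwDl.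
  by rewrite addr_ge0// mulr_ge0// -(pmulr_lge0 _ w0).
- move=> z x z0 z1 x0.
  have hz := tau z z0 z1.
  have D00 : 0 <= D0 * wght x by apply: le_trans (cmod_ge0 _) (hD0 x z x0 (ltW z0) (ltW z1)).
  apply: (le_trans (cmodB _ _)); rewrite !cmodM cmod_iC mul1r.
  apply: (@le_trans _ _ (C0 * (Dt * wght x) + C2 * (D0 * wght x))).
    apply: lerD; apply: ler_pM; try exact: cmod_ge0; [exact: hC0| |exact: hC2|].
    - by apply: hDt => //; exact: ltW.
    - by apply: hD0 => //; exact: ltW.
  rewrite [leRHS](_ : _ = C0 * (D0 * wght x) +
    (C0 * (Dt * wght x) + C2 * (D0 * wght x))); last by ring.
  by rewrite lerDr mulr_ge0.
- by move=> x x0; rewrite v0// mulr0.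
- move=> s s0 sT; rewrite ddE//.
  have s0' := ltW s0.
  rewrite -(green_space (sg + T - s) s0).
  have d1' : cdecay (fun x => K x (sg + T - s) * v2 x s - K2 x (sg + T - s) * v x s).
    by apply: cdecayB; exact: cdecay_mul.
  have d2' : cdecay (fun x => K x (sg + T - s) * (@iC R * vt x s + v2 x s)).
    apply: cdecayM => //; last exact: kbounded_at.
    apply: cdecayD; last exact: decays_cdecay.
    by apply: cdecayZ; exact: decays_cdecay.
  rewrite -!cintSZ//; try exact: cdecay_integrable.
  rewrite -cintSB//; try by apply: cdecay_integrable; exact: cdecayZ.
  apply: eq_cintS => x _.
  rewrite (_ : _ - @iC R * (K x (sg + T - s) * _) =
    - (@iC R * @iC R) * K x (sg + T - s) * vt x s - @iC R * K2 x (sg + T - s) * v x s);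
    last by ring.
  by rewrite iC_sqr opprK mul1r.
Qed.

End GreenIdentity.
End Green.

(** * The cubic normal form *)

Lemma continuous_fst_comp {T U V : topologicalType} (f : T -> U * V) :
  continuous f -> continuous (fun x => (f x).1).
Proof.
move=> cf x; have h : {for f x, continuous (@fst U V)} by move: (f x) => p; exact: cvg_fst.
exact: (continuous_comp (cf x) h).
Qed.

Lemma continuous_snd_comp {T U V : topologicalType} (f : T -> U * V) :
  continuous f -> continuous (fun x => (f x).2).
Proof.
move=> cf x; have h : {for f x, continuous (@snd U V)} by move: (f x) => p; exact: cvg_snd.
exact: (continuous_comp (cf x) h).
Qed.

Lemma continuous_idfun {T : topologicalType} : continuous (fun x : T => x).
Proof. by move=> x; exact: cvg_id. Qed.

Lemma continuous_cstfun {T U : topologicalType} (u : U) : continuous (fun _ : T => u).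
Proof. by move=> x; exact: cvg_cst. Qed.

Ltac ctsR := cbv beta; lazymatch goal with
  | |- continuous (fun x => x) => exact: continuous_idfun
  | |- continuous (fun x => fst (@?f x)) => refine (@continuous_fst_comp _ _ _ f _); ctsR
  | |- continuous (fun x => snd (@?f x)) => refine (@continuous_snd_comp _ _ _ f _); ctsR
  | |- continuous (fun x => (@?f x, @?g x)) => refine (@continuous_pair _ _ _ f g _ _); ctsR
  | |- continuous (fun _ => ?c) => exact: continuous_cstfun
  | |- continuous fst => exact: (continuous_fst_comp continuous_idfun)
  | |- continuous snd => exact: (continuous_snd_comp continuous_idfun)
  end.

(** * Decay and boundedness estimates, uniform on bounded time intervals *)

Section Bounds.
Context {R : realType}.
Notation mu := (@lebesgue_measure R).

Lemma wght_le1 (x : R) : 0 <= x -> wght x <= 1.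
Proof.
move=> x0; rewrite /wght invf_le1 ?exprn_gt0 ?ltr_pwDl//.
by rewrite exprn_ege1// lerDl.
Qed.

Lemma cmod_cint_cst (f : R -> R[i]) (s M : R) : 0 <= s -> ccont f ->
  (forall x, 0 <= x -> x <= s -> cmod (f x) <= M) -> cmod (cint 0 s f) <= 2 * (M * s).
Proof.
move=> s0 cf fM.
have := @cmod_cintS _ `[0, s] f (fun=> M) _ (cintegrable_cont 0 s cf) _ _.
rewrite Rintegral_cst//= lebesgue_measure_itv/=.
have -> : fine (if (0%:E < s%:E)%E then (s%:E - 0%:E)%E else 0%E) = s.
  case: ifPn => /=; first by rewrite subr0.
  by rewrite lte_fin -leNgt => s0'; apply/eqP; rewrite eq_le s0 s0'.
apply => //.
- by apply: continuous_integrable => x; exact: cvg_cst.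
- by move=> x /=; rewrite in_itv/= => /andP[]; exact: fM.
Qed.

Lemma cmod_cint_wght (f : R -> R[i]) (y M : R) : 0 <= M -> ccont f ->
  (forall x, 0 <= x -> x <= y -> cmod (f x) <= M * wght x) ->
  cmod (cint 0 y f) <= 2 * M.
Proof.
move=> M0 cf fM.
have sub : `[0, y]%classic `<=` (`[0, +oo[%classic : set R).
  by move=> x; rewrite /= !in_itv/= andbT => /andP[].
have iw : mu.-integrable `[0, y] (EFin \o (@wght R)).
  by apply: integrableS wght_integrable.
have iM : mu.-integrable `[0, y] (EFin \o (fun x => M * wght x)).
  by apply: integrableS (wght_integrableZ M).
have := @cmod_cintS _ `[0, y] f (fun x => M * wght x) _ (cintegrable_cont 0 y cf) iM _.
rewrite RintegralZl// => h; apply: (le_trans (h _ _)) => //.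
- by move=> x /=; rewrite in_itv/= => /andP[]; exact: fM.
- by rewrite ler_pM2l// ler_piMr// Rint_wght_le.
Qed.

Implicit Types (v w a b : R -> R -> R[i]) (f g : R -> R -> R -> R[i]).

Definition bounded_with (v : R -> R -> R[i]) : Prop :=
  forall T, 0 < T -> exists C, 0 <= C /\
    forall x s, 0 <= x -> 0 <= s -> s <= T -> cmod (v x s) <= C.

Definition decays2 (f : R -> R -> R -> R[i]) : Prop :=
  forall T, 0 < T -> exists C, 0 <= C /\
    forall u y s, 0 <= u -> 0 <= y -> 0 <= s -> s <= T ->
    cmod (f u y s) <= C * (wght u * wght y).

Lemma decays_with_ge0 v : decays_with v -> forall T, 0 < T -> exists C, 0 <= C /\
  forall x s, 0 <= x -> 0 <= s -> s <= T -> cmod (v x s) <= C * wght x.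
Proof.
move=> dv T T0; have [C hC] := dv T T0; exists C; split => //.
have := hC 0 T (lexx _) (ltW T0) (lexx _).
by rewrite /wght addr0 expr1n invr1 mulr1; apply: le_trans; exact: cmod_ge0.
Qed.

Lemma decays_with_bounded v : decays_with v -> bounded_with v.
Proof.
move=> dv T T0; have [C [C0 hC]] := decays_with_ge0 dv T0; exists C; split => // x s x0 s0 sT.
by apply: (le_trans (hC x s x0 s0 sT)); rewrite ler_piMr// wght_le1.
Qed.

Lemma decays_withD v w : decays_with v -> decays_with w ->
  decays_with (fun x s => v x s + w x s).
Proof.
move=> dv dw T T0; have [C hC] := dv T T0; have [D hD] := dw T T0.
exists (C + D) => x s x0 s0 sT; rewrite mulrDl; apply: (le_trans (cmodD _ _)).
by rewrite lerD ?hC ?hD.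
Qed.

Lemma decays_withN v : decays_with v -> decays_with (fun x s => - v x s).
Proof.
by move=> dv T T0; have [C hC] := dv T T0; exists C => x s *; rewrite cmodN; exact: hC.
Qed.

Lemma decays_withM b v : bounded_with b -> decays_with v ->
  decays_with (fun x s => b x s * v x s).
Proof.
move=> bb dv T T0; have [C [C0 hC]] := bb T T0; have [D hD] := dv T T0.
exists (C * D) => x s x0 s0 sT; rewrite cmodM -mulrA.
by apply: ler_pM; rewrite ?cmod_ge0 ?hC ?hD.
Qed.

Lemma decays_withM' v b : decays_with v -> bounded_with b ->
  decays_with (fun x s => v x s * b x s).
Proof.
move=> dv bb; have := decays_withM bb dv.
by move=> h T T0; have [C hC] := h T T0; exists C => x s; rewrite mulrC; exact: hC.
Qed.

Lemma bounded_with_cst (z : R[i]) : bounded_with (fun _ _ => z).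
Proof. by move=> T _; exists (cmod z); split => //; exact: cmod_ge0. Qed.

Lemma bounded_with_at0 v : bounded_with v -> bounded_with (fun _ s => v 0 s).
Proof.
by move=> bv T T0; have [C [C0 hC]] := bv T T0; exists C; split => // x s _; exact: hC.
Qed.

Lemma bounded_with_conjc v : bounded_with v -> bounded_with (fun x s => conjc (v x s)).
Proof.
by move=> bv T T0; have [C [C0 hC]] := bv T T0; exists C; split => // x s *;
  rewrite cmod_conjc; exact: hC.
Qed.

Lemma decays2M a b : decays_with a -> decays_with b ->
  decays2 (fun u y s => conjc (a u s) * b y s).
Proof.
move=> da db T T0; have [C [C0 hC]] := decays_with_ge0 da T0.
have [D [D0 hD]] := decays_with_ge0 db T0.
exists (C * D); split; first exact: mulr_ge0.
move=> u y s u0 y0 s0 sT; rewrite cmodM cmod_conjc mulrACA.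
by apply: ler_pM; rewrite ?cmod_ge0 ?hC ?hD.
Qed.

Lemma decays2B f g : decays2 f -> decays2 g ->
  decays2 (fun u y s => f u y s - g u y s).
Proof.
move=> df dg T T0; have [C [C0 hC]] := df T T0; have [D [D0 hD]] := dg T T0.
exists (C + D); split; first exact: addr_ge0.
move=> u y s u0 y0 s0 sT; rewrite mulrDl; apply: (le_trans (cmodB _ _)).
by rewrite lerD ?hC ?hD.
Qed.

Lemma decays2D f g : decays2 f -> decays2 g ->
  decays2 (fun u y s => f u y s + g u y s).
Proof.
move=> df dg T T0; have [C [C0 hC]] := df T T0; have [D [D0 hD]] := dg T T0.
exists (C + D); split; first exact: addr_ge0.
move=> u y s u0 y0 s0 sT; rewrite mulrDl; apply: (le_trans (cmodD _ _)).
by rewrite lerD ?hC ?hD.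
Qed.

Lemma decays2_bounded b f : bounded_with b -> decays2 f ->
  decays2 (fun u y s => b u s * f u y s).
Proof.
move=> bb df T T0; have [C [C0 hC]] := bb T T0; have [D [D0 hD]] := df T T0.
exists (C * D); split; first exact: mulr_ge0.
move=> u y s u0 y0 s0 sT; rewrite cmodM -mulrA.
by apply: ler_pM; rewrite ?cmod_ge0 ?hC ?hD.
Qed.

Lemma decays2_time f : decays2 f -> (forall u y, ccont (f u y)) ->
  decays2 (fun u y s => cint 0 s (f u y)).
Proof.
move=> df cf T T0; have [C [C0 hC]] := df T T0.
exists (2 * (C * T)); split; first by rewrite !mulr_ge0// ltW.
move=> u y s u0 y0 s0 sT.
have w0 : 0 <= wght u * wght y by rewrite mulr_ge0 ?wght_ge0.
apply: (le_trans (@cmod_cint_cst (f u y) s (C * (wght u * wght y)) s0 (cf u y) _)).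
  by move=> r r0 rs; apply: hC => //; exact: le_trans rs sT.
rewrite [leLHS](_ : _ = (2 * C * (wght u * wght y)) * s); last by ring.
rewrite [leRHS](_ : _ = (2 * C * (wght u * wght y)) * T); last by ring.
by rewrite ler_wpM2l// mulr_ge0// mulr_ge0.
Qed.

(** The weight in [u] has mass at most 1 on [[0, y]], so it is integrated away while the weight in
    [y] survives. *)
Lemma decays2_space f : decays2 f -> (forall y s, ccont (fun u => f u y s)) ->
  decays_with (fun y s => cint 0 y (fun u => f u y s)).
Proof.
move=> df cf T T0; have [C [C0 hC]] := df T T0.
exists (2 * C) => y s y0 s0 sT.
rewrite -mulrA; apply: cmod_cint_wght => //; first by rewrite mulr_ge0 ?wght_ge0.
by move=> u u0 _; rewrite -mulrA [wght y * _]mulrC; exact: hC.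
Qed.

Lemma decays2_at0 f : decays2 f -> decays_with (fun y s => f 0 y s).
Proof.
move=> df T T0; have [C [C0 hC]] := df T T0; exists C => y s y0 s0 sT.
apply: (le_trans (hC 0 y s (lexx _) y0 s0 sT)).
by rewrite ler_wpM2l// ler_piMl ?wght_ge0 ?wght_le1.
Qed.

Lemma bounded_with_cint a b : decays_with a -> bounded_with b ->
  (forall s, ccont (a ^~ s)) -> (forall s, ccont (b ^~ s)) ->
  bounded_with (fun y s => cint 0 y (fun u => a u s * b u s)).
Proof.
move=> da bb ca cb T T0; have [C [C0 hC]] := decays_with_ge0 da T0.
have [D [D0 hD]] := bb T T0.
exists (2 * (C * D)); split; first by rewrite !mulr_ge0.
move=> y s y0 s0 sT; apply: cmod_cint_wght; first exact: mulr_ge0.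
  exact: ccontM.
move=> u u0 _; rewrite cmodM mulrAC.
by apply: ler_pM; rewrite ?cmod_ge0 ?hC ?hD.
Qed.

End Bounds.

Section NormalForm.
Context {R : realType}.
Variables (q qx qxx qt : R -> R -> R[i]).
Hypothesis dqx : forall x s, is_cder (q ^~ s) x (qx x s).
Hypothesis dqxx : forall x s, is_cder (qx ^~ s) x (qxx x s).
Hypothesis dqt : forall x s, is_cder (q x) s (qt x s).
Hypothesis cq : ccont (fun p : R * R => q p.1 p.2).
Hypothesis cqx : ccont (fun p : R * R => qx p.1 p.2).
Hypothesis cqxx : ccont (fun p : R * R => qxx p.1 p.2).
Hypothesis cqt : ccont (fun p : R * R => qt p.1 p.2).
Hypothesis bq : decays_with q.
Hypothesis bqx : decays_with qx.
Hypothesis bqxx : decays_with qxx.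
Hypothesis bqt : decays_with qt.
Hypothesis pde : forall x s, 0 <= x -> 0 < s -> @iC R * qt x s + qxx x s = 0.
Hypothesis q_init : forall x, 0 <= x -> q x 0 = 0.

(* [corr u y s] is the integral of [conj (q v s) * q (v + y - u) s] over [v >= u]. *)
Definition corr (u y s : R) : R[i] :=
  @iC R * cint 0 s (fun r => conjc (qx u r) * q y r - conjc (q u r) * qx y r).
Definition corr_y (u y s : R) : R[i] :=
  @iC R * cint 0 s (fun r => conjc (qx u r) * qx y r - conjc (q u r) * qxx y r).
Definition corr_u (u y s : R) : R[i] :=
  @iC R * cint 0 s (fun r => conjc (qxx u r) * q y r - conjc (qx u r) * qx y r).

Definition abs2 (x s : R) : R[i] := q x s * conjc (q x s).

(** The normal form S. In [nf_y] and [nf_yy] the [y]-derivative of [corr] under the integral has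
    been moved onto the outer factor, as justified by [conv_derive]. *)
Definition nf (y s : R) : R[i] := cint 0 y (fun u => q u s * corr u y s).
Definition nf_y (y s : R) : R[i] := q 0 s * corr 0 y s
  + cint 0 y (fun u => qx u s * corr u y s) - q y s * cint 0 y (fun u => abs2 u s).
Definition nf_yy (y s : R) : R[i] := q 0 s * corr_y 0 y s
  + (qx 0 s * corr 0 y s + cint 0 y (fun u => qxx u s * corr u y s)
     - q y s * cint 0 y (fun u => qx u s * conjc (q u s)))
  - (qx y s * cint 0 y (fun u => abs2 u s) + q y s * abs2 y s).
Definition nf_t (y s : R) : R[i] := cint 0 y (fun u => qt u s * corr u y s
  + q u s * (@iC R * (conjc (qx u s) * q y s - conjc (q u s) * qx y s))).

Ltac atoms := cbv beta; lazymatch goal with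
  | |- ccont (fun x => q (@?f x) (@?g x)) => refine (@ccont_pair R _ _ _ q f g cq _ _); ctsR
  | |- ccont (fun x => qx (@?f x) (@?g x)) => refine (@ccont_pair R _ _ _ qx f g cqx _ _); ctsR
  | |- ccont (fun x => qxx (@?f x) (@?g x)) => refine (@ccont_pair R _ _ _ qxx f g cqxx _ _); ctsR
  | |- ccont (fun x => qt (@?f x) (@?g x)) => refine (@ccont_pair R _ _ _ qt f g cqt _ _); ctsR
  end.
Ltac cts := ccts ltac:(atoms).

Let gen_cont (h : R -> R -> R -> R[i]) :
  ccont (fun z : (R * R) * R => h z.1.1 z.1.2 z.2) ->
  ccont (fun z : (R * R) * R => @iC R * cint 0 z.2 (h z.1.1 z.1.2)).
Proof.
move=> ch; apply: ccontM; first exact: ccont_cst.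
exact: (@cint_upper_cont R (R * R)%type (fun p r => h p.1 p.2 r)).
Qed.

Lemma corr_cont3 : ccont (fun z : (R * R) * R => corr z.1.1 z.1.2 z.2).
Proof.
apply: (gen_cont (h := fun u y r => conjc (qx u r) * q y r - conjc (q u r) * qx y r)).
by cts.
Qed.

Lemma corr_y_cont3 : ccont (fun z : (R * R) * R => corr_y z.1.1 z.1.2 z.2).
Proof.
apply: (gen_cont (h := fun u y r => conjc (qx u r) * qx y r - conjc (q u r) * qxx y r)).
by cts.
Qed.

Lemma ccont3 {T : topologicalType} (h : R -> R -> R -> R[i]) (f1 f2 f3 : T -> R) :
  ccont (fun z : (R * R) * R => h z.1.1 z.1.2 z.2) ->
  continuous f1 -> continuous f2 -> continuous f3 ->
  ccont (fun x => h (f1 x) (f2 x) (f3 x)).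
Proof.
move=> ch c1 c2 c3.
apply: (@ccont_comp _ _ _ (fun z : (R * R) * R => h z.1.1 z.1.2 z.2)
  (fun x => ((f1 x, f2 x), f3 x))) => //.
by do 2?apply: continuous_pair.
Qed.

Ltac atoms3 := cbv beta; lazymatch goal with
  | |- ccont (fun x => corr (@?f x) (@?g x) (@?h x)) =>
    refine (@ccont3 _ corr f g h corr_cont3 _ _ _); ctsR
  | |- ccont (fun x => corr_y (@?f x) (@?g x) (@?h x)) =>
    refine (@ccont3 _ corr_y f g h corr_y_cont3 _ _ _); ctsR
  | |- _ => atoms
  end.
Ltac cts3 := ccts ltac:(atoms3).

Lemma corr_dy u y s : is_cder (fun y => corr u y s) y (corr_y u y s).
Proof.
apply: is_cderZ.
apply: (@cint_param_derive _
  (fun y r => conjc (qx u r) * q y r - conjc (q u r) * qx y r)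
  (fun y r => conjc (qx u r) * qx y r - conjc (q u r) * qxx y r) 0 s (y - 1) (y + 1)).
- by rewrite in_itv/=; apply/andP; split; lra.
- by move=> z; cts.
- move=> z r _ _; apply: is_cder_eq.
    by apply: is_cderB; apply: is_cderM; first [exact: is_cder_cst|exact: dqx|exact: dqxx].
  by rewrite !mul0r !add0r.
- by cts.
Qed.

Lemma corr_du u y s : is_cder (fun u => corr u y s) u (corr_u u y s).
Proof.
apply: is_cderZ.
apply: (@cint_param_derive _
  (fun u r => conjc (qx u r) * q y r - conjc (q u r) * qx y r)
  (fun u r => conjc (qxx u r) * q y r - conjc (qx u r) * qx y r) 0 s (u - 1) (u + 1)).
- by rewrite in_itv/=; apply/andP; split; lra.
- by move=> z; cts.
- move=> z r _ _; apply: is_cder_eq.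
    apply: is_cderB; apply: is_cderM; first
      [exact: is_cder_cst|apply: is_cder_conjc; exact: dqx|apply: is_cder_conjc; exact: dqxx].
  by rewrite !mulr0 !addr0.
- by cts.
Qed.

Lemma corr_dt u y s : 0 < s -> is_cder (corr u y) s
  (@iC R * (conjc (qx u s) * q y s - conjc (q u s) * qx y s)).
Proof.
move=> s0; apply: is_cderZ.
apply: (@cint_FTC1 _ (fun r => conjc (qx u r) * q y r - conjc (q u r) * qx y r)) => //.
by cts.
Qed.

Let qxxE x s : 0 <= x -> 0 < s -> qxx x s = - (@iC R * qt x s).
Proof. by move=> x0 s0; apply/eqP; rewrite -addr_eq0 addrC pde. Qed.

(** Moving [u] and [y] together leaves [y - u] unchanged and shifts only the lower limit of the
    space integral that [corr] encodes. In the time-integral form, the sum of derivatives is minus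
    the integral of the time derivative of [conj (q u) * q y]. *)
Lemma corr_transport u y s : 0 <= u -> 0 <= y -> 0 < s ->
  corr_u u y s + corr_y u y s = - (conjc (q u s) * q y s).
Proof.
move=> u0 y0 s0; rewrite /corr_u /corr_y -mulrDr -cintD; [|by cts|by cts].
have : cint 0 s (fun r => conjc (qt u r) * q y r + conjc (q u r) * qt y r) =
    conjc (q u s) * q y s - conjc (q u 0) * q y 0.
  apply: (@cint_FTC2_cont _ _ (fun r => conjc (q u r) * q y r)) => //; [by cts|by cts|].
  move=> r r0 rs; apply: is_cderM; last exact: dqt.
  by apply: is_cder_conjc; exact: dqt.
rewrite !q_init// mulr0 subr0 => <-.
rewrite -cintZ; last by cts.
rewrite -cintN; last by cts.
(* The equation is available at positive times only. At [r = 0] each second derivative is multiplied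
   by a vanishing initial value, and the other terms cancel. *)
apply: eq_cint => r; rewrite le_eqVlt => /predU1P[<-|r0] _.
  by rewrite !q_init// conjc0 ?mul0r ?mulr0; ring.
rewrite !qxxE// conjcN conjcM conjc_iC.
have e := @iC_sqr R.
transitivity ((@iC R * @iC R) * (conjc (qt u r) * q y r + conjc (q u r) * qt y r)).
  by ring.
by rewrite e mulN1r.
Qed.

(** The Leibniz rule produces [corr_y]; [corr_transport] trades it for [corr_u], and integration by
    parts in [u] cancels the diagonal term [w y * corr y y s]. Since the derivative lands on [w], a
    second application needs no third derivative of [q]. *)
Lemma conv_derive (w w' : R -> R[i]) (y s : R) : 0 < y -> 0 < s ->
  (forall u, is_cder w u (w' u)) -> ccont w' ->
  is_cder (fun y => cint 0 y (fun u => w u * corr u y s)) y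
    (w 0 * corr 0 y s + cint 0 y (fun u => w' u * corr u y s)
     - q y s * cint 0 y (fun u => w u * conjc (q u s))).
Proof.
move=> y0 s0 dw cw'.
have cw : ccont w by exact: is_cder_ccont dw.
have c1 : ccont (fun p : R * R => w p.1) by apply: ccont_comp => //; ctsR.
apply: is_cder_eq.
  apply: (@cint_leibniz _ (fun u z => w u * corr u z s) (fun u z => w u * corr_y u z s)) => //.
  - by cts3.
  - by cts3.
  - by move=> u z; apply: is_cderZ; exact: corr_dy.
have : cint 0 y (fun u => w' u * corr u y s + w u * corr_u u y s) =
    w y * corr y y s - w 0 * corr 0 y s.
  have cu : ccont (fun u => corr_u u y s).
    apply: ccontM; first exact: ccont_cst.
    apply: (@cint_param_cont _ _ (fun u r => conjc (qxx u r) * q y r - conjc (qx u r) * qx y r)).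
    by cts.
  apply: (@cint_FTC2_cont _ _ (fun u => w u * corr u y s)) => //.
  - by apply: ccontD; apply: ccontM => //; cts3.
  - by cts3.
  - by move=> u u0 uy; apply: is_cderM; [exact: dw|exact: corr_du].
rewrite (@eq_cint _ _ _ _ (fun u => w' u * corr u y s - w u * corr_y u y s
  - q y s * (w u * conjc (q u s)))); last first.
  move=> u u0 uy; rewrite [corr_u _ _ _](_ : _ = - (conjc (q u s) * q y s) - corr_y u y s).
    have alg (a b c e f : R[i]) : a + b * (- (c * e) - f) = a - b * f - e * (b * c) by ring.
    exact: alg.
  by rewrite -(corr_transport u0 (ltW y0) s0) addrK.
rewrite cintB; [|by cts3|by cts3].
rewrite cintB; [|by cts3|by cts3].
rewrite cintZ; last by cts3.
have alg (a1 a2 a3 a4 a5 : R[i]) : a1 - a2 - a3 = a4 - a5 -> a4 + a2 = a5 + a1 - a3.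
  by move=> h; rewrite -[a4](subrK a5) -h; ring.
by move=> E; exact: alg.
Qed.

Lemma nf_dy y s : 0 < y -> 0 < s -> is_cder (nf ^~ s) y (nf_y y s).
Proof.
move=> y0 s0; apply: (@conv_derive (q ^~ s) (qx ^~ s)) => //; cts.
Qed.

Lemma nf_dyy y s : 0 < y -> 0 < s -> is_cder (nf_y ^~ s) y (nf_yy y s).
Proof.
move=> y0 s0; apply: is_cderB; first apply: is_cderD.
- by apply: is_cderZ; exact: corr_dy.
- by apply: (@conv_derive (qx ^~ s) (qxx ^~ s)) => //; cts.
- apply: is_cderM; first exact: dqx.
  by apply: (@cint_FTC1 _ (fun u => abs2 u s)) => //; rewrite /abs2; cts.
Qed.

Lemma nf_dt y s : 0 < s -> is_cder (nf y) s (nf_t y s).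
Proof.
move=> s0.
apply: (@cint_param_derive _ (fun s u => q u s * corr u y s) (fun s u => qt u s * corr u y s
  + q u s * (@iC R * (conjc (qx u s) * q y s - conjc (q u s) * qx y s))) 0 y 0 (s + 1)).
- by rewrite in_itv/= s0/= ltrDl.
- by move=> z; cts3.
- move=> z u; rewrite in_itv/= => /andP[z0 _] _.
  exact: (is_cderM (dqt u z) (corr_dt u y z0)).
- by cts3.
Qed.

Let cint_cont2 (h : R -> R -> R -> R[i]) :
  ccont (fun z : (R * R) * R => h z.1.1 z.1.2 z.2) ->
  ccont (fun p : R * R => cint 0 p.1 (fun u => h u p.1 p.2)).
Proof.
move=> ch.
have h1 : ccont (fun z : (R * R) * R => cint 0 z.2 (fun u => h u z.1.1 z.1.2)).
  apply: (@cint_upper_cont R (R * R)%type (fun p u => h u p.1 p.2)).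
  by apply: (ccont3 ch); ctsR.
apply: (@ccont_comp _ _ _ _ (fun p : R * R => (p, p.1)) _ h1).
by ctsR.
Qed.

Lemma ccont_along1 (h : R -> R -> R[i]) s :
  ccont (fun p : R * R => h p.1 p.2) -> ccont (h ^~ s).
Proof. by move=> ch; apply: (@ccont_pair R _ _ _ h _ _ ch); ctsR. Qed.

Lemma ccont_along2 (h : R -> R -> R[i]) x :
  ccont (fun p : R * R => h p.1 p.2) -> ccont (h x).
Proof. by move=> ch; apply: (@ccont_pair R _ _ _ h _ _ ch); ctsR. Qed.

Lemma nf_cont : ccont (fun p : R * R => nf p.1 p.2).
Proof. by apply: (cint_cont2 (h := fun u y s => q u s * corr u y s)); cts3. Qed.

Lemma nf_t_cont : ccont (fun p : R * R => nf_t p.1 p.2).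
Proof.
apply: (cint_cont2 (h := fun u y s => qt u s * corr u y s
  + q u s * (@iC R * (conjc (qx u s) * q y s - conjc (q u s) * qx y s)))).
by cts3.
Qed.

Let cint_abs2_cont : ccont (fun p : R * R => cint 0 p.1 (fun u => abs2 u p.2)).
Proof. by apply: (cint_cont2 (h := fun u y s => abs2 u s)); rewrite /abs2; cts3. Qed.

Let cint_qxq_cont :
  ccont (fun p : R * R => cint 0 p.1 (fun u => qx u p.2 * conjc (q u p.2))).
Proof. by apply: (cint_cont2 (h := fun u y s => qx u s * conjc (q u s))); cts3. Qed.

Let cint_corr_cont (w : R -> R -> R[i]) : ccont (fun p : R * R => w p.1 p.2) ->
  ccont (fun p : R * R => cint 0 p.1 (fun u => w u p.2 * corr u p.1 p.2)).
Proof.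
move=> cw; apply: (cint_cont2 (h := fun u y s => w u s * corr u y s)).
by apply: ccontM; [apply: (@ccont_pair R _ _ _ w _ _ cw); ctsR|cts3].
Qed.

Lemma nf_y_cont : ccont (fun p : R * R => nf_y p.1 p.2).
Proof.
apply: ccontD; last by apply: ccontN; apply: ccontM; [cts3|exact: cint_abs2_cont].
by apply: ccontD; [cts3|exact: cint_corr_cont].
Qed.

Lemma nf_yy_cont : ccont (fun p : R * R => nf_yy p.1 p.2).
Proof.
apply: ccontD; first (apply: ccontD; first by cts3).
- apply: ccontD; last by apply: ccontN; apply: ccontM; [cts3|exact: cint_qxq_cont].
  by apply: ccontD; [cts3|exact: cint_corr_cont].
- apply: ccontN; apply: ccontD; last by rewrite /abs2; cts3.
  by apply: ccontM; [cts3|exact: cint_abs2_cont].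
Qed.

Lemma corr_decays : decays2 corr.
Proof.
refine (@decays2_bounded _ (fun _ _ => @iC R)
  (fun u y s => cint 0 s (fun r => conjc (qx u r) * q y r - conjc (q u r) * qx y r)) (bounded_with_cst _) _).
refine (@decays2_time _ (fun u y r => conjc (qx u r) * q y r - conjc (q u r) * qx y r) _ _).
  by refine (decays2B (decays2M _ _) (decays2M _ _)).
by move=> u y; cts.
Qed.

Lemma corr_y_decays : decays2 corr_y.
Proof.
refine (@decays2_bounded _ (fun _ _ => @iC R)
  (fun u y s => cint 0 s (fun r => conjc (qx u r) * qx y r - conjc (q u r) * qxx y r)) (bounded_with_cst _) _).
refine (@decays2_time _ (fun u y r => conjc (qx u r) * qx y r - conjc (q u r) * qxx y r) _ _).
  by refine (decays2B (decays2M _ _) (decays2M _ _)).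
by move=> u y; cts.
Qed.

Let cint_corr_decays (w : R -> R -> R[i]) : ccont (fun p : R * R => w p.1 p.2) ->
  decays_with w -> decays_with (fun y s => cint 0 y (fun u => w u s * corr u y s)).
Proof.
move=> cw dw.
refine (@decays2_space _ (fun u y s => w u s * corr u y s)
  (decays2_bounded (decays_with_bounded dw) corr_decays) _).
by move=> y s; apply: ccontM; [exact: (ccont_along1 _ cw)|cts3].
Qed.

Let at0_corr (b : R -> R -> R[i]) (f : R -> R -> R -> R[i]) : decays_with b -> decays2 f ->
  decays_with (fun y s => b 0 s * f 0 y s).
Proof.
move=> db df.
exact: decays_withM (bounded_with_at0 (decays_with_bounded db)) (decays2_at0 df).
Qed.

Let conjc_q_bounded : bounded_with (fun y s => conjc (q y s)).
Proof. exact: bounded_with_conjc (decays_with_bounded bq). Qed.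

Let abs2_bounded : bounded_with (fun y s => cint 0 y (fun u => abs2 u s)).
Proof.
refine (@bounded_with_cint _ q (fun y s => conjc (q y s)) bq conjc_q_bounded _ _) => s; cts.
Qed.

Let qxq_bounded : bounded_with (fun y s => cint 0 y (fun u => qx u s * conjc (q u s))).
Proof.
refine (@bounded_with_cint _ qx (fun y s => conjc (q y s)) bqx conjc_q_bounded _ _) => s; cts.
Qed.

Lemma nf_decays : decays_with nf.
Proof. exact: cint_corr_decays cq bq. Qed.

Lemma nf_y_decays : decays_with nf_y.
Proof.
exact: (decays_withD (decays_withD (at0_corr bq corr_decays) (cint_corr_decays cqx bqx))
  (decays_withN (decays_withM' bq abs2_bounded))).
Qed.

Lemma nf_yy_decays : decays_with nf_yy.
Proof.
have dabs2 : decays_with abs2 := decays_withM' bq conjc_q_bounded.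
exact: (decays_withD (decays_withD (at0_corr bq corr_y_decays)
    (decays_withD (decays_withD (at0_corr bqx corr_decays) (cint_corr_decays cqxx bqxx))
      (decays_withN (decays_withM' bq qxq_bounded))))
  (decays_withN (decays_withD (decays_withM' bqx abs2_bounded)
    (decays_withM' bq (decays_with_bounded dabs2))))).
Qed.

Lemma nf_t_decays : decays_with nf_t.
Proof.
refine (@decays2_space _ (fun u y s => qt u s * corr u y s
  + q u s * (@iC R * (conjc (qx u s) * q y s - conjc (q u s) * qx y s))) _ _).
  exact: (decays2D (decays2_bounded (decays_with_bounded bqt) corr_decays)
    (decays2_bounded (decays_with_bounded bq) (decays2_bounded (bounded_with_cst (@iC R))
      (decays2B (decays2M bqx bq) (decays2M bq bqx))))).
by move=> y s; cts3.
Qed.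

Lemma nf_half_line : half_line_fun nf nf_y nf_yy nf_t.
Proof.
split.
- split.
  + by move=> *; exact: nf_dy.
  + by move=> *; exact: nf_dyy.
  + by move=> *; exact: nf_dt.
- split.
  + by move=> s; exact: (ccont_along1 s nf_cont).
  + by move=> s; exact: (ccont_along1 s nf_y_cont).
  + by move=> s; exact: (ccont_along1 s nf_yy_cont).
  + by move=> s; exact: (ccont_along1 s nf_t_cont).
  + by move=> x; exact: (ccont_along2 x nf_cont).
- split; [exact: nf_decays|exact: nf_y_decays|exact: nf_yy_decays|exact: nf_t_decays].
- move=> y y0; rewrite /nf (@eq_cint _ _ _ _ (fun=> 0 * 0)).
    by rewrite cintZ ?mul0r//; exact: ccont_cst.
  by move=> u u0 _; rewrite q_init ?mul0r.
Qed.

(** The integrals of [qxx * corr] cancel, as do the multiples of the integral of [abs2]. The two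
    halves of the derivative of [abs2], one from [nf_t] and one from [nf_yy], add up to
    [abs2 y s - abs2 0 s]. With the diagonal term of [nf_yy] this gives the factor 2, and it leaves
    the boundary coefficient [abs2 0 s]. *)
Lemma nf_pde y s : 0 <= y -> 0 < s -> @iC R * nf_t y s + nf_yy y s =
  - (2 * abs2 y s * q y s)
  + (abs2 0 s * q y s + qx 0 s * corr 0 y s + q 0 s * corr_y 0 y s).
Proof.
move=> y0 s0.
have e := @iC_sqr R.
have E1 : @iC R * nf_t y s = - cint 0 y (fun u => qxx u s * corr u y s)
    - q y s * cint 0 y (fun u => q u s * conjc (qx u s))
    + qx y s * cint 0 y (fun u => abs2 u s).
  rewrite /nf_t -cintZ; last by cts3.
  rewrite -!cintZ; [|by rewrite /abs2; cts|by cts].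
  rewrite -cintN; last by cts3.
  rewrite -cintB; [|by apply: ccontN; cts3|by cts3].
  rewrite -cintD; [|by cts3|by rewrite /abs2; cts].
  apply: eq_cint => u u0 uy; rewrite /abs2.
  transitivity (@iC R * qt u s * corr u y s
    + (@iC R * @iC R) * q u s * (conjc (qx u s) * q y s - conjc (q u s) * qx y s)).
    have alg (i a c x y1 : R[i]) : i * (a * c + x * (i * y1)) = i * a * c + (i * i) * x * y1.
      by ring.
    exact: alg.
  rewrite e (_ : @iC R * qt u s = - qxx u s); last by rewrite qxxE// opprK.
  have alg (a c x y1 z w t : R[i]) : - a * c + -1 * x * (y1 * z - w * t) =
    - (a * c) - z * (x * y1) + t * (x * w) by ring.
  exact: alg.
have E2 : cint 0 y (fun u => qx u s * conjc (q u s)) +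
    cint 0 y (fun u => q u s * conjc (qx u s)) = abs2 y s - abs2 0 s.
  move: y0; rewrite le_eqVlt => /predU1P[<-|y0].
    by rewrite !cint_ge ?lexx// addr0 subrr.
  rewrite -cintD; [|by cts|by cts].
  apply: (@cint_FTC2_cont _ _ (abs2 ^~ s)) => //.
  - by cts.
  - by rewrite /abs2; cts.
  - move=> u u0 uy; apply: is_cderM; first exact: dqx.
    by apply: is_cder_conjc; exact: dqx.
rewrite E1 /nf_yy.
have alg (c1 c2 c3 c4 q0 qx0 p0 p1 qy qxy b b0 : R[i]) : c1 + c2 = b - b0 ->
    - c3 - qy * c2 + qxy * c4 + (q0 * p1 + (qx0 * p0 + c3 - qy * c1) - (qxy * c4 + qy * b)) =
    - (2 * b * qy) + (b0 * qy + qx0 * p0 + q0 * p1).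
  by move=> h; rewrite -[c1](addrK c2) h; ring.
exact: alg.
Qed.

(** The normal form vanishes on the boundary and so keeps the Dirichlet data. This Neumann trace is
    its whole contribution at [x = 0], and becomes the last term of the third coefficient. *)
Lemma nf_y_at0 s : nf_y 0 s = q 0 s * corr 0 0 s.
Proof. by rewrite /nf_y !cint_ge// mulr0 addr0 subr0. Qed.

End NormalForm.

(** * The regularized trace identity *)

Lemma iC_neq0 {R : realType} : @iC R != 0.
Proof.
apply/eqP => i0; have := @iC_sqr R.
by rewrite i0 mul0r => /eqP; rewrite eq_sym oppr_eq0 oner_eq0.
Qed.

Section Trace.
Context {R : realType}.
Notation mu := (@lebesgue_measure R).
Variable d : R.
Hypothesis d_gt0 : 0 < d.
Local Notation k := (kap d).
Local Notation K0 := (ker0 d).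
Local Notation K1 := (ker1 d).
Local Notation K2 := (ker2 d).
Local Notation K3 := (ker3 d).
Local Notation K4 := (ker4 d).

Lemma free_kernel0 : free_kernel K0 K1 K2.
Proof.
have [b0 b1 b2 b3 b4] := ker_bounded d_gt0; split.
- exact: ker0_x.
- exact: ker1_x.
- by move=> t; apply: is_cder_ccont => x; exact: ker2_x.
- exact: ker0_t.
- by split; [exact: b0|exact: b1|exact: b2].
Qed.

Lemma free_kernel1 : free_kernel K1 K2 K3.
Proof.
have [b0 b1 b2 b3 b4] := ker_bounded d_gt0; split.
- exact: ker1_x.
- exact: ker2_x.
- by move=> t; apply: is_cder_ccont => x; exact: ker3_x.
- exact: ker1_t.
- by split; [exact: b1|exact: b2|exact: b3].
Qed.

Lemma free_kernel2 : free_kernel K2 K3 K4.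
Proof.
have [b0 b1 b2 b3 b4] := ker_bounded d_gt0; split.
- exact: ker2_x.
- exact: ker3_x.
- exact: ker4_cont.
- exact: ker2_t.
- by split; [exact: b2|exact: b3|exact: b4].
Qed.

Lemma kap_cont : ccont k.
Proof. by apply: is_cder_ccont => t; exact: is_cder_kap. Qed.

Lemma ker0_cont t : ccont (K0 ^~ t).
Proof. by apply: is_cder_ccont => x; exact: ker0_x. Qed.

Lemma cont_sub (a : R) : continuous (fun s : R => a - s).
Proof. by move=> s; apply: cvgB; [exact: cvg_cst|exact: cvg_id]. Qed.

Lemma kap_sub_cont (a : R) : ccont (fun s => k (a - s)).
Proof. by apply: ccont_comp; [exact: cont_sub|exact: kap_cont]. Qed.

Lemma kap_sub_der (a s : R) :
  is_cder (fun s => k (a - s)) s (2^-1 * k (a - s) ^+ 3).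
Proof.
have ds : is_derive s 1 (fun z : R => a - z) (-1) by apply: is_derive_eq; ring.
apply: is_cder_eq (@is_cder_comp R k (fun z => a - z) s _ (-1) (is_cder_kap d_gt0 (a - s)) ds) _.
rewrite (_ : (-1)%:C = -1 :> R[i]); last by apply: complex_ext; rewrite /= ?oppr0.
by rewrite mulN1r opprK.
Qed.

(* Integration by parts against [k^3 = d/ds (2 k (a - s))]. *)
Lemma kap3_by_parts (a r : R) (g g' : R -> R[i]) : 0 < r -> ccont g' ->
  ccont g -> (forall s, 0 < s -> s <= r -> is_cder g s (g' s)) -> g 0 = 0 ->
  cint 0 r (fun s => k (a - s) ^+ 3 * g s) =
  2 * k (a - r) * g r - 2 * cint 0 r (fun s => k (a - s) * g' s).
Proof.
move=> r0 cg' cg dg g0; have ck := kap_sub_cont a.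
have := @cint_FTC2_cont _ (fun s => k (a - s) ^+ 3 * g s + 2 * (k (a - s) * g' s))
  (fun s => 2 * k (a - s) * g s) 0 r r0.
rewrite cintD; [|by apply: ccontM => //; exact: ccontX
  |by apply: ccontM; [exact: ccont_cst|exact: ccontM]].
rewrite cintZ; last by exact: ccontM.
rewrite g0 mulr0 subr0 => <-.
- by rewrite addrK.
- apply: ccontD; first by apply: ccontM => //; exact: ccontX.
  by apply: ccontM; [exact: ccont_cst|exact: ccontM].
- by apply: ccontM => //; apply: ccontM => //; exact: ccont_cst.
- move=> s s0 sr; apply: is_cder_eq.
    by apply: is_cderM; [apply: is_cderZ; exact: kap_sub_der|exact: dg].
  by rewrite /=; field.
Qed.

Lemma gau_decays0 : kbounded (gau d).
Proof.
move=> T; exists 1 => x t x0 _; rewrite cmod_gau// -expR0 ler_expR oppr_le0.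
by rewrite mulr_ge0 ?sqr_ge0// divr_ge0 ?ltW// mulr_gt0// exprn_gt0// rho_gt0.
Qed.

Lemma gau_cont t : ccont (gau d ^~ t).
Proof. by apply: is_cder_ccont => x; exact: is_cder_gau_x. Qed.

Section TraceIdentity.
Variables (v v1 v2 vt : R -> R -> R[i]).
Hypothesis hv : half_line_fun v v1 v2 vt.

(** At time 0 the odd kernel acts like a derivative concentrated at the origin. Integrating by parts
    separates the Dirichlet trace from a Gaussian mean of [v1], which becomes the Neumann trace as
    [d] tends to 0. *)
Lemma ker0_init T : 0 < T ->
  cintS `[0, +oo[ (fun x => K0 x 0 * v x T) =
  2 * @iC R * k 0 * (v 0 T + cintS `[0, +oo[ (fun x => gau d x 0 * v1 x T)).
Proof.
move=> T0; have T0' := ltW T0.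
case: hv => [[d1 d2 d3] [c0 c1 c2 ct cs] [e0 e1 e2 et] v0].
have bg := gau_decays0; have cg := gau_cont.
have [bK _ _ _ _] := ker_bounded d_gt0; have cK := ker0_cont.
have m0 : mu_ d 0 != 0.
  by rewrite /mu_ mulf_neq0 ?expf_neq0 ?iC_neq0 ?kap_neq0.
have cd1 : cdecay (fun x => gau d x 0 * v1 x T) by apply: cdecay_mul.
have cd0 : cdecay (fun x => gau d x 0 * v x T) by apply: cdecay_mul.
have cdK : cdecay (fun x => K0 x 0 * v x T) by apply: cdecay_mul.
(* [x g = (2 / m) g_x] turns [K0] into a multiple of [g_x]. *)
have := @cint_FTC2y _
  (fun x => (2 * k 0 ^+ 3 / mu_ d 0) * (gau d x 0 * v1 x T) + K0 x 0 * v x T)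
  (fun x => (2 * k 0 ^+ 3 / mu_ d 0) * (gau d x 0 * v x T)) _ _ _.
rewrite cintSD//; last 2 first.
- by apply: cdecay_integrable; exact: cdecayZ.
- exact: cdecay_integrable.
rewrite cintSZ//; last exact: cdecay_integrable.
have -> : gau d 0 0 = 1.
  rewrite /gau expr0n mul0r mul0r /cexp /= expR0 cos0 sin0 mulr1 mulr0.
  by apply: complex_ext.
rewrite mul1r => h.
have e : 2 * k 0 ^+ 3 / mu_ d 0 = - (2 * @iC R * k 0).
  have k0 := kap_neq0 d_gt0 0; have i2 := @iC_sqr R.
  have i0 := @iC_neq0 R.
  rewrite /mu_; apply: (mulfI (_ : @iC R * k 0 ^+ 2 != 0)); first by rewrite mulf_neq0 ?expf_neq0.
  transitivity (2 * k 0 ^+ 3); first by field; rewrite i0 k0.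
  transitivity (- (@iC R * @iC R) * 2 * k 0 ^+ 3); last by ring.
  by rewrite i2 opprK mul1r.
apply: (addrI (2 * k 0 ^+ 3 / mu_ d 0 * cintS `[0, +oo[ (fun x => gau d x 0 * v1 x T))).
rewrite h.
- by rewrite e; ring.
- by apply: cdecayD => //; exact: cdecayZ.
- exact: cdecayZ.
- move=> x x0; apply: is_cder_eq.
    by apply: is_cderZ; apply: is_cderM; [exact: is_cder_gau_x|exact: d1].
  by rewrite /= real_complex_half /ker0; field.
Qed.

(** The term [2 i k(0) v(0, T)], which diverges as [d] tends to 0, occurs on both sides: in
    [ker0_init], and as the end term when [k^3 v] is integrated by parts in time. It cancels. *)
Lemma trace_identity T (J : R -> R[i]) : 0 < T -> ccont J -> ccont (vt 0) ->
  (forall s, 0 < s -> s <= T ->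
    cintS `[0, +oo[ (fun x => K0 x (T - s) * (@iC R * vt x s + v2 x s)) = J s) ->
  2 * k 0 * cintS `[0, +oo[ (fun x => gau d x 0 * v1 x T) =
  - (2 * cint 0 T (fun s => k (T - s) * vt 0 s)) - cint 0 T J.
Proof.
move=> T0 cJ cvt JE.
have ck := kap_sub_cont T.
case: (hv) => [[d1 d2 d3] [c0 c1 c2 ct cs] [e0 e1 e2 et] v0].
have E := @green_identity _ K0 K1 K2 v v1 v2 vt free_kernel0 hv T 0
  (fun s => @iC R * (k (T - s) ^+ 3 * v 0 s) - @iC R * J s) T0 (lexx _).
have {E} : cintS `[0, +oo[ (fun x => K0 x 0 * v x T) =
  cint 0 T (fun s => @iC R * (k (T - s) ^+ 3 * v 0 s) - @iC R * J s).
  apply: E.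
    apply: ccontD; last by apply: ccontN; apply: ccontM => //; exact: ccont_cst.
    by apply: ccontM; [exact: ccont_cst|apply: ccontM => //; exact: ccontX].
  move=> s s0 sT; rewrite add0r JE//.
  by have [-> -> _ _] := ker_at0 d (T - s); rewrite mul0r subr0.
have cg3 : ccont (fun s => k (T - s) ^+ 3 * v 0 s) by apply: ccontM => //; exact: ccontX.
rewrite ker0_init// cintB; last 2 first.
- by apply: ccontM => //; exact: ccont_cst.
- by apply: ccontM => //; exact: ccont_cst.
rewrite !cintZ// (@kap3_by_parts T T (v 0) (vt 0))//; last 2 first.
- by move=> s s0 _; exact: d3.
- exact: v0.
rewrite subrr => E.
have i0 := @iC_neq0 R.
apply: (mulfI i0).
transitivity (2 * @iC R * k 0 * (v 0 T + cintS `[0, +oo[ (fun x => gau d x 0 * v1 x T))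
  - 2 * @iC R * k 0 * v 0 T); first by ring.
by rewrite E; ring.
Qed.

End TraceIdentity.
End Trace.

(** Regularity, decay and initial data without the equation, so that free and forced solutions share
    one record. *)
Record lin_sol {R : realType} (q qx qxx qt : R -> R -> R[i]) : Prop := LinSol {
  ls_dx : forall x s, is_cder (q ^~ s) x (qx x s);
  ls_dxx : forall x s, is_cder (qx ^~ s) x (qxx x s);
  ls_dt : forall x s, is_cder (q x) s (qt x s);
  ls_c : ccont (fun p : R * R => q p.1 p.2);
  ls_cx : ccont (fun p : R * R => qx p.1 p.2);
  ls_cxx : ccont (fun p : R * R => qxx p.1 p.2);
  ls_ct : ccont (fun p : R * R => qt p.1 p.2);
  ls_b : decays_with q;
  ls_bx : decays_with qx;
  ls_bxx : decays_with qxx;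
  ls_bt : decays_with qt;
  ls_init : forall x, 0 <= x -> q x 0 = 0 }.

(** * The trace identity for the corrected third-order term, with all space integrals evaluated *)

Section Regularized.
Context {R : realType}.

Lemma lin_sol_half_line (q qx qxx qt : R -> R -> R[i]) :
  lin_sol q qx qxx qt -> half_line_fun q qx qxx qt.
Proof.
move=> [d1 d2 d3 c1 c2 c3 c4 b1 b2 b3 b4 i0]; split.
- by split=> *; [exact: d1|exact: d2|exact: d3].
- split=> s.
  + exact: (ccont_along1 s c1).
  + exact: (ccont_along1 s c2).
  + exact: (ccont_along1 s c3).
  + exact: (ccont_along1 s c4).
  + exact: (ccont_along2 s c1).
- by split; [exact: b1|exact: b2|exact: b3|exact: b4].
- exact: i0.
Qed.

Lemma decays_withZ (l : R[i]) (v : R -> R -> R[i]) : decays_with v ->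
  decays_with (fun x s => l * v x s).
Proof. exact: decays_withM (bounded_with_cst l). Qed.

Lemma half_line_fun_addZ (l : R[i]) (v v1 v2 vt w w1 w2 wt : R -> R -> R[i]) :
  half_line_fun v v1 v2 vt -> half_line_fun w w1 w2 wt ->
  half_line_fun (fun x s => v x s + l * w x s) (fun x s => v1 x s + l * w1 x s)
    (fun x s => v2 x s + l * w2 x s) (fun x s => vt x s + l * wt x s).
Proof.
move=> [[d1 d2 d3] [c0 c1 c2 ct cs] [e0 e1 e2 et] v0].
move=> [[d1' d2' d3'] [c0' c1' c2' ct' cs'] [e0' e1' e2' et'] w0].
have cZ (h h' : R -> R[i]) : ccont h -> ccont h' -> ccont (fun x => h x + l * h' x).
  by move=> ch ch'; apply: ccontD => //; apply: ccontM => //; exact: ccont_cst.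
split.
- split=> x s x0 s0; apply: is_cderD.
  + exact: d1.
  + by apply: is_cderZ; exact: d1'.
  + exact: d2.
  + by apply: is_cderZ; exact: d2'.
  + exact: d3.
  + by apply: is_cderZ; exact: d3'.
- split=> s; apply: cZ; [exact: c0|exact: c0'|exact: c1|exact: c1'|exact: c2|exact: c2'
    |exact: ct|exact: ct'|exact: cs|exact: cs'].
- split; apply: decays_withD; [exact: e0|exact: decays_withZ|exact: e1|exact: decays_withZ
    |exact: e2|exact: decays_withZ|exact: et|exact: decays_withZ].
- by move=> x x0; rewrite v0// w0// mulr0 addr0.
Qed.

Variable d : R.
Hypothesis d_gt0 : 0 < d.
Local Notation k := (kap d).
Local Notation K0 := (ker0 d).
Local Notation K1 := (ker1 d).
Local Notation K2 := (ker2 d).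
Local Notation K3 := (ker3 d).
Local Notation K4 := (ker4 d).

(** Here the kernel time is frozen. It serves [corr] and [corr_y], where time is only an upper limit
    of integration: their time derivatives are combinations of [q], [qx] and [qxx], whose pairings
    with the kernel are known. *)
Lemma kernel_evolution (c ct : R -> R -> R[i]) (sg T : R) (dd : R -> R[i]) : 0 < T ->
  decays_with c -> decays_with ct -> (forall s, ccont (c ^~ s)) ->
  (forall y, ccont (c y)) -> (forall y, 0 <= y -> c y 0 = 0) ->
  (forall y s, 0 < s -> is_cder (c y) s (ct y s)) -> ccont dd ->
  (forall s, 0 < s -> s <= T -> cintS `[0, +oo[ (fun y => K0 y sg * ct y s) = dd s) ->
  cintS `[0, +oo[ (fun y => K0 y sg * c y T) = cint 0 T dd.
Proof.
move=> T0 dc dct cc cc' c0 dtc cdd ctE.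
have T1 : 0 < T + 1 by rewrite addr_gt0.
have [b0 _ _ _ _] := ker_bounded d_gt0.
have [C hC] := kbounded_at sg b0.
have [D [D0 hD]] := decays_with_ge0 dc T1.
have [E [E0 hE]] := decays_with_ge0 dct T1.
have C0 : 0 <= C by apply: le_trans (cmod_ge0 _) (hC 0 (lexx _)).
have w0 (x : R) : 0 <= wght x by exact: wght_ge0.
refine (@time_evolution _ (fun s y => K0 y sg * c y s) (fun s y => K0 y sg * ct y s)
  T (C * D + C * E) dd T0 cdd _ _ _ _ _ _ ctE).
- by move=> s; apply: ccontM; [exact: ker0_cont|exact: cc].
- by move=> y _; apply: ccontM; [exact: ccont_cst|exact: cc'].
- by move=> s y s0 _ _; apply: is_cderZ; exact: dtc.
- move=> s y s0 s1 y0; rewrite cmodM mulrDl -!mulrA.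
  apply: (@le_trans _ _ (C * (D * wght y))); last by rewrite lerDl !mulr_ge0.
  apply: ler_pM; [exact: cmod_ge0|exact: cmod_ge0|exact: hC|].
  by apply: hD => //; exact: ltW.
- move=> s y s0 s1 y0; rewrite cmodM mulrDl -!mulrA.
  apply: (@le_trans _ _ (C * (E * wght y))); last by rewrite lerDr !mulr_ge0.
  apply: ler_pM; [exact: cmod_ge0|exact: cmod_ge0|exact: hC|].
  by apply: hE => //; exact: ltW.
- by move=> y y0; rewrite c0// mulr0.
Qed.

Section Free.
Variables (q qx qxx qt : R -> R -> R[i]).
Hypothesis hq : lin_sol q qx qxx qt.
Hypothesis pde : forall x s, 0 <= x -> 0 < s -> @iC R * qt x s + qxx x s = 0.

Let hl : half_line_fun q qx qxx qt := lin_sol_half_line hq.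

Definition kconv (a : R) (h : R -> R[i]) (r : R) : R[i] :=
  cint 0 r (fun p => k (a + r - p) ^+ 3 * h p).

Let cq0 : ccont (q 0) := ccont_along2 0 (ls_c hq).
Let cqx0 : ccont (qx 0) := ccont_along2 0 (ls_cx hq).
Let cqt0 : ccont (qt 0) := ccont_along2 0 (ls_ct hq).

Lemma green_free (L L1 L2 : R -> R -> R[i]) (sg r : R) (dd : R -> R[i]) :
  free_kernel L L1 L2 -> 0 <= sg -> 0 < r -> ccont dd ->
  (forall p, dd p = @iC R * (L1 0 (sg + r - p) * q 0 p - L 0 (sg + r - p) * qx 0 p)) ->
  cintS `[0, +oo[ (fun x => L x sg * q x r) = cint 0 r dd.
Proof.
move=> hL sg0 r0 cdd ddE; apply: (green_identity hL hl) => // p p0 pr.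
rewrite ddE (@eq_cintS _ _ (fun x => L x _ * _) (fun=> 0 * 0)); last first.
  by move=> x; rewrite /= in_itv/= andbT => x0; rewrite pde// mulr0 mul0r.
rewrite cintSZ ?mul0r ?mulr0 ?subr0//; apply: cdecay_integrable; split.
  exact: ccont_cst.
by exists 0 => x _; rewrite cmod0 mul0r.
Qed.

Lemma kconv_cont (a : R) (h : R -> R[i]) : ccont h -> ccont (kconv a h).
Proof.
move=> ch.
have h1 : ccont (fun p : R * R => cint 0 p.2 (fun u => k (a + p.1 - u) ^+ 3 * h u)).
  apply: (@cint_upper_cont R R (fun r u => k (a + r - u) ^+ 3 * h u)).
  apply: ccontM; last by apply: ccont_comp => //; ctsR.
  apply: ccontX; apply: ccont_comp (kap_cont d_gt0).
  by move=> p; apply: cvgB; [apply: cvgD; [exact: cvg_cst|exact: cvg_fst]|exact: cvg_snd].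
exact: (@ccont_comp _ _ _ _ (fun r : R => (r, r)) ltac:(ctsR) h1).
Qed.

Lemma ker0_q sg r : 0 <= sg -> 0 < r ->
  cintS `[0, +oo[ (fun x => K0 x sg * q x r) = @iC R * kconv sg (q 0) r.
Proof.
move=> sg0 r0; have ck := kap_sub_cont d_gt0 (sg + r).
have c1 : ccont (fun p => k (sg + r - p) ^+ 3 * q 0 p) by apply: ccontM => //; exact: ccontX.
rewrite -cintZ//; apply: (green_free (free_kernel0 d_gt0)) => //.
  by apply: ccontM => //; exact: ccont_cst.
by move=> p; have [-> -> _ _] := ker_at0 d (sg + r - p); rewrite mul0r subr0.
Qed.

Lemma ker1_q sg r : 0 <= sg -> 0 < r ->
  cintS `[0, +oo[ (fun x => K1 x sg * q x r) = - (@iC R * kconv sg (qx 0) r).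
Proof.
move=> sg0 r0; have ck := kap_sub_cont d_gt0 (sg + r).
have c1 : ccont (fun p => k (sg + r - p) ^+ 3 * qx 0 p) by apply: ccontM => //; exact: ccontX.
rewrite -mulNr -cintZ//; apply: (green_free (free_kernel1 d_gt0)) => //.
  by apply: ccontM => //; exact: ccont_cst.
by move=> p; have [_ -> -> _] := ker_at0 d (sg + r - p); rewrite mul0r sub0r mulNr mulrN.
Qed.

Let hdec : [/\ forall (sg r : R), 0 < r -> cdecay (fun x => K0 x sg * q x r),
  forall (sg r : R), 0 < r -> cdecay (fun x => K0 x sg * qx x r),
  forall (sg r : R), 0 < r -> cdecay (fun x => K0 x sg * qxx x r),
  forall (sg r : R), 0 < r -> cdecay (fun x => K1 x sg * q x r)
  & forall (sg r : R), 0 < r -> cdecay (fun x => K2 x sg * q x r)].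
Proof.
have [b0 b1 b2 _ _] := ker_bounded d_gt0.
have c0 := ker0_cont d.
have c1 t : ccont (K1 ^~ t) by apply: is_cder_ccont => x; exact: ker1_x.
have c2 t : ccont (K2 ^~ t) by apply: is_cder_ccont => x; exact: ker2_x.
have [_ [e0 e1 e2 et es] [f0 f1 f2 ft] _] := hl.
split=> sg r r0; apply: cdecay_mul (ltW r0);
  first [exact: b0|exact: b1|exact: b2|exact: c0|exact: c1|exact: c2
    |exact: e0|exact: e1|exact: e2|exact: f0|exact: f1|exact: f2].
Qed.

(** [K0] vanishes at the origin, so moving the derivative onto the kernel costs no boundary term and
    leaves [ker1_q]. *)
Lemma ker0_qx sg r : 0 <= sg -> 0 < r ->
  cintS `[0, +oo[ (fun x => K0 x sg * qx x r) = @iC R * kconv sg (qx 0) r.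
Proof.
move=> sg0 r0; have [h0 h1 _ h3 _] := hdec.
have e : cintS `[0, +oo[ (fun x => K1 x sg * q x r + K0 x sg * qx x r) = - (K0 0 sg * q 0 r).
  apply: (@cint_FTC2y _ _ (fun x => K0 x sg * q x r)).
  - by apply: cdecayD; [exact: h3|exact: h1].
  - exact: h0.
  - by move=> x x0; apply: is_cderM; [exact: ker0_x|exact: (ls_dx hq)].
have [k0 _ _ _] := ker_at0 d sg.
move: e; rewrite k0 mul0r oppr0 cintSD//; last 2 first.
- by apply: cdecay_integrable; exact: h3.
- by apply: cdecay_integrable; exact: h1.
by rewrite ker1_q// => /eqP; rewrite addrC subr_eq0 => /eqP.
Qed.

(** Moving both derivatives onto the kernel leaves a boundary term and a convolution with [k^5]. As
    [k^5] is a multiple of the time derivative of [k^3], an integration by parts in time absorbs the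
    boundary term and keeps the singularity at the power 3/2. *)
Lemma ker0_qxx sg r : 0 <= sg -> 0 < r ->
  cintS `[0, +oo[ (fun x => K0 x sg * qxx x r) = kconv sg (qt 0) r.
Proof.
move=> sg0 r0; have [_ _ h2 _ h4] := hdec.
have ck := kap_sub_cont d_gt0 (sg + r).
have c3 : ccont (fun p => k (sg + r - p) ^+ 3 * qt 0 p) by apply: ccontM => //; exact: ccontX.
have c5 : ccont (fun p => - (3 / 2) * (k (sg + r - p) ^+ 5 * q 0 p)).
  by apply: ccontM; [exact: ccont_cst|apply: ccontM => //; exact: ccontX].
have eK2 : cintS `[0, +oo[ (fun x => K2 x sg * q x r) =
    cint 0 r (fun p => - (3 / 2) * (k (sg + r - p) ^+ 5 * q 0 p)).
  apply: (green_free (free_kernel2 d_gt0)) => // p.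
  have [_ _ -> ->] := ker_at0 d (sg + r - p); rewrite mul0r subr0 /mu_.
  have i2 := @iC_sqr R; move: (k _) (q 0 p) => a b.
  transitivity ((@iC R * @iC R) * (3 / 2) * (a ^+ 5 * b)); first by rewrite i2 mulN1r.
  by ring.
have eF : cint 0 r (fun p => k (sg + r - p) ^+ 3 * qt 0 p
    - (- (3 / 2) * (k (sg + r - p) ^+ 5 * q 0 p))) = k sg ^+ 3 * q 0 r.
  rewrite (@cint_FTC2_cont _ _ (fun p => k (sg + r - p) ^+ 3 * q 0 p) 0 r)//.
  - by rewrite (ls_init hq)// mulr0 subr0 addrK.
  - by apply: ccontD => //; exact: ccontN.
  - by apply: ccontM => //; exact: ccontX.
  - move=> p p0 pr; apply: is_cder_eq.
      apply: is_cderM; last exact: (ls_dt hq).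
      by apply: is_cderX; exact: kap_sub_der.
    by rewrite /=; move: (k _) (q 0 p) (qt 0 p) => a b c; field.
have := green_space (free_kernel0 d_gt0) hl sg r0.
have [-> -> _ _] := ker_at0 d sg.
rewrite mul0r subr0 cintSB//; last 2 first.
- by apply: cdecay_integrable; exact: h2.
- by apply: cdecay_integrable; exact: h4.
rewrite eK2 -eF cintB// => /eqP; rewrite subr_eq => /eqP ->.
by rewrite subrK.
Qed.

(* The [y]-integrals of [K0 y a * corr 0 y s] and [K0 y a * corr_y 0 y s], as evaluated
   by Green's identity. *)
Definition kB (a s : R) : R[i] := cint 0 s (fun r => @iC R *
  (conjc (qx 0 r) * (@iC R * kconv a (q 0) r) - conjc (q 0 r) * (@iC R * kconv a (qx 0) r))).
Definition kB' (a s : R) : R[i] := cint 0 s (fun r => @iC R *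
  (conjc (qx 0 r) * (@iC R * kconv a (qx 0) r) - conjc (q 0 r) * kconv a (qt 0) r)).

Let cc3 := corr_cont3 (ls_c hq) (ls_cx hq).
Let ccy3 := corr_y_cont3 (ls_c hq) (ls_cx hq) (ls_cxx hq).

Let cint0 (f : R -> R[i]) : cint 0 0 f = 0. Proof. exact: cint_ge. Qed.

Lemma ker0_corr sg s : 0 <= sg -> 0 < s ->
  cintS `[0, +oo[ (fun y => K0 y sg * corr q qx 0 y s) = kB sg s.
Proof.
move=> sg0 s0; have [h0 h1 h2 _ _] := hdec.
have cq' := kconv_cont sg cq0; have cqx' := kconv_cont sg cqx0.
refine (@kernel_evolution (corr q qx 0)
  (fun y s => @iC R * (conjc (qx 0 s) * q y s - conjc (q 0 s) * qx y s)) sg s _ s0 _ _ _ _ _ _ _ _).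
- exact: decays2_at0 (corr_decays (ls_c hq) (ls_cx hq) (ls_b hq) (ls_bx hq)).
- exact: decays_withZ (decays2_at0 (decays2B (decays2M (ls_bx hq) (ls_b hq))
    (decays2M (ls_b hq) (ls_bx hq)))).
- by move=> r; refine (ccont3 (f1 := fun=> 0) (f2 := fun y => y) (f3 := fun=> r) cc3 _ _ _); ctsR.
- by move=> y; refine (ccont3 (f1 := fun=> 0) (f2 := fun=> y) (f3 := fun r => r) cc3 _ _ _); ctsR.
- by move=> y _; rewrite /corr cint0 mulr0.
- by move=> y r r0; apply: (corr_dt (ls_c hq) (ls_cx hq)).
- by ccts fail.
- move=> r r0 rs; rewrite -(ker0_q sg0 r0) -(ker0_qx sg0 r0).
  have i0 := cdecay_integrable (h0 sg r r0); have i1 := cdecay_integrable (h1 sg r r0).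
  rewrite -!cintSZ// -cintSB//; try exact: cintegrableZ.
  rewrite -cintSZ//; last first.
    by apply: cdecay_integrable; apply: cdecayB; apply: cdecayZ; [exact: h0|exact: h1].
  by apply: eq_cintS => y _; ring.
Qed.

Lemma ker0_corr_y sg s : 0 <= sg -> 0 < s ->
  cintS `[0, +oo[ (fun y => K0 y sg * corr_y q qx qxx 0 y s) = kB' sg s.
Proof.
move=> sg0 s0; have [h0 h1 h2 _ _] := hdec.
have cqt' := kconv_cont sg cqt0; have cqx' := kconv_cont sg cqx0.
refine (@kernel_evolution (corr_y q qx qxx 0)
  (fun y s => @iC R * (conjc (qx 0 s) * qx y s - conjc (q 0 s) * qxx y s)) sg s _ s0 _ _ _ _ _ _ _ _).
- exact: decays2_at0 (corr_y_decays (ls_c hq) (ls_cx hq) (ls_cxx hq) (ls_b hq) (ls_bx hq) (ls_bxx hq)).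
- exact: decays_withZ (decays2_at0 (decays2B (decays2M (ls_bx hq) (ls_bx hq))
    (decays2M (ls_b hq) (ls_bxx hq)))).
- by move=> r; refine (ccont3 (f1 := fun=> 0) (f2 := fun y => y) (f3 := fun=> r) ccy3 _ _ _); ctsR.
- by move=> y; refine (ccont3 (f1 := fun=> 0) (f2 := fun=> y) (f3 := fun r => r) ccy3 _ _ _); ctsR.
- by move=> y _; rewrite /corr_y cint0 mulr0.
- move=> y r r0; apply: is_cderZ.
  apply: (@cint_FTC1 _ (fun r => conjc (qx 0 r) * qx y r - conjc (q 0 r) * qxx y r)) => //.
  have c1 := ccont_along2 y (ls_cx hq); have c2 := ccont_along2 y (ls_cxx hq).
  by ccts fail.
- by ccts fail.
- move=> r r0 rs; rewrite -(ker0_qxx sg0 r0) -(ker0_qx sg0 r0).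
  have i1 := cdecay_integrable (h1 sg r r0); have i2 := cdecay_integrable (h2 sg r r0).
  rewrite -!cintSZ// -cintSB//; try exact: cintegrableZ.
  rewrite -cintSZ//; last first.
    by apply: cdecay_integrable; apply: cdecayB; apply: cdecayZ; [exact: h1|exact: h2].
  by apply: eq_cintS => y _; ring.
Qed.

(** The pairing of [K0] at time [T - s] with the boundary forcing left by [nf_pde]; its three
    summands match those of that forcing. *)
Definition source (T s : R) : R[i] := abs2 q 0 s * (@iC R * kconv (T - s) (q 0) s)
  + qx 0 s * kB (T - s) s + q 0 s * kB' (T - s) s.

Lemma kconv_cont2 T (h : R -> R[i]) : ccont h ->
  ccont (fun p : R * R => kconv (T - p.1) h p.2).
Proof.
move=> ch.
have h1 : ccont (fun z : (R * R) * R =>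
    cint 0 z.2 (fun u => k (T - z.1.1 + z.1.2 - u) ^+ 3 * h u)).
  apply: (@cint_upper_cont R (R * R)%type (fun p u => k (T - p.1 + p.2 - u) ^+ 3 * h u)).
  apply: ccontM; last by apply: ccont_comp => //; ctsR.
  apply: ccontX; apply: ccont_comp (kap_cont d_gt0).
  have p1 : continuous (fun p : (R * R) * R => p.1.1) by ctsR.
  have p2 : continuous (fun p : (R * R) * R => p.1.2) by ctsR.
  have p3 : continuous (fun p : (R * R) * R => p.2) by ctsR.
  move=> p; apply: cvgB; last exact: p3.
  by apply: cvgD; [apply: cvgB; [exact: cvg_cst|exact: p1]|exact: p2].
exact: (@ccont_comp _ _ _ _ (fun p : R * R => (p, p.2)) ltac:(ctsR) h1).
Qed.

Lemma source_cont T : ccont (source T).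
Proof.
have diag (F : R -> R -> R[i]) : ccont (fun p : R * R => F p.1 p.2) ->
    ccont (fun s => cint 0 s (F s)).
  move=> cF.
  exact: (@ccont_comp _ _ _ _ (fun r : R => (r, r)) ltac:(ctsR) (cint_upper_cont cF)).
have D (h : R -> R[i]) : ccont h -> ccont (fun s => kconv (T - s) h s).
  move=> ch; exact: (@ccont_comp _ _ _ _ (fun r : R => (r, r)) ltac:(ctsR) (kconv_cont2 T ch)).
have c2 (h : R -> R[i]) : ccont h -> ccont (fun p : R * R => h p.2).
  by move=> ch; apply: ccont_comp => //; ctsR.
have e1 := kconv_cont2 T cq0; have e2 := kconv_cont2 T cqx0; have e3 := kconv_cont2 T cqt0.
have e4 := c2 _ cq0; have e5 := c2 _ cqx0.
have B : ccont (fun s => kB (T - s) s).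
  apply: (diag (fun s r => @iC R * (conjc (qx 0 r) * (@iC R * kconv (T - s) (q 0) r)
    - conjc (q 0 r) * (@iC R * kconv (T - s) (qx 0) r)))).
  by ccts fail.
have B' : ccont (fun s => kB' (T - s) s).
  apply: (diag (fun s r => @iC R * (conjc (qx 0 r) * (@iC R * kconv (T - s) (qx 0) r)
    - conjc (q 0 r) * kconv (T - s) (qt 0) r))).
  by ccts fail.
have D0 := D _ cq0.
by rewrite /source /abs2; ccts fail.
Qed.

(** The trace identity for [p + l nf]: the cubic forcing of [p] cancels against that of [l nf], and
    the time derivative on the boundary is that of [p] because [nf_t] vanishes there. *)
Lemma regularized_identity (l : R[i]) (p px pxx pt : R -> R -> R[i]) (T : R) : 0 < T ->
  lin_sol p px pxx pt ->
  (forall x s, 0 <= x -> 0 < s -> @iC R * pt x s + pxx x s = 2 * l * abs2 q x s * q x s) ->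
  2 * k 0 * cintS `[0, +oo[ (fun x => gau d x 0 * (px x T + l * nf_y q qx x T)) =
  - (2 * cint 0 T (fun s => k (T - s) * pt 0 s)) - l * cint 0 T (source T).
Proof.
move=> T0 hp ppde.
have hn := nf_half_line (ls_dx hq) (ls_dxx hq) (ls_dt hq) (ls_c hq) (ls_cx hq) (ls_cxx hq)
  (ls_ct hq) (ls_b hq) (ls_bx hq) (ls_bxx hq) (ls_bt hq) pde (ls_init hq).
have hQ := half_line_fun_addZ l (lin_sol_half_line hp) hn.
have cpt0 := ccont_along2 0 (ls_ct hp).
have nt0 s : nf_t q qx qt 0 s = 0 by exact: cint_ge.
have cS := source_cont T.
have E := @trace_identity _ d d_gt0 _ _ _ _ hQ T (fun s => l * source T s) T0.
rewrite -(cintZ 0 T cS) E.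
- congr (- (2 * _) - _); apply: eq_cint => s _ _.
  by rewrite nt0 mulr0 addr0.
- by apply: ccontM => //; exact: ccont_cst.
- by under eq_fun do rewrite nt0 mulr0 addr0.
- move=> s s0 sT.
  have s0' : 0 <= T - s by rewrite subr_ge0.
  rewrite (@eq_cintS _ _ _ (fun x => l * (abs2 q 0 s * (K0 x (T - s) * q x s)
    + qx 0 s * (K0 x (T - s) * corr q qx 0 x s)
    + q 0 s * (K0 x (T - s) * corr_y q qx qxx 0 x s)))); last first.
    move=> x; rewrite /= in_itv/= andbT => x0.
    have e1 := ppde x s x0 s0.
    have e2 := nf_pde (ls_dx hq) (ls_c hq) (ls_cx hq) (ls_cxx hq) (ls_ct hq) pde x0 s0.
    have alg (i a b c e K al be ga : R[i]) : i * a + c = 2 * l * be * ga ->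
        i * b + e = - (2 * be * ga) + al ->
        K * (i * (a + l * b) + (c + l * e)) = l * (K * al).
      move=> h1 h2; transitivity (K * ((i * a + c) + l * (i * b + e))); first by ring.
      by rewrite h1 h2; ring.
    rewrite (alg _ _ _ _ _ _ _ _ _ e1 e2); congr (l * _).
    by move: (K0 _ _) (abs2 _ _ _) (q x s) (qx 0 s) (corr _ _ _ _ _) (q 0 s)
      (corr_y _ _ _ _ _ _) => *; ring.
  have [h0 _ _ _ _] := hdec.
  have [b0 _ _ _ _] := ker_bounded d_gt0.
  have hm (c : R -> R -> R[i]) : decays_with c -> ccont (c ^~ s) ->
      cdecay (fun x => K0 x (T - s) * c x s).
    move=> dc cc; apply: cdecayM; last exact: kbounded_at.
      by apply: decays_cdecay => //; exact: ltW.
    exact: ker0_cont.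
  have j0 := h0 (T - s) s s0.
  have j1 : cdecay (fun x => K0 x (T - s) * corr q qx 0 x s).
    apply: hm.
      exact: decays2_at0 (corr_decays (ls_c hq) (ls_cx hq) (ls_b hq) (ls_bx hq)).
    by refine (ccont3 (f1 := fun=> 0) (f2 := fun y => y) (f3 := fun=> s) cc3 _ _ _); ctsR.
  have j2 : cdecay (fun x => K0 x (T - s) * corr_y q qx qxx 0 x s).
    apply: hm.
      exact: decays2_at0 (corr_y_decays (ls_c hq) (ls_cx hq) (ls_cxx hq) (ls_b hq)
        (ls_bx hq) (ls_bxx hq)).
    by refine (ccont3 (f1 := fun=> 0) (f2 := fun y => y) (f3 := fun=> s) ccy3 _ _ _); ctsR.
  have m0 : measurable (`[0, +oo[%classic : set R) by [].
  rewrite cintSZ//; last first.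
    by apply: cdecay_integrable; apply: cdecayD; [apply: cdecayD|]; exact: cdecayZ.
  rewrite cintSD//; last 2 first.
  - by apply: cdecay_integrable; apply: cdecayD; exact: cdecayZ.
  - by apply: cdecay_integrable; exact: cdecayZ.
  rewrite cintSD//; last 2 first.
  - by apply: cdecay_integrable; exact: cdecayZ.
  - by apply: cdecay_integrable; exact: cdecayZ.
  rewrite !cintSZ//; try exact: cdecay_integrable.
  by rewrite ker0_q// ker0_corr// ker0_corr_y.
Qed.

End Free.
End Regularized.

(** * Removing the regularization *)

Section Limits.
Context {R : realType}.
Notation mu := (@lebesgue_measure R).

Definition dn (n : nat) : R := n.+1%:R^-1.

Lemma dn_gt0 n : 0 < dn n.
Proof. by rewrite invr_gt0. Qed.

Lemma dn_cvg : dn n @[n --> \oo] --> (0 : R).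
Proof. exact: cvg_harmonic. Qed.

Lemma sqrt_cvg (u : nat -> R) (l : R) : u n @[n --> \oo] --> l ->
  Num.sqrt (u n) @[n --> \oo] --> Num.sqrt l.
Proof. by move=> ul; apply: continuous_cvg => //; exact: sqrt_continuous. Qed.

Lemma rho_cvg (t : R) : 0 < t -> rho (dn n) t @[n --> \oo] --> t.
Proof.
move=> t0; rewrite -[X in _ --> X](gtr0_norm t0) -sqrtr_sqr.
apply: sqrt_cvg; rewrite -[X in _ --> X]addr0; apply: cvgD; first exact: cvg_cst.
rewrite -[X in _ --> X](mulr0 (0 : R)).
by apply: cvgM; exact: dn_cvg.
Qed.

Lemma kap_cvg (t : R) : 0 < t -> ccvg (fun n => kap (dn n) t) ((Num.sqrt t)^-1)%:C.
Proof.
move=> t0; have cr := rho_cvg t0.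
have cV : (rho (dn n) t)^-1 @[n --> \oo] --> t^-1 by apply: cvgV => //; rewrite gt_eqF.
have s0 : Num.sqrt t != 0 by rewrite gt_eqF// sqrtr_gt0.
split => /=.
- rewrite (_ : (Num.sqrt t)^-1 = Num.sqrt ((t + t) / 2) / t); last first.
    rewrite (_ : (t + t) / 2 = t); last by field.
    by rewrite -{3}(sqr_sqrtr (ltW t0)); field.
  apply: cvgM => //; apply: sqrt_cvg; apply: cvgM; last exact: cvg_cst.
  by apply: cvgD => //; exact: cvg_cst.
- rewrite (_ : 0 = Num.sqrt ((t - t) / 2) / t); last by rewrite subrr mul0r sqrtr0 mul0r.
  apply: cvgM => //; apply: sqrt_cvg; apply: cvgM; last exact: cvg_cst.
  by apply: cvgB => //; exact: cvg_cst.
Qed.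

(** Since [t <= rho t], the singular kernel dominates all its regularizations; every passage to the
    limit rests on this. *)
Lemma cmod_kap_le (d t : R) : 0 < d -> 0 < t -> cmod (kap d t) <= (Num.sqrt t)^-1.
Proof.
move=> d0 t0; rewrite -(ler_pXn2r (_ : (0 < 2)%N)) ?nnegrE ?cmod_ge0 ?invr_ge0 ?sqrtr_ge0//.
rewrite cmod_kap_sqr// exprVn (sqr_sqrtr (ltW t0)) lef_pV2 ?posrE ?rho_gt0//.
exact: le_trans (ler_norm _) (ltW (rho_gt_norm d0 t)).
Qed.

Lemma is_derive_sqrtV (c a x : R) : 0 < a - x ->
  is_derive x 1 (fun s : R => c * (Num.sqrt (a - s))^-1) (c / 2 * ((Num.sqrt (a - x)) ^+ 3)^-1).
Proof.
move=> ax.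
have s0 : Num.sqrt (a - x) != 0 by rewrite gt_eqF// sqrtr_gt0.
have d1 : is_derive x 1 (fun z : R => a - z) (-1) by apply: is_derive_eq; ring.
have d2 := @is_derive1_comp _ Num.sqrt (fun z => a - z) x _ _ (is_derive1_sqrt ax) d1.
have d3 := @is_deriveV R (fun z => Num.sqrt (a - z)) x _ 1 s0 d2.
have d4 := is_deriveZ c d3.
apply: (is_derive_eq d4).
rewrite /GRing.scale /=; move: s0; move: (Num.sqrt _) => s s0.
by field.
Qed.

Lemma is_derive_sqrt_sub (a x : R) : 0 < a - x ->
  is_derive x 1 (fun s : R => - (2 * Num.sqrt (a - s))) (Num.sqrt (a - x))^-1.
Proof.
move=> ax.
have s0 : Num.sqrt (a - x) != 0 by rewrite gt_eqF// sqrtr_gt0.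
have d1 : is_derive x 1 (fun z : R => a - z) (-1) by apply: is_derive_eq; ring.
have d2 := @is_derive1_comp _ Num.sqrt (fun z => a - z) x _ _ (is_derive1_sqrt ax) d1.
have d4 := is_deriveN (is_deriveZ 2 d2).
apply: (is_derive_eq d4).
rewrite /GRing.scale /=; move: s0; move: (Num.sqrt _) => s s0.
by field.
Qed.

Lemma continuous_sqrt_sub_max (a e : R) : continuous (fun s : R => Num.sqrt (Num.max e (a - s))).
Proof.
move=> s; apply: (@continuous_comp _ _ _ (fun s : R => Num.max e (a - s)) Num.sqrt);
  last exact: sqrt_continuous.
by apply: continuous_max; [exact: cvg_cst|apply: cvgB; [exact: cvg_cst|exact: cvg_id]].
Qed.

(** At distance [a] from the singularity, the power -3/2 integrates to order [a^(-1/2)], uniformly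
    in [r]. The maximum with [a] changes nothing on [[0, r]] and makes the integrand continuous on
    the whole line. *)
Lemma Rint_sqrtV3 (a r : R) : 0 < a -> 0 <= r ->
  Rintegral mu `[0, r] (fun p => ((Num.sqrt (Num.max a (a + r - p))) ^+ 3)^-1) <=
  2 / Num.sqrt a.
Proof.
move=> a0; rewrite le_eqVlt => /predU1P[<-|r0].
  by rewrite set_itv1 Rintegral_set1 divr_ge0// sqrtr_ge0.
have mx p : p <= r -> Num.max a (a + r - p) = a + r - p.
  by move=> pr; apply/max_idPr; lra.
have s0 p : 0 < Num.sqrt (Num.max a (a + r - p)).
  by rewrite sqrtr_gt0 lt_max a0.
have -> : Rintegral mu `[0, r] (fun p => ((Num.sqrt (Num.max a (a + r - p))) ^+ 3)^-1) =
    2 * (Num.sqrt (a + r - r))^-1 - 2 * (Num.sqrt (a + r - 0))^-1.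
  apply: (@Rint_FTC2 _ _ (fun p => 2 * (Num.sqrt (a + r - p))^-1) 0 r r0).
  - move=> p; apply: cvgV; first by rewrite expf_neq0// gt_eqF.
    have c := @continuous_sqrt_sub_max (a + r) a p.
    apply: (@continuous_comp _ _ _ (fun p => Num.sqrt (Num.max a (a + r - p)))
      (fun y : R => y ^+ 3)) => //.
    exact: exprn_continuous.
  - move=> p p0 pr; have ap : 0 < a + r - p by lra.
    apply: is_derive_eq (is_derive_sqrtV 2 ap) _.
    by rewrite mx// divff// mul1r.
  - have a0' : 0 < a + r - 0 by lra.
    have [/derivable1_diffP/differentiable_continuous c _] := is_derive_sqrtV 2 a0'.
    exact: cvg_at_right_filter c.
by rewrite addrK lerBlDr lerDl mulr_ge0// invr_ge0 sqrtr_ge0.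
Qed.

(** Monotone convergence: the integrands shifted by [dn n] increase to the singular one, and
    explicit primitives bound their integrals by [2 sqrt (T + 1)]. The endpoint is left out because
    the approximations diverge there, whereas the inverse of 0 is 0. *)
Lemma sqrtV_integrable (T : R) : 0 < T ->
  mu.-integrable `[0, T[ (EFin \o (fun s => (Num.sqrt (T - s))^-1)).
Proof.
move=> T0.
pose f (n : nat) (s : R) := (Num.sqrt (Num.max (dn n) (T + dn n - s)))^-1.
have mx n s : s <= T -> Num.max (dn n) (T + dn n - s) = T + dn n - s.
  by move=> sT; apply/max_idPr; lra.
have sp n s : 0 < Num.sqrt (Num.max (dn n) (T + dn n - s)).
  by rewrite sqrtr_gt0 lt_max dn_gt0.
have cf n : continuous (f n).
  move=> s; apply: cvgV; first by rewrite gt_eqF.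
  exact: continuous_sqrt_sub_max.
have mem s : `[0, T[%classic s -> 0 <= s /\ s < T.
  by rewrite /= in_itv/= => /andP[].
have mf n : measurable_fun `[0, T[ (f n).
  by apply: measurable_funTS; exact: continuous_measurable_fun.
have f_cvg s : `[0, T[%classic s -> f n s @[n --> \oo] --> (Num.sqrt (T - s))^-1.
  move=> /mem[s0 sT]; apply: cvgV; first by rewrite gt_eqF// sqrtr_gt0 subr_gt0.
  apply: sqrt_cvg.
  rewrite (_ : (fun n => _) = (fun n => T + dn n - s)); last first.
    by apply/funext => n; rewrite mx// ltW.
  rewrite (_ : T - s = T + 0 - s); last by rewrite addr0.
  apply: cvgB; last exact: cvg_cst.
  by apply: cvgD; [exact: cvg_cst|exact: dn_cvg].
have f_int n : (\int[mu]_(s in `[0%R, T[) (f n s)%:E <= (2 * Num.sqrt (T + 1))%:E)%E.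
  have E : Rintegral mu `[0, T] (f n) = - (2 * Num.sqrt (T + dn n - T)) - - (2 * Num.sqrt (T + dn n - 0)).
    apply: (@Rint_FTC2 _ (f n) (fun s => - (2 * Num.sqrt (T + dn n - s))) 0 T T0 (cf n)).
    - move=> s s0 sT; have h : 0 < T + dn n - s by have := dn_gt0 n; lra.
      by apply: is_derive_eq (is_derive_sqrt_sub h) _; rewrite /f mx.
    - have h : 0 < T + dn n - 0 by have := dn_gt0 n; lra.
      have [/derivable1_diffP/differentiable_continuous c _] := is_derive_sqrt_sub h.
      exact: cvg_at_right_filter c.
  have i1 : mu.-integrable `[0, T] (EFin \o f n) by exact: continuous_integrable.
  rewrite integral_itv_bndo_bndc; last by apply/measurable_EFinP.
  rewrite -[leLHS]fineK; last exact: integrable_fin_num.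
  rewrite lee_fin -/(Rintegral mu `[0, T] (f n)) E opprK subr0.
  apply: (@le_trans _ _ (2 * Num.sqrt (T + dn n))).
    by rewrite gerDr oppr_le0 mulr_ge0// sqrtr_ge0.
  rewrite ler_pM2l// ler_sqrt; last by rewrite addr_ge0// ltW.
  by rewrite lerD2l invf_le1// ler1n.
have mlim : measurable_fun `[0, T[ (fun s => (Num.sqrt (T - s))^-1).
  exact: (measurable_realfun.measurable_fun_cvg mf f_cvg).
apply/integrableP; split; first exact/measurable_EFinP.
have mono s : `[0, T[%classic s ->
    {homo (fun n => (f n s)%:E) : n m / (n <= m)%N >-> (n <= m)%E}.
  move=> /mem[s0 sT] n m nm; rewrite lee_fin /f !mx ?(ltW sT)//.
  rewrite lef_pV2 ?posrE ?sqrtr_gt0; last 2 first.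
  - by have := dn_gt0 m; have := dn_gt0 n; lra.
  - by have := dn_gt0 m; have := dn_gt0 n; lra.
  rewrite ler_sqrt; last by have := dn_gt0 m; have := dn_gt0 n; lra.
  by rewrite lerB// lerD2l lef_pV2 ?posrE// ler_nat.
have f0 n s : `[0, T[%classic s -> (0 <= (f n s)%:E)%E.
  by move=> _; rewrite lee_fin invr_ge0 sqrtr_ge0.
have mfE n : measurable_fun `[0, T[ (fun s => (f n s)%:E) by exact/measurable_EFinP.
have cv := @cvg_monotone_convergence _ _ _ mu `[0, T[ (measurable_itv _) _ mfE f0 mono.
rewrite [ltLHS](_ : _ = (\int[mu]_(s in `[0%R, T[) limn (fun n => (f n s)%:E))%E); last first.
  apply: eq_integral => s; rewrite inE => Ts; rewrite (@cvg_lim _ _ _ _ _ _ ((Num.sqrt (T - s))^-1)%:E)//=.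
    by rewrite ger0_norm// invr_ge0 sqrtr_ge0.
  by apply/fine_cvgP; split; [exact: nearW|exact: f_cvg].
rewrite -(cvg_lim _ cv)//.
apply: (@le_lt_trans _ _ (2 * Num.sqrt (T + 1))%:E); last exact: ltry.
apply: lime_le; first by apply/cvg_ex; eexists; exact: cv.
by near=> n; exact: f_int.
Unshelve. all: end_near. Qed.

End Limits.

(** * Limits of the single, double and triple time integrals *)

Section SingularLimits.
Context {R : realType}.
Notation mu := (@lebesgue_measure R).
Local Notation kn n := (kap (@dn R n)).

Lemma ccont_bounded (h : R -> R[i]) (T : R) : 0 <= T -> ccont h ->
  exists M, 0 <= M /\ forall s, 0 <= s -> s <= T -> cmod (h s) <= M.
Proof.
move=> T0 [h1 h2].
have cf : {within `[0, T], continuous (fun s => `|complex.Re (h s)| + `|complex.Im (h s)|)}.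
  apply: continuous_subspaceT => s.
  by apply: cvgD; apply: cvg_norm; [exact: h1|exact: h2].
have [c _ hc] := EVT_max T0 cf.
exists (`|complex.Re (h c)| + `|complex.Im (h c)|); split; first by rewrite addr_ge0.
move=> s s0 sT; apply: (le_trans (cmod_le_ReIm _)).
by apply: hc; rewrite in_itv/= s0.
Qed.

Lemma cint_bndo (f : R -> R[i]) (T : R) : cintegrable `[0, T[ f ->
  cintS `[0, T[ f = cint 0 T f.
Proof.
by move=> [i1 i2]; congr Complex; apply: Rintegral_itv_bndo_bndc.
Qed.

Lemma ccont_integrable_bndo (f : R -> R[i]) (T : R) : ccont f -> cintegrable `[0, T[ f.
Proof.
move=> [f1 f2].
have sub : `[0, T[%classic `<=` (`[0, T]%classic : set R).
  by move=> x; rewrite /= !in_itv/= => /andP[-> /ltW].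
by split; apply: (@integrableS _ _ _ mu `[0, T]) => //; exact: continuous_integrable.
Qed.

(** Dominated convergence is applied on the interval without [T], where the pointwise limit may
    fail; removing one point does not change the integrals. *)
Lemma outer_dct (f_ : nat -> R -> R[i]) (f : R -> R[i]) (T C : R) : 0 < T ->
  (forall n, ccont (f_ n)) ->
  (forall s, 0 <= s -> s < T -> ccvg (fun n => f_ n s) (f s)) ->
  (forall n s, 0 <= s -> s < T -> cmod (f_ n s) <= C * (Num.sqrt (T - s))^-1) ->
  ccvg (fun n => cint 0 T (f_ n)) (cint 0 T f).
Proof.
move=> T0 cf ff bf.
have mem s : `[0, T[%classic s -> 0 <= s /\ s < T by rewrite /= in_itv/= => /andP[].
have iC : mu.-integrable `[0, T[ (EFin \o (fun s => C * (Num.sqrt (T - s))^-1)).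
  rewrite (_ : EFin \o _ = fun s => (C%:E * ((Num.sqrt (T - s))^-1)%:E)%E); last first.
    by apply/funext => s /=; rewrite EFinM.
  by apply: integrableZl => //; exact: sqrtV_integrable.
have [||||i c] := @cint_dct R `[0, T[ f_ f (fun s => C * (Num.sqrt (T - s))^-1) _ _ _ iC _.
- by [].
- by move=> n; exact: ccont_measurable.
- by move=> s /mem[s0 sT]; exact: ff.
- by move=> n s /mem[s0 sT]; exact: bf.
rewrite -cint_bndo//; apply: eq_ccvg c => n.
by rewrite cint_bndo//; exact: ccont_integrable_bndo.
Qed.

Lemma inner_dct (f_ : nat -> R -> R[i]) (f : R -> R[i]) (r C : R) :
  (forall n, ccont (f_ n)) ->
  (forall p, 0 <= p -> p <= r -> ccvg (fun n => f_ n p) (f p)) ->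
  (forall n p, 0 <= p -> p <= r -> cmod (f_ n p) <= C) ->
  ccvg (fun n => cint 0 r (f_ n)) (cint 0 r f).
Proof.
move=> cf ff bf.
have mem s : `[0, r]%classic s -> 0 <= s /\ s <= r by rewrite /= in_itv/= => /andP[].
have iC : mu.-integrable `[0, r] (EFin \o (fun=> C)).
  by apply: continuous_integrable => s; exact: cvg_cst.
have [||||i c] := @cint_dct R `[0, r] f_ f (fun=> C) _ _ _ iC _.
- by [].
- by move=> n; exact: ccont_measurable.
- by move=> s /mem[s0 sr]; exact: ff.
- by move=> n s /mem[s0 sr]; exact: bf.
exact: c.
Qed.

Let ck n a : ccont (fun s => kn n (a - s)) := kap_sub_cont (dn_gt0 n) a.

Lemma single_limit (h : R -> R[i]) (T : R) : 0 < T -> ccont h ->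
  ccvg (fun n => cint 0 T (fun s => kn n (T - s) * h s))
    (cint 0 T (fun s => h s * ker12 T s)).
Proof.
move=> T0 ch; have [M [M0 hM]] := ccont_bounded (ltW T0) ch.
apply: (@outer_dct _ _ T M T0).
- by move=> n; apply: ccontM.
- move=> s s0 sT; rewrite mulrC; apply: ccvgM; last exact: ccvg_cst.
  by apply: kap_cvg; rewrite subr_gt0.
- move=> n s s0 sT; rewrite cmodM mulrC; apply: ler_pM; rewrite ?cmod_ge0//.
    by apply: hM => //; exact: ltW.
  by apply: cmod_kap_le; rewrite ?dn_gt0// subr_gt0.
Qed.

Lemma sqrtV_le (a b : R) : 0 < a -> a <= b -> (Num.sqrt b)^-1 <= (Num.sqrt a)^-1.
Proof.
move=> a0 ab; have b0 : 0 < b by exact: lt_le_trans ab.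
by rewrite lef_pV2; [exact: ler_wsqrtr|rewrite posrE sqrtr_gt0..].
Qed.

Lemma double_limit (a h : R -> R[i]) (T : R) : 0 < T -> ccont a -> ccont h ->
  ccvg (fun n => cint 0 T (fun s => a s * cint 0 s (fun p => kn n (T - p) * h p)))
    (cint 0 T (fun s => a s * cint 0 s (fun p => h p * ker12 T p))).
Proof.
move=> T0 ca ch; have [M [M0 hM]] := ccont_bounded (ltW T0) ch.
have [N [N0 hN]] := ccont_bounded (ltW T0) ca.
apply: (@outer_dct _ _ T (N * (2 * (M * T))) T0).
- by move=> n; apply: ccontM => //; apply: ccont_cint; exact: ccontM.
- move=> s s0 sT; apply: ccvgM; first exact: ccvg_cst.
  apply: (@inner_dct _ _ s ((Num.sqrt (T - s))^-1 * M)).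
  + by move=> n; apply: ccontM.
  + move=> p p0 ps; rewrite mulrC; apply: ccvgM; last exact: ccvg_cst.
    by apply: kap_cvg; lra.
  + move=> n p p0 ps; rewrite cmodM; apply: ler_pM; rewrite ?cmod_ge0//; last by apply: hM => //; lra.
    have h1 : 0 < T - s by lra.
    have h2 : T - s <= T - p by lra.
    apply: le_trans (sqrtV_le h1 h2).
    by apply: cmod_kap_le; rewrite ?dn_gt0//; lra.
- move=> n s s0 sT; rewrite cmodM -mulrA; apply: ler_pM; rewrite ?cmod_ge0//.
    by apply: hN => //; exact: ltW.
  have sT0 : 0 <= (Num.sqrt (T - s))^-1 by rewrite invr_ge0 sqrtr_ge0.
  apply: (@le_trans _ _ (2 * (M * (Num.sqrt (T - s))^-1 * s))).
    apply: cmod_cint_cst => //; first exact: ccontM.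
    move=> p p0 ps; rewrite cmodM mulrC; apply: ler_pM; rewrite ?cmod_ge0//.
      by apply: hM => //; lra.
    have h1 : 0 < T - s by lra.
    have h2 : T - s <= T - p by lra.
    apply: le_trans (sqrtV_le h1 h2).
    by apply: cmod_kap_le; rewrite ?dn_gt0//; lra.
  rewrite [leRHS](_ : _ = 2 * (M * (Num.sqrt (T - s))^-1 * T)); last by ring.
  by rewrite ler_pM2l// ler_wpM2l ?mulr_ge0// ltW.
Qed.

Lemma ker32E (a : R) : 0 < a -> ker32 a = (((Num.sqrt a)^-1)%:C) ^+ 3.
Proof.
move=> a0; rewrite /ker32 (_ : 3 / 2 = 2^-1 * 3%:R :> R); last by field.
rewrite powRrM powR12_sqrt ?ltW// powR_mulrn ?sqrtr_ge0//.
by rewrite -rmorphXn /= exprVn.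
Qed.

(** Uniform in [n] and [r], and of the integrable order [(T - s)^(-1/2)]. The constant 4 multiplies
    the factor of [cmod_cintS] by that of [Rint_sqrtV3]. *)
Lemma kconv_bound (c : R -> R[i]) (T M : R) n (s r : R) : ccont c -> 0 <= M ->
  (forall p, 0 <= p -> p <= T -> cmod (c p) <= M) ->
  0 <= r -> r <= s -> s < T ->
  cmod (kconv (dn n) (T - s) c r) <= 4 * M * (Num.sqrt (T - s))^-1.
Proof.
move=> cc M0 hM r0 rs sT.
have a0 : 0 < T - s by rewrite subr_gt0.
pose g p := ((Num.sqrt (Num.max (T - s) (T - s + r - p))) ^+ 3)^-1.
have cg : continuous g.
  move=> p; apply: cvgV; first by rewrite expf_neq0// gt_eqF// sqrtr_gt0 lt_max a0.
  have h := @continuous_sqrt_sub_max R (T - s + r) (T - s) p.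
  apply: (@continuous_comp _ _ _ (fun p => Num.sqrt (Num.max (T - s) (T - s + r - p)))
    (fun y : R => y ^+ 3)) => //.
  exact: exprn_continuous.
have ig : mu.-integrable `[0, r] (EFin \o (fun p => M * g p)).
  by apply: continuous_integrable => p; apply: cvgM; [exact: cvg_cst|exact: cg].
have cf : ccont (fun p => kn n (T - s + r - p) ^+ 3 * c p).
  by apply: ccontM => //; exact: ccontX.
have := @cmod_cintS R `[0, r] _ (fun p => M * g p) (measurable_itv _)
  (cintegrable_cont 0 r cf) ig _.
rewrite RintegralZl//; last exact: continuous_integrable.
move=> h; apply: (le_trans (h _)).
  move=> p; rewrite /= in_itv/= => /andP[p0 pr].
  rewrite cmodM mulrC cmodX; apply: ler_pM; rewrite ?cmod_ge0 ?exprn_ge0 ?cmod_ge0//.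
    by apply: hM => //; lra.
  rewrite /g -exprVn lerXn2r ?nnegrE ?cmod_ge0 ?invr_ge0 ?sqrtr_ge0//.
  have -> : Num.max (T - s) (T - s + r - p) = T - s + r - p by apply/max_idPr; lra.
  by apply: cmod_kap_le; rewrite ?dn_gt0//; lra.
rewrite [leRHS](_ : _ = 2 * (M * (2 / Num.sqrt (T - s)))); last by ring.
rewrite ler_pM2l// ler_wpM2l//.
exact: Rint_sqrtV3.
Qed.

(** For fixed [s < T] the kernel is bounded by [(T - s)^(-3/2)], which suffices for the two inner
    limits but is not integrable in [s]; the outer limit needs the sharper [kconv_bound]. *)
Lemma triple_limit (a b c : R -> R[i]) (T : R) : 0 < T -> ccont a -> ccont b -> ccont c ->
  ccvg (fun n => cint 0 T (fun s => a s * cint 0 s (fun r => b r * kconv (dn n) (T - s) c r)))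
    (cint 0 T (fun s1 => a s1 * cint 0 s1 (fun s2 => b s2
      * cint 0 s2 (fun s3 => c s3 * ker32 (T - s1 + s2 - s3))))).
Proof.
move=> T0 ca cb cc.
have [M [M0 hM]] := ccont_bounded (ltW T0) cc.
have [N [N0 hN]] := ccont_bounded (ltW T0) ca.
have [B [B0 hB]] := ccont_bounded (ltW T0) cb.
have diag (F : R -> R -> R[i]) : ccont (fun p : R * R => F p.1 p.2) ->
    ccont (fun s => cint 0 s (F s)).
  move=> cF.
  exact: (@ccont_comp _ _ _ _ (fun r : R => (r, r)) ltac:(ctsR) (cint_upper_cont cF)).
apply: (@outer_dct _ _ T (N * (2 * (B * (4 * M) * T))) T0).
- move=> n; apply: ccontM => //.
  apply: (diag (fun s r => b r * kconv (dn n) (T - s) c r)).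
  apply: ccontM; first by apply: ccont_comp => //; ctsR.
  exact: kconv_cont2 (dn_gt0 n) T c cc.
- move=> s s0 sT; apply: ccvgM; first exact: ccvg_cst.
  apply: (@inner_dct _ _ s (B * (4 * M * (Num.sqrt (T - s))^-1))).
  + move=> n; apply: ccontM => //; exact: kconv_cont (dn_gt0 n) (T - s) c cc.
  + move=> r r0 rs; apply: ccvgM; first exact: ccvg_cst.
    apply: (@inner_dct _ _ r (M * (Num.sqrt (T - s))^-1 ^+ 3)).
    * by move=> n; apply: ccontM => //; exact: ccontX.
    * move=> p p0 pr; rewrite mulrC ker32E; last by lra.
      apply: ccvgM; last exact: ccvg_cst.
      by apply: ccvgX; apply: kap_cvg; lra.
    * move=> n p p0 pr; rewrite cmodM mulrC; apply: ler_pM; rewrite ?cmod_ge0//.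
        by apply: hM => //; lra.
      rewrite cmodX lerXn2r ?nnegrE ?cmod_ge0 ?invr_ge0 ?sqrtr_ge0//.
      have h1 : 0 < T - s by lra.
      have h2 : T - s <= T - s + r - p by lra.
      apply: le_trans (sqrtV_le h1 h2).
      by apply: cmod_kap_le; rewrite ?dn_gt0//; lra.
  + move=> n r r0 rs; rewrite cmodM; apply: ler_pM; rewrite ?cmod_ge0//.
      by apply: hB => //; lra.
    exact: kconv_bound.
- move=> n s s0 sT; rewrite cmodM.
  rewrite [leRHS](_ : _ = N * (2 * (B * (4 * M) * T) * (Num.sqrt (T - s))^-1)); last by ring.
  apply: ler_pM; rewrite ?cmod_ge0//.
    by apply: hN => //; exact: ltW.
  have sT0 : 0 <= (Num.sqrt (T - s))^-1 by rewrite invr_ge0 sqrtr_ge0.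
  apply: (@le_trans _ _ (2 * (B * (4 * M * (Num.sqrt (T - s))^-1) * s))).
    apply: cmod_cint_cst => //.
      by apply: ccontM => //; exact: kconv_cont (dn_gt0 n) (T - s) c cc.
    move=> r r0 rs; rewrite cmodM; apply: ler_pM; rewrite ?cmod_ge0//.
      by apply: hB => //; lra.
    exact: kconv_bound.
  rewrite [leRHS](_ : _ = 2 * (B * (4 * M * (Num.sqrt (T - s))^-1) * T)); last by ring.
  by rewrite ler_pM2l// ler_wpM2l ?mulr_ge0// ltW.
Qed.

End SingularLimits.

(** * The Gaussian approximate identity and the value of the kernel at time zero *)

Section GaussianLimit.
Context {R : realType}.
Notation mu := (@lebesgue_measure R).

Lemma Rint_cvg_y (f : R -> R) (c : R) : 0 < c -> continuous f ->
  mu.-integrable `[0, +oo[ (EFin \o f) ->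
  Rintegral mu `[0, c * n%:R] f @[n --> \oo] --> Rintegral mu `[0, +oo[ f.
Proof.
move=> c0 cf intf.
pose f_ (n : nat) := f \_ `[0, c * n%:R].
have sub (n : nat) : `[0, c * n%:R]%classic `<=` (`[0, +oo[%classic : set R).
  by move=> x; rewrite /= !in_itv/= andbT => /andP[].
have intn : mu.-integrable `[0, +oo[ (EFin \o (fun x => `|f x|)).
  rewrite (_ : EFin \o _ = abse \o (EFin \o f)) //.
  exact: integrable_abse.
have [|||_] := @Rint_dct R `[0, +oo[ f_ f (fun x => `|f x|) (measurable_itv _) _ _ intn _.
- move=> n; apply/measurable_restrict => //.
  by apply: measurable_funTS; exact: continuous_measurable_fun.
- move=> x; rewrite /= in_itv/= andbT => x0.
  apply: cvg_near_cst; near=> n; rewrite /f_ patchE mem_set//= in_itv/= x0/=.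
  by rewrite mulrC -ler_pdivrMr//; near: n; exact: nbhs_infty_ger.
- move=> n x _; rewrite /f_ patchE.
  by case: ifPn => // _; rewrite normr0.
apply: cvg_trans; apply: near_eq_cvg; near=> n.
by rewrite /f_ -Rintegral_mkcondr setIidr.
Unshelve. all: end_near. Qed.

(** The substitution is made on [[0, c n]] by [Rint_rescale], and [n] then tends to infinity. *)
Lemma Rint_scale_y (g : R -> R) (c : R) : 0 < c -> continuous g ->
  mu.-integrable `[0, +oo[ (EFin \o g) ->
  mu.-integrable `[0, +oo[ (EFin \o (fun y => g (c * y))) ->
  Rintegral mu `[0, +oo[ g = c * Rintegral mu `[0, +oo[ (fun y => g (c * y)).
Proof.
move=> c0 cg ig igc.
have cgc : continuous (fun y => g (c * y)).
  move=> y; apply: (@continuous_comp _ _ _ (fun y => c * y) g); last exact: cg.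
  exact: mulrl_continuous.
have h1 := Rint_cvg_y c0 cg ig.
have h2 := Rint_cvg_y ltr01 cgc igc.
have h3 : c * Rintegral mu `[0, 1 * n%:R] (fun y => g (c * y)) @[n --> \oo] -->
    c * Rintegral mu `[0, +oo[ (fun y => g (c * y)).
  by apply: cvgM => //; exact: cvg_cst.
have e : (fun n : nat => Rintegral mu `[0, c * n%:R] g) =
    (fun n : nat => c * Rintegral mu `[0, 1 * n%:R] (fun y => g (c * y))).
  apply/funext => n; rewrite (Rint_rescale _ cg) (Rint_rescale _ cgc) mul1r.
  have n0 : 0 <= n%:R :> R by [].
  have -> : Num.max (n%:R) 0 = n%:R :> R by apply/max_idPl.
  have -> : Num.max (c * n%:R) 0 = c * n%:R by apply/max_idPl; rewrite mulr_ge0// ltW.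
  rewrite mulrA; congr (_ * _); apply: eq_Rintegral => u _.
  by rewrite mulrA.
rewrite e in h1.
exact: (cvg_unique _ h1 h3).
Qed.

Lemma gauss_integrable : mu.-integrable `[0, +oo[ (EFin \o @gauss_fun R).
Proof. by apply: integrableS integrableT_gauss. Qed.

(** The substitution [x = 2 sqrt (dn n) y] leaves a factor 2, and the half-line Gaussian integral is
    [sqrt pi / 2]; hence the constant. *)
Lemma gauss_limit (u : R -> R) (C : R) : continuous u ->
  (forall x, 0 <= x -> `|u x| <= C * wght x) ->
  (Num.sqrt (dn n))^-1 * Rintegral mu `[0, +oo[ (fun x => expR (- (x ^+ 2 / (4 * dn n))) * u x)
    @[n --> \oo] --> Num.sqrt pi * u 0.
Proof.
move=> cu uC.
have C0 : 0 <= C.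
  have := le_trans (normr_ge0 _) (uC 0 (lexx _)).
  by rewrite /wght addr0 expr1n invr1 mulr1.
have uM x : 0 <= x -> `|u x| <= C.
  by move=> x0; apply: (le_trans (uC x x0)); rewrite ler_piMr// wght_le1.
pose s (n : nat) : R := Num.sqrt (dn n).
have s0 n : 0 < s n by rewrite sqrtr_gt0 dn_gt0.
have ss n : s n ^+ 2 = dn n by rewrite sqr_sqrtr// ltW// dn_gt0.
have intg n : mu.-integrable `[0, +oo[ (EFin \o (fun y => gauss_fun y * u (2 * s n * y))).
  apply: (@le_Rintegrable _ _ _ (fun y => C * gauss_fun y)) => //.
  - apply: measurable_funTS; apply: continuous_measurable_fun => y.
    apply: cvgM; first exact: continuous_gauss_fun.
    apply: (@continuous_comp _ _ _ (fun y => 2 * s n * y) u); last exact: cu.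
    exact: mulrl_continuous.
  - move=> y; rewrite /= in_itv/= andbT => y0.
    rewrite normrM ger0_norm ?gauss_fun_ge0// mulrC ler_wpM2r ?gauss_fun_ge0//.
    by apply: uM; rewrite !mulr_ge0// ltW.
  - rewrite (_ : EFin \o _ = fun y => (C%:E * (gauss_fun y)%:E)%E).
      by apply: integrableZl => //; exact: gauss_integrable.
    by apply/funext => y; rewrite /= EFinM.
have E n : (Num.sqrt (dn n))^-1 *
    Rintegral mu `[0, +oo[ (fun x => expR (- (x ^+ 2 / (4 * dn n))) * u x) =
    2 * Rintegral mu `[0, +oo[ (fun y => gauss_fun y * u (2 * s n * y)).
  have c2 : 0 < 2 * s n by rewrite mulr_gt0.
  have eg y : expR (- ((2 * s n * y) ^+ 2 / (4 * dn n))) * u (2 * s n * y) =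
      gauss_fun y * u (2 * s n * y).
    rewrite /gauss_fun; congr (expR (- _) * _).
    by rewrite -ss; field; rewrite gt_eqF.
  have cgu : continuous (fun x : R => expR (- (x ^+ 2 / (4 * dn n))) * u x).
    move=> x; apply: cvgM; last exact: cu.
    have c1 : - (y ^+ 2 / (4 * dn n)) @[y --> x] --> - (x ^+ 2 / (4 * dn n)).
      by apply: cvgN; apply: cvgM; [exact: exprn_continuous|exact: cvg_cst].
    by apply: continuous_cvg c1; exact: continuous_expR.
  rewrite (@Rint_scale_y _ (2 * s n))//.
  - rewrite -/(s n) mulrA [_ * (2 * s n)](_ : _ = 2); last by field; rewrite gt_eqF.
    by congr (_ * _); apply: eq_Rintegral => y _; rewrite eg.
  - apply: (@decay_integrable _ _ C).
      exact: cgu.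
    move=> x x0; rewrite normrM ger0_norm ?expR_ge0//.
    apply: le_trans (uC x x0); rewrite ler_piMl// -expR0 ler_expR oppr_le0.
    by rewrite divr_ge0 ?sqr_ge0// mulr_ge0// ltW// dn_gt0.
  - have := intg n; rewrite (_ : (fun y => gauss_fun y * _) =
      (fun y => expR (- ((2 * s n * y) ^+ 2 / (4 * dn n))) * u (2 * s n * y)))//.
    by apply/funext => y; rewrite eg.
rewrite (_ : (fun n : nat => _) = (fun n : nat =>
  2 * Rintegral mu `[0, +oo[ (fun y => gauss_fun y * u (2 * s n * y)))); last first.
  by apply/funext => n; exact: E.
rewrite [X in _ --> X](_ : _ = 2 * Rintegral mu `[0, +oo[ (fun y => gauss_fun y * u 0)); last first.
  rewrite RintegralZr//; last exact: gauss_integrable.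
  rewrite {1}/Rintegral integral0y_gauss /=; by field.
apply: cvgM; first exact: cvg_cst.
have scvg : s n @[n --> \oo] --> (0 : R).
  by rewrite -(@sqrtr0 R); apply: sqrt_cvg; exact: dn_cvg.
have iC : mu.-integrable `[0, +oo[ (EFin \o (fun y => C * gauss_fun y)).
  rewrite (_ : EFin \o _ = fun y => (C%:E * (gauss_fun y)%:E)%E).
    by apply: integrableZl => //; exact: gauss_integrable.
  by apply/funext => y; rewrite /= EFinM.
have [||||] := @Rint_dct R `[0, +oo[ (fun n y => gauss_fun y * u (2 * s n * y))
  (fun y => gauss_fun y * u 0) (fun y => C * gauss_fun y) _ _ _ iC _ => //.
- by move=> n; apply/measurable_EFinP; have /integrableP[] := intg n.
- move=> y _; apply: cvgM; first exact: cvg_cst.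
  apply: continuous_cvg; first exact: cu.
  rewrite -[X in _ --> X](mul0r y); apply: cvgM; last exact: cvg_cst.
  rewrite -[X in _ --> X](mulr0 (2 : R)); apply: cvgM => //; exact: cvg_cst.
- move=> n y; rewrite /= in_itv/= andbT => y0.
  rewrite normrM ger0_norm ?gauss_fun_ge0// mulrC ler_wpM2r ?gauss_fun_ge0//.
  by apply: uM; rewrite !mulr_ge0// ltW.
Qed.

Lemma cos_pi4 : cos (pi / 4) = Num.sqrt (2^-1) :> R /\ sin (pi / 4) = Num.sqrt (2^-1) :> R.
Proof.
have p0 := pi_gt0 R.
have cp : 0 < cos (pi / 4 : R) by apply: cos_gt0_pihalf; lra.
have sp : 0 < sin (pi / 4 : R) by apply: sin_gt0_pi; lra.
have e1 : cos (pi / 4) ^+ 2 - sin (pi / 4) ^+ 2 = 0 :> R.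
  rewrite -(cos_pihalf R) (_ : pi / 2 = pi / 4 + pi / 4); last by field.
  by rewrite cosD !expr2.
have e2 := @cos2Dsin2 R (pi / 4).
have ec : cos (pi / 4) ^+ 2 = 2^-1 :> R by lra.
have es : sin (pi / 4) ^+ 2 = 2^-1 :> R by lra.
by split; [rewrite -ec|rewrite -es]; rewrite sqrtr_sqr gtr0_norm.
Qed.

(** This is [(- i d)^(-1/2)] on the chosen branch. Its phase, once divided out, is the origin of the
    factor [exp (- i pi / 4)] in the formulas. *)
Lemma kap_at0 (d : R) : 0 < d -> kap d 0 = ((Num.sqrt d)^-1)%:C * conjc (@e_mipi4 R).
Proof.
move=> d0; have [c4 s4] := cos_pi4.
have r0 : rho d 0 = d by rewrite /rho expr0n add0r sqrtr_sqr gtr0_norm.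
have h : Num.sqrt (d / 2) / d = (Num.sqrt d)^-1 * Num.sqrt (2^-1).
  rewrite sqrtrM ?ltW// -{2}(sqr_sqrtr (ltW d0)).
  by field; rewrite gt_eqF// sqrtr_gt0.
rewrite /kap r0 addr0 subr0 /e_mipi4 cosN sinN c4 s4.
apply: complex_ext; rewrite ?(cReM, cImM, cReC, cImC) /= ?opprK.
- by rewrite mul0r subr0.
- by rewrite mul0r addr0.
Qed.

Lemma gau_at0 (d x : R) : 0 < d -> gau d x 0 = (expR (- (x ^+ 2 / (4 * d))))%:C.
Proof.
move=> d0; rewrite /gau /mu_ kap_sqr// rho_sqr// expr0n add0r mul0r.
have dn0 : d != 0 by rewrite gt_eqF.
rewrite (_ : _ * _ = (- (x ^+ 2 / (4 * d)))%:C).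
  by rewrite /cexp /= cos0 sin0 mulr1 mulr0.
by apply: complex_ext; rewrite ?(cReM, cImM) /=; field.
Qed.

(** The growth [d^(-1/2)] of the kernel at time 0 is exactly the normalization of [gauss_limit]. *)
Lemma initial_limit (w : R -> R[i]) : cdecay w ->
  ccvg (fun n => 2 * kap (dn n) 0 * cintS `[0, +oo[ (fun x => gau (dn n) x 0 * w x))
    (2 * conjc (@e_mipi4 R) * ((Num.sqrt pi)%:C * w 0)).
Proof.
move=> [[w1 w2] [C wC]].
have h : ccvg (fun n => ((Num.sqrt (dn n))^-1)%:C * cintS `[0, +oo[ (fun x => gau (dn n) x 0 * w x))
    ((Num.sqrt pi)%:C * w 0).
  have h1 := @gauss_limit (fun x => complex.Re (w x)) C w1
    (fun x x0 => le_trans (Re_le_cmod _) (wC x x0)).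
  have h2 := @gauss_limit (fun x => complex.Im (w x)) C w2
    (fun x x0 => le_trans (Im_le_cmod _) (wC x x0)).
  have e1 n : complex.Re (((Num.sqrt (dn n))^-1)%:C
      * cintS `[0, +oo[ (fun x => gau (dn n) x 0 * w x)) =
      (Num.sqrt (dn n))^-1 * Rintegral mu `[0, +oo[ (fun x =>
        expR (- (x ^+ 2 / (4 * dn n))) * complex.Re (w x)).
    rewrite cReM /= mul0r subr0; congr (_ * _); apply: eq_Rintegral => x _.
    by rewrite /ReF gau_at0 ?dn_gt0// cReM /= mul0r subr0.
  have e2 n : complex.Im (((Num.sqrt (dn n))^-1)%:C
      * cintS `[0, +oo[ (fun x => gau (dn n) x 0 * w x)) =
      (Num.sqrt (dn n))^-1 * Rintegral mu `[0, +oo[ (fun x =>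
        expR (- (x ^+ 2 / (4 * dn n))) * complex.Im (w x)).
    rewrite cImM /= mul0r addr0; congr (_ * _); apply: eq_Rintegral => x _.
    by rewrite /ImF gau_at0 ?dn_gt0// cImM /= mul0r addr0.
  have e3 : complex.Re ((Num.sqrt pi)%:C * w 0) = Num.sqrt pi * complex.Re (w 0).
    by rewrite cReM /= mul0r subr0.
  have e4 : complex.Im ((Num.sqrt pi)%:C * w 0) = Num.sqrt pi * complex.Im (w 0).
    by rewrite cImM /= mul0r addr0.
  split.
  - by rewrite e3 (funext e1); exact: h1.
  - by rewrite e4 (funext e2); exact: h2.
apply: eq_ccvg (ccvgM (ccvg_cst (2 * conjc (@e_mipi4 R))) h) => n.
by rewrite kap_at0 ?dn_gt0//; ring.
Qed.

End GaussianLimit.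

(** * The limit formula *)

Section LimitFormula.
Context {R : realType}.
Variables (q qx qxx qt : R -> R -> R[i]).
Hypothesis hq : lin_sol q qx qxx qt.
Hypothesis pde : forall x s, 0 <= x -> 0 < s -> @iC R * qt x s + qxx x s = 0.
Variable T : R.
Hypothesis T0 : 0 < T.

Let cq0 : ccont (q 0) := ccont_along2 0 (ls_c hq).
Let cqx0 : ccont (qx 0) := ccont_along2 0 (ls_cx hq).
Let cqt0 : ccont (qt 0) := ccont_along2 0 (ls_ct hq).
Let cabs2 : ccont (fun s => abs2 q 0 s).
Proof. by apply: ccontM => //; exact: ccont_conjc. Qed.

Let diag (F : R -> R -> R[i]) : ccont (fun p : R * R => F p.1 p.2) ->
  ccont (fun s => cint 0 s (F s)).
Proof.
move=> cF.
exact: (@ccont_comp _ _ _ _ (fun r : R => (r, r)) ltac:(ctsR) (cint_upper_cont cF)).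
Qed.

Definition tint (d : R) (a b c : R -> R[i]) : R[i] :=
  cint 0 T (fun s => a s * cint 0 s (fun r => b r * kconv d (T - s) c r)).

Lemma tint_cont d (a b c : R -> R[i]) : 0 < d -> ccont a -> ccont b -> ccont c ->
  ccont (fun s => a s * cint 0 s (fun r => b r * kconv d (T - s) c r)).
Proof.
move=> d0 ca cb cc; apply: ccontM => //.
apply: (diag (F := fun s r => b r * kconv d (T - s) c r)).
apply: ccontM; first by apply: ccont_comp => //; ctsR.
exact: kconv_cont2.
Qed.

Lemma kB_split d s : 0 < d -> kB d q qx (T - s) s =
  cint 0 s (fun r => conjc (q 0 r) * kconv d (T - s) (qx 0) r)
  - cint 0 s (fun r => conjc (qx 0 r) * kconv d (T - s) (q 0) r).
Proof.
move=> d0.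
have k1 : ccont (kconv d (T - s) (q 0)) by exact: kconv_cont.
have k2 : ccont (kconv d (T - s) (qx 0)) by exact: kconv_cont.
rewrite -cintB; [|by ccts fail|by ccts fail].
apply: eq_cint => r _ _.
have alg (i a b c e : R[i]) : i * i = -1 -> i * (a * (i * b) - c * (i * e)) = c * e - a * b.
  by move=> h; transitivity ((i * i) * (a * b - c * e)); [ring|rewrite h; ring].
exact: alg (@iC_sqr R).
Qed.

Lemma kB'_split d s : 0 < d -> kB' d q qx qt (T - s) s =
  - cint 0 s (fun r => conjc (qx 0 r) * kconv d (T - s) (qx 0) r)
  - @iC R * cint 0 s (fun r => conjc (q 0 r) * kconv d (T - s) (qt 0) r).
Proof.
move=> d0.
have k1 : ccont (kconv d (T - s) (qt 0)) by exact: kconv_cont.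
have k2 : ccont (kconv d (T - s) (qx 0)) by exact: kconv_cont.
have c1 : ccont (fun r => conjc (qx 0 r) * kconv d (T - s) (qx 0) r) by ccts fail.
have c2 : ccont (fun r => conjc (q 0 r) * kconv d (T - s) (qt 0) r) by ccts fail.
rewrite -cintN// -cintZ// -cintB; [|exact: ccontN|by apply: ccontM => //; exact: ccont_cst].
apply: eq_cint => r _ _.
have alg (i a b c e : R[i]) : i * i = -1 -> i * (a * (i * b) - c * e) = - (a * b) - i * (c * e).
  by move=> h; transitivity ((i * i) * (a * b) - i * (c * e)); [ring|rewrite h; ring].
exact: alg (@iC_sqr R).
Qed.

(** With shift [T - s] and upper limit [s] the lag is [T - p], no longer depending on [s].
    Integrating by parts yields the square-root kernels of the first two terms of the third
    coefficient. *)
Lemma kconv_diag d s : 0 < d -> 0 <= s ->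
  kconv d (T - s) (q 0) s = 2 * (kap d (T - s) * q 0 s)
    - 2 * cint 0 s (fun p => kap d (T - p) * qt 0 p).
Proof.
move=> d0; rewrite le_eqVlt => /predU1P[<-|s0].
  by rewrite /kconv !cint_ge// (ls_init hq)// !mulr0 subr0.
rewrite /kconv subrK (@kap3_by_parts _ d d0 T s (q 0) (qt 0))//.
- by rewrite mulrA.
- by move=> r r0 _; exact: (ls_dt hq).
- exact: (ls_init hq).
Qed.

Lemma source_cint d : 0 < d -> cint 0 T (source d q qx qt T) =
  @iC R * (2 * cint 0 T (fun s => kap d (T - s) * (abs2 q 0 s * q 0 s))
    - 2 * cint 0 T (fun s => abs2 q 0 s * cint 0 s (fun p => kap d (T - p) * qt 0 p)))
  + (tint d (qx 0) (fun r => conjc (q 0 r)) (qx 0)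
    - tint d (qx 0) (fun r => conjc (qx 0 r)) (q 0))
  + (- tint d (q 0) (fun r => conjc (qx 0 r)) (qx 0)
    - @iC R * tint d (q 0) (fun r => conjc (q 0 r)) (qt 0)).
Proof.
move=> d0.
have ck := kap_sub_cont d0 T.
have cq0c : ccont (fun r => conjc (q 0 r)) by exact: ccont_conjc.
have cqx0c : ccont (fun r => conjc (qx 0 r)) by exact: ccont_conjc.
have t1 := tint_cont d0 cqx0 cq0c cqx0.
have t2 := tint_cont d0 cqx0 cqx0c cq0.
have t3 := tint_cont d0 cq0 cqx0c cqx0.
have t4 := tint_cont d0 cq0 cq0c cqt0.
have x1 : ccont (fun s => kap d (T - s) * (abs2 q 0 s * q 0 s)).
  by apply: ccontM => //; exact: ccontM.
have x2 : ccont (fun s => abs2 q 0 s * cint 0 s (fun p => kap d (T - p) * qt 0 p)).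
  by apply: ccontM => //; apply: ccont_cint; exact: ccontM.
have cZ (z : R[i]) (f : R -> R[i]) : ccont f -> ccont (fun s => z * f s).
  by move=> cf; apply: ccontM => //; exact: ccont_cst.
have cB (f g : R -> R[i]) : ccont f -> ccont g -> ccont (fun s => f s - g s).
  by move=> cf cg; apply: ccontD => //; exact: ccontN.
have e1 := cB _ _ (cZ 2 _ x1) (cZ 2 _ x2).
have e2 := cB _ _ t1 t2.
have e3 := cB _ _ (ccontN t3) (cZ (@iC R) _ t4).
rewrite /tint -(cintZ 0 T x1) -(cintZ 0 T x2) -(cintB 0 T (cZ 2 _ x1) (cZ 2 _ x2)).
rewrite -(cintZ 0 T e1) -(cintB 0 T t1 t2) -(cintN 0 T t3) -(cintZ 0 T t4).
rewrite -(cintB 0 T (ccontN t3) (cZ (@iC R) _ t4)).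
rewrite -(cintD 0 T (cZ _ _ e1) e2) -(cintD 0 T (ccontD (cZ _ _ e1) e2) e3).
apply: eq_cint => s s0 sT.
rewrite /source kB_split// kB'_split// kconv_diag//.
have alg (i a k g c qq x b1 b2 b3 b4 : R[i]) :
  a * (i * (2 * (k * g) - 2 * c)) + x * (b1 - b2) + qq * (- b3 - i * b4) =
  i * (2 * (k * (a * g)) - 2 * (a * c)) + (x * b1 - x * b2) + (- (qq * b3) - i * (qq * b4)).
  by ring.
exact: alg.
Qed.

Definition tlim (a b c : R -> R[i]) : R[i] :=
  cint 0 T (fun s1 => a s1 * cint 0 s1 (fun s2 => b s2
    * cint 0 s2 (fun s3 => c s3 * ker32 (T - s1 + s2 - s3)))).

(** Both sides of [regularized_identity] converge along [dn], and limits are unique. A general [l]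
    lets the same statement cover all three orders. *)
Lemma trace_limit (l : R[i]) (p px pxx pt : R -> R -> R[i]) :
  lin_sol p px pxx pt ->
  (forall x s, 0 <= x -> 0 < s -> @iC R * pt x s + pxx x s = 2 * l * abs2 q x s * q x s) ->
  2 * conjc (@e_mipi4 R) * ((Num.sqrt pi)%:C * (px 0 T + l * (q 0 T * corr q qx 0 0 T))) =
  - (2 * cint 0 T (fun s => pt 0 s * ker12 T s))
  - l * (@iC R * (2 * cint 0 T (fun s => abs2 q 0 s * q 0 s * ker12 T s)
       - 2 * cint 0 T (fun s => abs2 q 0 s * cint 0 s (fun r => qt 0 r * ker12 T r)))
     + (tlim (qx 0) (fun r => conjc (q 0 r)) (qx 0)
       - tlim (qx 0) (fun r => conjc (qx 0 r)) (q 0))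
     + (- tlim (q 0) (fun r => conjc (qx 0 r)) (qx 0)
       - @iC R * tlim (q 0) (fun r => conjc (q 0 r)) (qt 0))).
Proof.
move=> hp ppde.
have cq0c : ccont (fun r => conjc (q 0 r)) by exact: ccont_conjc.
have cqx0c : ccont (fun r => conjc (qx 0 r)) by exact: ccont_conjc.
have hn := nf_half_line (ls_dx hq) (ls_dxx hq) (ls_dt hq) (ls_c hq) (ls_cx hq) (ls_cxx hq)
  (ls_ct hq) (ls_b hq) (ls_bx hq) (ls_bxx hq) (ls_bt hq) pde (ls_init hq).
have [_ [_ c1 _ _ _] [_ e1 _ _] _] := half_line_fun_addZ l (lin_sol_half_line hp) hn.
have := initial_limit (decays_cdecay e1 (ltW T0) (c1 T)).
rewrite nf_y_at0 => L; apply: (ccvg_unique L).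
apply: (@eq_ccvg _ (fun n => - (2 * cint 0 T (fun s => kap (dn n) (T - s) * pt 0 s))
  - l * cint 0 T (source (dn n) q qx qt T))).
  by move=> n; rewrite (regularized_identity (dn_gt0 n) hq pde T0 hp ppde).
have cpt0 := ccont_along2 0 (ls_ct hp).
have cc (z : R[i]) := @ccvg_cst R z.
apply: ccvgB.
  by apply: ccvgN; apply: ccvgM (cc 2) _; exact: single_limit.
apply: ccvgM (cc l) _.
apply: (eq_ccvg (fun n => esym (source_cint (dn_gt0 n)))).
have tl (a b c : R -> R[i]) : ccont a -> ccont b -> ccont c ->
    ccvg (fun n => tint (dn n) a b c) (tlim a b c).
  by move=> *; exact: triple_limit.
apply: ccvgD; first apply: ccvgD.
- apply: ccvgM (cc _) _; apply: ccvgB; apply: ccvgM (cc 2) _.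
  + by apply: single_limit => //; exact: ccontM.
  + exact: double_limit.
- by apply: ccvgB; exact: tl.
- by apply: ccvgB; [apply: ccvgN; exact: tl|apply: ccvgM (cc _) _; exact: tl].
Qed.

End LimitFormula.

(** * From the classical solutions to the abstract setting *)

Section Bridge.
Context {R : realType}.

(** Extends to the endpoint what is given in the open half-line only: the equation for [x > 0] and
    the boundary time derivative for positive times. *)
Lemma ccont_eq_at0 (f g : R -> R[i]) : ccont f -> ccont g ->
  (forall x, 0 < x -> f x = g x) -> forall x, 0 <= x -> f x = g x.
Proof.
move=> [f1 f2] [g1 g2] fg x; rewrite le_eqVlt => /predU1P[<-|]; last exact: fg.
have h (u v : R -> R) : continuous u -> continuous v ->
    (forall x, 0 < x -> u x = v x) -> u 0 = v 0.
  move=> cu cv uv.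
  have hu : u x @[x --> 0^'+] --> u 0 by apply: cvg_at_right_filter; exact: cu.
  have hv : v x @[x --> 0^'+] --> v 0 by apply: cvg_at_right_filter; exact: cv.
  have hv' : v x @[x --> 0^'+] --> u 0.
    apply: cvg_trans hu; apply: near_eq_cvg; near=> y.
    by apply: uv; near: y; exact: nbhs_right_gt.
  exact: (cvg_unique _ hv' hv).
apply: complex_ext.
- by apply: (h _ _ f1 g1) => y y0; rewrite fg.
- by apply: (h _ _ f2 g2) => y y0; rewrite fg.
Unshelve. all: end_near. Qed.

Lemma forced_lin_sol (F : R -> R -> R[i]) (g : R -> R[i]) (q : R -> R -> R[i]) :
  forced_lin_schr F g q -> lin_sol q (dx q) (dxx q) (dt q).
Proof.
move=> [[d1 [d2 [d3 [c0 [c1 [c2 ct]]]]]] [dec [pde [i0 b0]]]].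
have bnd T : 0 < T -> exists C, forall x s, 0 <= x -> 0 <= s -> s <= T ->
    [/\ cmod (q x s) <= C * wght x, cmod (dx q x s) <= C * wght x,
      cmod (dxx q x s) <= C * wght x & cmod (dt q x s) <= C * wght x].
  move=> T0; have [C hC] := dec T T0; exists C => x s x0 s0 sT.
  have alg (a b c e D : R) : 0 <= a -> 0 <= b -> 0 <= c -> 0 <= e -> a + b + c + e <= D ->
      [/\ a <= D, b <= D, c <= D & e <= D] by move=> *; split; lra.
  apply: alg (hC x s x0 (introT andP (conj s0 sT))); exact: cmod_ge0.
split.
- by move=> x s; exact: cderivableP (d1 x s).
- by move=> x s; exact: cderivableP (d2 x s).
- by move=> x s; exact: cderivableP (d3 x s).
- exact: c0.
- exact: c1.
- exact: c2.
- exact: ct.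
- by move=> T T0; have [C hC] := bnd T T0; exists C => x s x0 s0 sT; have [] := hC x s x0 s0 sT.
- by move=> T T0; have [C hC] := bnd T T0; exists C => x s x0 s0 sT; have [] := hC x s x0 s0 sT.
- by move=> T T0; have [C hC] := bnd T T0; exists C => x s x0 s0 sT; have [] := hC x s x0 s0 sT.
- by move=> T T0; have [C hC] := bnd T T0; exists C => x s x0 s0 sT; have [] := hC x s x0 s0 sT.
- exact: i0.
Qed.

Lemma forced_pde (F : R -> R -> R[i]) (g : R -> R[i]) (q : R -> R -> R[i]) :
  forced_lin_schr F g q -> (forall s, ccont (F ^~ s)) ->
  forall x s, 0 <= x -> 0 < s -> @iC R * dt q x s + dxx q x s = F x s.
Proof.
move=> hq cF x s x0 s0; have ls := forced_lin_sol hq.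
have [_ [_ [pde _]]] := hq.
apply: (@ccont_eq_at0 (fun x => @iC R * dt q x s + dxx q x s) (F ^~ s)) => //.
- apply: ccontD; last exact: ccont_along1 (ls_cxx ls).
  by apply: ccontM; [exact: ccont_cst|exact: ccont_along1 (ls_ct ls)].
- by move=> y y0; exact: pde.
Qed.

Lemma csmooth_cder (g : R -> R[i]) x : csmooth g -> is_cder g x (cderive g x).
Proof. by move=> hg; apply: cderivableP; exact: hg 0%N x. Qed.

Lemma csmooth_cderive_cont (g : R -> R[i]) : csmooth g -> ccont (cderive g).
Proof.
move=> hg; split => x.
- have [h _] := hg 1%N x; rewrite derive1n1 in h.
  by have /derivable1_diffP/differentiable_continuous := h.
- have [_ h] := hg 1%N x; rewrite derive1n1 in h.
  by have /derivable1_diffP/differentiable_continuous := h.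
Qed.

(** The trace agrees with [g] at nonnegative times only, so two-sided derivatives can be compared at
    positive times; time 0 follows by continuity. *)
Lemma boundary_time_derivative (q qx qxx qt : R -> R -> R[i]) (g : R -> R[i]) :
  lin_sol q qx qxx qt -> csmooth g -> (forall t, 0 <= t -> q 0 t = g t) ->
  forall s, 0 <= s -> qt 0 s = cderive g s.
Proof.
move=> hq hg qg; apply: ccont_eq_at0.
- exact: ccont_along2 (ls_ct hq).
- exact: csmooth_cderive_cont.
move=> s s0.
have [h1 h2] := ls_dt hq 0 s; have [g1 g2] := csmooth_cder s hg.
have ne : \forall z \near s, q 0 z = g z.
  near=> z; apply: qg; apply: ltW; near: z; exact: lt_nbhsr.
apply: complex_ext.
- have n1 : \forall z \near s, ReF (q 0) z = ReF g z.
    by apply: filterS ne => z; rewrite /ReF => ->.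
  have [_ <-] := near_eq_is_derive n1 h1.
  by have [_ <-] := g1.
- have n2 : \forall z \near s, ImF (q 0) z = ImF g z.
    by apply: filterS ne => z; rewrite /ImF => ->.
  have [_ <-] := near_eq_is_derive n2 h2.
  by have [_ <-] := g2.
Unshelve. all: end_near. Qed.

Lemma e_mipi4_unit : @e_mipi4 R * conjc (@e_mipi4 R) = 1.
Proof.
have h := @cos2Dsin2 R (- (pi / 4)).
rewrite (_ : 1 = 1%:C)//; apply: complex_ext; rewrite ?(cReM, cImM, cReC, cImC).
- by rewrite [RHS]/= -h /=; ring.
- by rewrite [RHS]/= /=; ring.
Qed.

End Bridge.

(** * Solving for the Neumann coefficients *)

Lemma solve_first_order {F : fieldType} (sp Eb E X W : F) : 2 != 0 :> F ->
  E * Eb = 1 -> sp != 0 -> Eb != 0 ->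
  2 * Eb * (sp * W) = - (2 * X) -> W = - (E / sp) * X.
Proof.
move=> two0 eE sp0 Eb0 h; have n0 : 2 * Eb * sp != 0 by rewrite !mulf_neq0.
apply: (mulfI n0); rewrite -[LHS]mulrA h.
transitivity (- (2 * X) * (E * Eb)); first by rewrite eE mulr1.
by field.
Qed.

(** Every integral is an opaque field element, so the comparison with the stated formula is pure
    algebra: [E] is the inverse of [Eb], [1 / i = - i] and [C / PI = E / (2 sp)]. Primed variables
    are integrals of traces of the solutions, unprimed ones integrals of the prescribed data. *)
Lemma solve_third_order {F : fieldType}
  (l sp Eb E i PI C G Q Z x1' x2' x3' T1' T2' T3' T4' T1 T2 T3 T4 x1 x2 x3 x4 g q0 : F) :
  2 != 0 :> F -> E * Eb = 1 -> i * i = -1 -> sp != 0 -> Eb != 0 -> i != 0 ->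
  PI = sp * sp -> C = sp / 2 * E -> x1' = x1 -> x2' = x2 -> x3' = x3 ->
  T1' = T1 -> T2' = T2 -> T3' = T3 -> T4' = T4 -> Q = q0 -> Z = i * - x4 -> G = g ->
  2 * Eb * (sp * (G + l * (Q * Z))) = - (2 * x3')
    - l * (i * (2 * x1' - 2 * x2') + (T3' - T4') + (- T2' - i * T1')) ->
  g = 2 * l * C / (PI * i) * x1 - 2 * l * C / (PI * i) * x2
    - 2 * C / PI * x3 - l * C / (PI * i) * T1
    + l * C / PI * T2 - l * C / PI * T3
    + l * C / PI * T4 + i * l * q0 * x4.
Proof.
move=> two0 eE' ii sp0' Eb0 i0 -> -> -> -> -> -> -> -> -> -> -> -> h.
have iV : i^-1 = - i by apply: (mulfI i0); rewrite divff// mulrN ii opprK.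
have -> : E = Eb^-1 by apply: (mulIf Eb0); rewrite eE' mulVf.
have n0 : 2 * Eb * sp != 0 by rewrite !mulf_neq0.
apply: (mulfI n0); rewrite !invfM iV.
transitivity (2 * Eb * (sp * (g + l * (q0 * (i * - x4)))) + 2 * Eb * sp * (i * l * q0 * x4)).
  by ring.
rewrite h; field.
by rewrite sp0' Eb0.
Qed.

Theorem theorem5p1 (R : realType) (lam : R) (g01 g02 g03 : R -> R[i])
  (q1 q2 q3 : R -> R -> R[i]) :
  (lam = 1 \/ lam = -1) ->
  csmooth g01 -> csmooth g02 -> csmooth g03 ->
  cflat_at0 g01 -> cflat_at0 g02 -> cflat_at0 g03 ->
  perturbative_sol lam g01 g02 g03 q1 q2 q3 ->
  let g11 := fun t => dx q1 0 t in
  let g12 := fun t => dx q2 0 t in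
  let g13 := fun t => dx q3 0 t in
  let c := @c_nls R in
  let l := lam%:C in
  forall t : R, 0 < t ->
    g11 t = - (@e_mipi4 R / (Num.sqrt pi)%:C)
              * cint 0 t (fun s => cderive g01 s * ker12 t s)
 /\ g12 t = - (@e_mipi4 R / (Num.sqrt pi)%:C)
              * cint 0 t (fun s => cderive g02 s * ker12 t s)
 /\ g13 t =
      2 * l * c / (pi%:C * @iC R)
        * cint 0 t (fun s => g01 s * conjc (g01 s) * g01 s * ker12 t s)
    - 2 * l * c / (pi%:C * @iC R)
        * cint 0 t (fun s => g01 s * conjc (g01 s)
                     * cint 0 s (fun r => cderive g01 r * ker12 t r))
    - 2 * c / pi%:C
        * cint 0 t (fun s => cderive g03 s * ker12 t s)
    - l * c / (pi%:C * @iC R)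
        * cint 0 t (fun s1 => g01 s1 * cint 0 s1 (fun s2 => conjc (g01 s2)
            * cint 0 s2 (fun s3 => cderive g01 s3 * ker32 (t - s1 + s2 - s3))))
    + l * c / pi%:C
        * cint 0 t (fun s1 => g01 s1 * cint 0 s1 (fun s2 => conjc (g11 s2)
            * cint 0 s2 (fun s3 => g11 s3 * ker32 (t - s1 + s2 - s3))))
    - l * c / pi%:C
        * cint 0 t (fun s1 => g11 s1 * cint 0 s1 (fun s2 => conjc (g01 s2)
            * cint 0 s2 (fun s3 => g11 s3 * ker32 (t - s1 + s2 - s3))))
    + l * c / pi%:C
        * cint 0 t (fun s1 => g11 s1 * cint 0 s1 (fun s2 => conjc (g11 s2)
            * cint 0 s2 (fun s3 => g01 s3 * ker32 (t - s1 + s2 - s3))))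
    + @iC R * l * g01 t
        * cint 0 t (fun s => conjc (g01 s) * g11 s - conjc (g11 s) * g01 s).
Proof.
move=> _ s1 s2 s3 _ _ _ [h1 [h2 h3]] g11 g12 g13 c l t t0.
have c0 : forall s : R, ccont ((fun _ _ : R => 0 : R[i]) ^~ s).
  by move=> s; exact: ccont_cst.
have ls1 := forced_lin_sol h1; have ls2 := forced_lin_sol h2; have ls3 := forced_lin_sol h3.
have p1 := forced_pde h1 c0; have p2 := forced_pde h2 c0.
have cq1 (s : R) : ccont (q1 ^~ s) := ccont_along1 s (ls_c ls1).
have p3 : forall x s, 0 <= x -> 0 < s ->
    @iC R * dt q3 x s + dxx q3 x s = 2 * l * abs2 q1 x s * q1 x s.
  move=> x s x0 s0; rewrite (forced_pde h3)//.
    by rewrite /abs2 rmorphM /= rmorph_nat.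
  move=> r; apply: ccontM => //; apply: ccontM; first exact: ccont_cst.
  by apply: ccontM => //; exact: ccont_conjc.
have b1 : forall s, 0 <= s -> q1 0 s = g01 s by case: h1 => _ [_ [_ [_ h]]].
have b2 : forall s, 0 <= s -> q2 0 s = g02 s by case: h2 => _ [_ [_ [_ h]]].
have b3 : forall s, 0 <= s -> q3 0 s = g03 s by case: h3 => _ [_ [_ [_ h]]].
have e1 := boundary_time_derivative ls1 s1 b1.
have e2 := boundary_time_derivative ls2 s2 b2.
have e3 := boundary_time_derivative ls3 s3 b3.
(* The two linear orders are the case of coupling 0, where the normal form and all cubic terms drop
   out of [trace_limit]. *)
have z1 : forall x s, 0 <= x -> 0 < s ->
    @iC R * dt q1 x s + dxx q1 x s = 2 * 0 * abs2 q1 x s * q1 x s.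
  by move=> x s x0 s0; rewrite p1// mulr0 !mul0r.
have z2 : forall x s, 0 <= x -> 0 < s ->
    @iC R * dt q2 x s + dxx q2 x s = 2 * 0 * abs2 q1 x s * q1 x s.
  by move=> x s x0 s0; rewrite p2// mulr0 !mul0r.
have L1 := trace_limit ls1 p1 t0 ls1 z1.
have L2 := trace_limit ls1 p1 t0 ls2 z2.
have L3 := trace_limit ls1 p1 t0 ls3 p3.
have eE := @e_mipi4_unit R.
have sp0 : (Num.sqrt pi)%:C != 0 :> R[i].
  by apply/eqP => -[/eqP]; rewrite gt_eqF// sqrtr_gt0 pi_gt0.
have spE : pi%:C = (Num.sqrt pi)%:C * (Num.sqrt pi)%:C :> R[i].
  by rewrite -rmorphM -expr2 sqr_sqrtr// pi_ge0.
have E0 : conjc (@e_mipi4 R) != 0.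
  by apply/eqP => E0; move: eE; rewrite E0 mulr0 => /eqP; rewrite eq_sym oner_eq0.
have two0 : 2 != 0 :> R[i] by rewrite pnatr_eq0.
have solve_for (X W : R[i]) : 2 * conjc (@e_mipi4 R) * ((Num.sqrt pi)%:C * W) = - (2 * X) ->
    W = - (@e_mipi4 R / (Num.sqrt pi)%:C) * X.
  exact: solve_first_order.
have first_order (qj : R -> R -> R[i]) (gj : R -> R[i]) :
    (forall s, 0 <= s -> dt qj 0 s = cderive gj s) ->
    cint 0 t (fun s => dt qj 0 s * ker12 t s) = cint 0 t (fun s => cderive gj s * ker12 t s).
  by move=> e; apply: eq_cint => s s0 _; rewrite e.
split.
  move: L1; rewrite !mul0r subr0 addr0 (first_order _ _ e1); exact: solve_for.
split.
  move: L2; rewrite !mul0r subr0 addr0 (first_order _ _ e2); exact: solve_for.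
have i2 := @iC_sqr R.
have X1 : cint 0 t (fun s => abs2 q1 0 s * q1 0 s * ker12 t s) =
    cint 0 t (fun s => g01 s * conjc (g01 s) * g01 s * ker12 t s).
  by apply: eq_cint => s s0 _; rewrite /abs2 (b1 s s0).
have X2 : cint 0 t (fun s => abs2 q1 0 s * cint 0 s (fun r => dt q1 0 r * ker12 t r)) =
    cint 0 t (fun s => g01 s * conjc (g01 s) * cint 0 s (fun r => cderive g01 r * ker12 t r)).
  apply: eq_cint => s s0 _; rewrite /abs2 (b1 s s0).
  by rewrite (@eq_cint _ 0 s _ (fun r => cderive g01 r * ker12 t r))// => r r0 _; rewrite (e1 r r0).
have X3 := first_order _ _ e3.
have tlimE (a b d a' b' d' : R -> R[i]) : (forall s, 0 <= s -> a s = a' s) ->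
    (forall s, 0 <= s -> b s = b' s) -> (forall s, 0 <= s -> d s = d' s) ->
    tlim t a b d = tlim t a' b' d'.
  move=> ea eb ed; apply: eq_cint => s s0 _; rewrite (ea s s0); apply: (congr1 (fun z => a' s * z)).
  apply: eq_cint => r r0 _; rewrite (eb r r0); apply: (congr1 (fun z => b' r * z)).
  by apply: eq_cint => p p0' _; rewrite (ed p p0').
have cb1 : forall s, 0 <= s -> conjc (q1 0 s) = conjc (g01 s) by move=> s s0; rewrite b1.
have rfl (f : R -> R[i]) : forall s, 0 <= s -> f s = f s by [].
have Y1 := tlimE _ _ _ g11 (fun s => conjc (g01 s)) g11 (rfl _) cb1 (rfl _).
have Y2 := tlimE _ _ _ g11 (fun s => conjc (g11 s)) g01 (rfl _) (rfl _) b1.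
have Y3 := tlimE _ _ _ g01 (fun s => conjc (g11 s)) g11 b1 (rfl _) (rfl _).
have Y4 := tlimE _ _ _ g01 (fun s => conjc (g01 s)) (cderive g01) b1 cb1 e1.
have cq0 : ccont (q1 0) := ccont_along2 0 (ls_c ls1).
have cqx0 : ccont (dx q1 0) := ccont_along2 0 (ls_cx ls1).
(* At the origin [corr] is the mass of [q1] on the half-line, expressed by the flux through the
   boundary; the bracket in the formula is this flux with the opposite sign. *)
have X4 : corr q1 (dx q1) 0 0 t =
    @iC R * - cint 0 t (fun s => conjc (g01 s) * g11 s - conjc (g11 s) * g01 s).
  rewrite /corr; congr (_ * _).
  rewrite (@eq_cint _ 0 t (fun s => conjc (g01 s) * g11 s - conjc (g11 s) * g01 s)
    (fun s => conjc (q1 0 s) * dx q1 0 s - conjc (dx q1 0 s) * q1 0 s)); last first.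
    by move=> s s0 _; rewrite (b1 s s0).
  rewrite -cintN; last by ccts fail.
  by apply: eq_cint => s _ _; rewrite opprB.
have cE : c = (Num.sqrt pi)%:C / 2 * @e_mipi4 R.
  by rewrite /c /c_nls; congr (_ * _); rewrite rmorphM /= fmorphV rmorph_nat.
have Xb := b1 t (ltW t0).
exact: (solve_third_order two0 eE i2 sp0 E0 (@iC_neq0 R)
  spE cE X1 X2 X3 Y4 Y3 Y1 Y2 Xb X4 erefl L3).
Qed.
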